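(* Let $\{a_j \}_{j \in \mathbb{Z}}$ be a sequence of complex numbers with \[ \sum_{j \in \mathbb{Z}} |j a_j| < \infty. \] Let $k_n$ be a sequence of non-negative integers that converges to $k \in [0 , \infty]$ as $n \to \infty$ and satisfies $k_n = o( n/\log n)$. Let $A$ be the $n \times n$ Toeplitz matrix with symbol $\{a_j \}_{j \in \mathbb{Z}}$ truncated at $k_n$, and take $\gamma > 0$. Let $E$ be an $n \times n$ random matrix which satisfies: (1) there exists $\alpha \geq 0$ so that $\|E\| = O(n^\alpha)$ with probability $1 - o(1)$; and (2) for almost every $z \in \mathbb{C}$, there exists $\kappa_z > 0$ so that \[ \mathbb{P} (\sigma_{\min}(A + n^{-\alpha - \gamma}E - zI) \leq n^{-\kappa_z} ) = o(1). \] Then there exists a (deterministic) probability measure $\mu$ on $\mathbb{C}$ so that the empirical spectral measure $\mu_{A + n^{-\alpha - \gamma} E}$ of $A + n^{-\alpha - \gamma} E$ converges weakly in probability to $\mu$ as $n\to\infty$. Moreover, $\mu$ is the distribution of \[ \sum_{|j| \leq k} a_j U^j, \] where $U$ is a random variable uniformly distributed on the unit circle $S^1=\{z\in\mathbb{C}:|z|=1\}$, with the convention that if $k = \infty$ the sum is $\sum_{j \in \mathbb{Z}} a_j U^j$.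
   Context: The $n\times n$ Toeplitz matrix with symbol $\{a_j\}_{j\in\mathbb{Z}}$ truncated at an integer $k\ge0$ is the matrix $A=(A_{ij})_{i,j=1}^n$ with $A_{ij}=a_{i-j}$ if $|i-j|\le k$ and $A_{ij}=0$ if $|i-j|>k$. Sums over $|j|\le k$ are over integers $j$. $\|M\|$ is the spectral norm, $\sigma_{\min}(M)$ the smallest singular value, and $I$ the identity matrix. ''Almost every'' refers to Lebesgue measure on $\mathbb{C}$. The empirical spectral measure of an $n\times n$ matrix $M$ is $\mu_M=\frac1n\sum_{j=1}^n\delta_{\lambda_j(M)}$, where $\lambda_j(M)$ are the eigenvalues counted with algebraic multiplicity. Asymptotic notation is as $n\to\infty$; ''$\|E\|=O(n^\alpha)$ with probability $1-o(1)$'' means that there is a constant $C$ independent of $n$ with $\mathbb{P}(\|E\|\le Cn^\alpha)\to1$. Random measures $\mu_n$ converge weakly in probability to $\mu$ if $\int g\,d\mu_n\to\int g\,d\mu$ in probability for every bounded continuous $g:\mathbb{C}\to\mathbb{C}$. *)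

(* Defs.v *)
From HB Require Import structures.
From mathcomp Require Import all_boot all_order all_algebra.
From mathcomp Require Import all_classical all_reals all_analysis.
From mathcomp Require Export complex.

Set Implicit Arguments.
Unset Strict Implicit.
Unset Printing Implicit Defensive.

Import Order.TTheory GRing.Theory Num.Theory.
Import numFieldNormedType.Exports.
Export Normc.
Local Open Scope classical_set_scope.
Local Open Scope ring_scope.
Local Open Scope complex_scope.

(* R[i]^o is R[i] with the topology of its modulus; [`|z|] lives in R[i],
   so the R-valued modulus [normc z] is used for real inequalities. *)
Definition borelC (R : realType) := g_sigma_algebraType (@open R[i]^o).

HB.instance Definition _ (R : realType) := Measurable.on (borelC R).

Section Matrices.
Variable R : realType.
Implicit Types n : nat.

Definition toeplitz (a : int -> R[i]) (k n : nat) : 'M[R[i]]_n :=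
  \matrix_(i < n, j < n)
    (if (`|i%:Z - j%:Z| <= k)%N then a (i%:Z - j%:Z) else 0).

Definition eigenvalues n (M : 'M[R[i]]_n) : seq R[i] :=
  sval (closed_field_poly_normal (char_poly M)).

Definition l2norm n (x : 'cV[R[i]]_n) : R :=
  Num.sqrt (\sum_i normc (x i 0) ^+ 2).

Definition spectral_norm n (M : 'M[R[i]]_n) : R :=
  sup [set l2norm (M *m x) | x in [set x : 'cV[R[i]]_n | l2norm x <= 1]].

Definition singular_values n (M : 'M[R[i]]_n) : seq R :=
  [seq Num.sqrt (complex.Re l) | l <- eigenvalues ((map_mx Num.conj M)^T *m M)].

(* The infimum of a finite nonempty set, hence a minimum (it is 0 for n = 0). *)
Definition sigma_min n (M : 'M[R[i]]_n) : R := inf [set` singular_values M].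

Definition esm n (M : 'M[R[i]]_n) : {measure set (borelC R) -> \bar R} :=
  mscale ((n%:R : R)^-1)%:nng
    (msum (fun i => \d_((eigenvalues M)`_i : borelC R)) n).

Definition perturbed (alpha gamma : R) n (A E : 'M[R[i]]_n) : 'M[R[i]]_n :=
  A + ((n%:R : R) `^ (- alpha - gamma))%:C *: E.

End Matrices.

Section Measures.
Variable R : realType.

Definition cintegral (mu : {measure set (borelC R) -> \bar R})
    (g : R[i] -> R[i]) : R[i] :=
  (\int[mu]_z complex.Re (g z))%R +i* (\int[mu]_z complex.Im (g z))%R.

Definition cvg_weakly_in_prob (d : nat -> measure_display)
    (T : forall n, measurableType (d n)) (P : forall n, probability (T n) R)
    (mu_ : forall n, T n -> {measure set (borelC R) -> \bar R})
    (mu : {measure set (borelC R) -> \bar R}) : Prop :=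
  forall g : R[i]^o -> R[i]^o, continuous g ->
    (exists B : R, forall z, normc (g z) <= B) ->
    forall eps : R, 0 < eps ->
      P n [set w | eps < normc (cintegral (mu_ n w) g - cintegral mu g)]
        @[n --> \oo] --> 0%E.

Lemma twopi_gt0 : 0 < 2 * pi :> R.
Proof. by rewrite mulr_gt0 ?pi_gt0. Qed.

Definition expi (t : R) : R[i] := cos t +i* sin t.

Definition uniform_on_circle d (W : measurableType d) (Q : probability W R)
    (U : {RV Q >-> borelC R}) : Prop :=
  (forall w, normc (U w) = 1) /\
  forall B : set (borelC R), measurable B ->
    distribution Q U B = uniform_prob twopi_gt0 (expi @^-1` B).

(* The sum of a_j u^j over the integers j with |j| <= k, where k may be +oo:
   limit as N -> oo of the sum over |j| <= min(N, k), indexed by j = m - N. *)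
Definition laurent_sum (a : int -> R[i]) (k : \bar R) (u : R[i]) : R[i] :=
  limn ((fun N : nat =>
    \sum_(0 <= m < N.*2.+1 | ((`|m%:Z - N%:Z|%N)%:R%:E <= k)%E)
       a (m%:Z - N%:Z) * u ^ (m%:Z - N%:Z)) : nat -> R[i]^o).

End Measures.

(* Main.v *)
(* Up to a matrix of rank at most 2 k_n, the truncated Toeplitz matrix is a
   circulant one, i.e. the discrete Fourier transform conjugates it to the
   diagonal matrix of the values f_n(w^l) of the truncated symbol at the n-th
   roots of unity.  For h(x) = ln (1 + s / |x|^4), Schur triangularization bounds
   the sum of h(l - z) over the eigenvalues l of M by
     ln det (s + Y* Y) - 2 ln |det Y|   with Y = (M - z)^2,
   and both determinants are compared with those of the circulant matrix: the
   small noise costs o(n), and rank O(k_n) costs O(k_n ln n) = o(n) because the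
   smallest singular value of M - z is at least polynomially small.  Hence, for
   z off the limit curve and in the full-measure set where (2) holds, the mean
   of h(l - z) over the spectrum is at most its mean over the nodes f_n(w^l),
   up to o(1).  A combination of such kernels, with nonnegative coefficients
   g(z) and one admissible z in each cell of a fine grid, approximates a given
   g >= 0 (uniformly from below, and from above at points not too close to the
   z's), so the mean of g over the spectrum is at most its mean over the nodes,
   up to o(1).  Applying this to B + g and B - g gives equality in the limit,
   and the means over the nodes are Riemann sums for the integral of g against
   the law of the symbol on the circle. *)
Require Import Defs.
From mathcomp Require Import all_boot all_order all_algebra.
From mathcomp Require Import all_classical all_reals all_analysis.
From mathcomp Require Import measurable_realfun ring lra zify.
Set Implicit Arguments.
Unset Strict Implicit.
Unset Printing Implicit Defensive.
Import Order.TTheory GRing.Theory Num.Theory.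
Import numFieldNormedType.Exports.
Local Open Scope classical_set_scope.
Local Open Scope ring_scope.
Local Open Scope complex_scope.

(** * Operator bounds and determinants *)

Section LinearAlgebra.
Variable R : realType.
Local Notation C := R[i].
Implicit Types (z : C).

(** Two features of the kernel shape the proof. Positivity: for a non-normal matrix,
    triangularization controls the determinant of [s + Y* Y] from one side only, so an inequality is
    sought for a kernel that can be averaged with nonnegative weights; the missing half comes from
    the two point sets having the same number [n] of points. The exponent 4: built on [M - z] alone,
    the kernel would decay like [1 / |x|^2], which is not integrable over the plane, and distant
    grid points would weigh as much as close ones; squaring [M - z] repairs this. The shift by [s]
    bounds the Gram determinant's matrix from below whatever the perturbation, so there a change of
    rank [r] costs only a multiple of [r]; the smallest singular value enters through [|det Y|]
    alone. The pole of the kernel is logarithmic, but an eigenvalue may come arbitrarily close to a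
    grid point. The spectrum is therefore used only where the kernel sum has to be bounded from
    below, and the bound from above is asked at the nodes, which are deterministic and can be kept
    away from the grid points. *)

Lemma normc_ge0 z : 0 <= normc z.
Proof. by case: z => a b; apply: sqrtr_ge0. Qed.

Lemma normc_eq0 z : (normc z == 0) = (z == 0).
Proof. by apply/eqP/eqP => [/eq0_normc//|->]; rewrite normc0. Qed.

Lemma normc_gt0 z : (0 < normc z) = (z != 0).
Proof. by rewrite lt_def normc_ge0 normc_eq0 andbT. Qed.

Lemma normcE z : `|z| = (normc z)%:C.
Proof. by case: z => a b; rewrite normc_def. Qed.

Lemma sqr_normc_conj z : (normc z ^+ 2)%:C = Num.conj z * z.
Proof. by rewrite -normCKC normcE -rmorphXn. Qed.

Lemma normcB z1 z2 : normc (z1 - z2) = normc (z2 - z1).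
Proof. by rewrite -(opprB z2) normcN. Qed.

Lemma le_normcB z1 z2 : normc (z1 - z2) <= normc z1 + normc z2.
Proof. by rewrite -[X in _ <= _ + X]normcN; apply: le_normcD. Qed.

Lemma ler_normc_distD z2 z1 z3 :
  normc (z1 - z3) <= normc (z1 - z2) + normc (z2 - z3).
Proof. by apply: le_trans (le_normcD _ _); rewrite addrA subrK. Qed.

Lemma normcX z m : normc (z ^+ m) = normc z ^+ m.
Proof. by elim: m => [|m IH]; rewrite ?normc1// !exprS normcM IH. Qed.

Lemma normcC (x : R) : normc x%:C = `|x|.
Proof. by rewrite /normc /= expr0n addr0 sqrtr_sqr. Qed.

Lemma normc_prod (I : Type) (s : seq I) (F : I -> C) :
  normc (\prod_(i <- s) F i) = \prod_(i <- s) normc (F i).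
Proof. by elim/big_rec2: _ => [|i x y _ <-]; rewrite ?normc1 ?normcM. Qed.

Lemma le_normc_sum (I : Type) (s : seq I) (P : pred I) (F : I -> C) :
  normc (\sum_(i <- s | P i) F i) <= \sum_(i <- s | P i) normc (F i).
Proof.
elim/big_rec2: _ => [|i x y _ IH]; first by rewrite normc0.
by apply: le_trans (le_normcD _ _) _; rewrite lerD2l.
Qed.

Lemma normc_conj z : normc (Num.conj z) = normc z.
Proof.
by apply: (@complexI R); rewrite -!normcE norm_conjC.
Qed.

Lemma ler_prod_seq (I : eqType) (s : seq I) (F G : I -> R) :
  {in s, forall i, 0 <= F i <= G i} ->
  \prod_(i <- s) F i <= \prod_(i <- s) G i.
Proof.
move=> h; rewrite big_seq [leRHS]big_seq.
suff /andP[] : 0 <= \prod_(i <- s | i \in s) F i <= \prod_(i <- s | i \in s) G i by [].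
elim/big_rec2: _ => [|i x y is_ /andP[x0 xy]]; first by rewrite ler01 lexx.
have /andP[f0 fg] := h i is_.
by rewrite mulr_ge0//= ler_pM.
Qed.

Definition adj m n (M : 'M[C]_(m, n)) := (map_mx Num.conj M)^T.

Lemma adjM m n p (A : 'M[C]_(m, n)) (B : 'M[C]_(n, p)) :
  adj (A *m B) = adj B *m adj A.
Proof. by rewrite /adj map_mxM trmx_mul. Qed.

Lemma adjK m n (A : 'M[C]_(m, n)) : adj (adj A) = A.
Proof. by apply/matrixP => i j; rewrite !mxE conjCK. Qed.

Lemma adjD m n (A B : 'M[C]_(m, n)) : adj (A + B) = adj A + adj B.
Proof. by apply/matrixP => i j; rewrite !mxE rmorphD. Qed.

Lemma adj1 n : adj (1%:M : 'M[C]_n) = 1%:M.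
Proof. by apply/matrixP => i j; rewrite !mxE rmorph_nat eq_sym. Qed.

Definition sqn n (x : 'cV[C]_n) : R := \sum_i normc (x i 0) ^+ 2.

Lemma sqn_ge0 n (x : 'cV[C]_n) : 0 <= sqn x.
Proof. by apply: sumr_ge0 => i _; apply: sqr_ge0. Qed.

Lemma sqn_adj n (x : 'cV[C]_n) : (sqn x)%:C = (adj x *m x) 0 0.
Proof.
rewrite /sqn rmorph_sum mxE; apply: eq_bigr => i _.
by rewrite !mxE -sqr_normc_conj.
Qed.

Lemma l2norm_ge0 n (x : 'cV[C]_n) : 0 <= l2norm x.
Proof. exact: sqrtr_ge0. Qed.

Lemma sqr_l2norm n (x : 'cV[C]_n) : l2norm x ^+ 2 = sqn x.
Proof. by rewrite sqr_sqrtr// sqn_ge0. Qed.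

Lemma l2norm_eq0 n (x : 'cV[C]_n) : (l2norm x == 0) = (x == 0).
Proof.
rewrite -(sqrf_eq0 (l2norm x)) sqr_l2norm /sqn psumr_eq0 => [|i _]; last exact: sqr_ge0.
apply/allP/eqP => [h|-> i _]; last by rewrite /= mxE normc0 expr0n /= eqxx.
apply/matrixP => i j; rewrite ord1 mxE; apply/eqP.
by rewrite -normc_eq0 -sqrf_eq0; apply: h; rewrite mem_index_enum.
Qed.

Lemma l2norm0 n : l2norm (0 : 'cV[C]_n) = 0.
Proof. by apply/eqP; rewrite l2norm_eq0. Qed.

Lemma l2norm_gt0 n (x : 'cV[C]_n) : (0 < l2norm x) = (x != 0).
Proof. by rewrite lt_def l2norm_ge0 l2norm_eq0 andbT. Qed.

Lemma l2normZ n a (x : 'cV[C]_n) : l2norm (a *: x) = normc a * l2norm x.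
Proof.
apply/eqP; rewrite -(@eqrXn2 _ 2)// ?mulr_ge0 ?normc_ge0 ?l2norm_ge0//.
rewrite exprMn !sqr_l2norm mulr_sumr; apply/eqP/eq_bigr => i _.
by rewrite mxE normcM exprMn.
Qed.

Lemma l2normN n (x : 'cV[C]_n) : l2norm (- x) = l2norm x.
Proof. by rewrite -scaleN1r l2normZ normcN normc1 mul1r. Qed.

(** With [x] and [y] the two norms, the sum of the squares [(a i * y - b i * x) ^+ 2] equals [2 x y]
    times the difference of the two sides; the cases of a zero norm are set aside to cancel that
    factor. *)
Lemma cauchy_schwarz_sum n (a b : 'I_n -> R) :
  \sum_i a i * b i
    <= Num.sqrt (\sum_i a i ^+ 2) * Num.sqrt (\sum_i b i ^+ 2).
Proof.
set A := \sum_i a i ^+ 2; set B := \sum_i b i ^+ 2.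
have A0 : 0 <= A by apply: sumr_ge0 => i _; apply: sqr_ge0.
have B0 : 0 <= B by apply: sumr_ge0 => i _; apply: sqr_ge0.
set x := Num.sqrt A; set y := Num.sqrt B.
have x0 : 0 <= x := sqrtr_ge0 _; have y0 : 0 <= y := sqrtr_ge0 _.
have nul (c : 'I_n -> R) : \sum_i c i ^+ 2 = 0 -> forall i, c i = 0.
  move=> /eqP; rewrite psumr_eq0 => [|i _]; last exact: sqr_ge0.
  by move=> /allP h i; apply/eqP; rewrite -sqrf_eq0; apply: h; rewrite mem_index_enum.
have [x_eq0|xn0] := eqVneq x 0.
  have /nul a0 : A = 0 by apply/le_anti; rewrite A0 -sqrtr_eq0 -/x x_eq0 eqxx.
  by rewrite x_eq0 mul0r big1// => i _; rewrite a0 mul0r.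
have [y_eq0|yn0] := eqVneq y 0.
  have /nul a0 : B = 0 by apply/le_anti; rewrite B0 -sqrtr_eq0 -/y y_eq0 eqxx.
  by rewrite y_eq0 mulr0 big1// => i _; rewrite a0 mulr0.
have xy : 0 < x * y by rewrite mulr_gt0// lt_def ?xn0 ?yn0 ?x0 ?y0.
have : 0 <= \sum_i (a i * y - b i * x) ^+ 2 by apply: sumr_ge0 => i _; apply: sqr_ge0.
have -> : \sum_i (a i * y - b i * x) ^+ 2
    = A * y ^+ 2 + B * x ^+ 2 - 2 * (x * y) * \sum_i a i * b i.
  rewrite /A /B !mulr_suml mulr_sumr -big_split -sumrB; apply: eq_bigr => i _ /=.
  by ring.
rewrite !sqr_sqrtr//.
have -> : A * B + B * A = 2 * (x * y) * (x * y).
  by rewrite -mulrA -expr2 exprMn !sqr_sqrtr//; ring.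
rewrite subr_ge0 ler_pM2l//; by rewrite mulr_gt0.
Qed.

Lemma l2normD n (x y : 'cV[C]_n) : l2norm (x + y) <= l2norm x + l2norm y.
Proof.
rewrite -(@ler_pXn2r _ 2)// ?nnegrE ?addr_ge0 ?l2norm_ge0//.
rewrite sqrrD !sqr_l2norm.
apply: (@le_trans _ _ (\sum_i (normc (x i 0) + normc (y i 0)) ^+ 2)).
  apply: ler_sum => i _; rewrite mxE lerXn2r ?nnegrE ?addr_ge0 ?normc_ge0//.
  exact: le_normcD.
under eq_bigr do rewrite sqrrD.
rewrite big_split big_split /= lerD2r lerD2l sumrMnl lerMn2r /=.
exact: cauchy_schwarz_sum.
Qed.

Lemma l2normB n (x y : 'cV[C]_n) : l2norm x - l2norm y <= l2norm (x + y).
Proof.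
by rewrite lerBlDr -[X in _ <= _ + X]l2normN (le_trans _ (l2normD _ _)) ?addrK.
Qed.

(** * Norm and smallest singular value as inequalities for all vectors *)

Definition opbound n (s : R) (M : 'M[C]_n) :=
  forall x : 'cV[C]_n, l2norm (M *m x) <= s * l2norm x.

Definition lowbound n (c : R) (M : 'M[C]_n) :=
  forall x : 'cV[C]_n, c * l2norm x <= l2norm (M *m x).

Lemma opboundW n s t (M : 'M[C]_n) : s <= t -> opbound s M -> opbound t M.
Proof.
by move=> st h x; apply: le_trans (h x) _; rewrite ler_wpM2r ?l2norm_ge0.
Qed.

Lemma opboundD n s t (M N : 'M[C]_n) :
  opbound s M -> opbound t N -> opbound (s + t) (M + N).
Proof.
move=> hM hN x; rewrite mulmxDl mulrDl.
by apply: le_trans (l2normD _ _) _; apply: lerD.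
Qed.

Lemma opboundM n s t (M N : 'M[C]_n) : 0 <= s ->
  opbound s M -> opbound t N -> opbound (s * t) (M *m N).
Proof.
move=> s0 hM hN x; rewrite -mulmxA -mulrA.
by apply: le_trans (hM _) _; rewrite ler_wpM2l.
Qed.

Lemma opboundZ n s a (M : 'M[C]_n) :
  opbound s M -> opbound (normc a * s) (a *: M).
Proof.
by move=> h x; rewrite -scalemxAl l2normZ -mulrA ler_wpM2l ?normc_ge0.
Qed.

Lemma opboundN n s (M : 'M[C]_n) : opbound s M -> opbound s (- M).
Proof. by move=> h x; rewrite mulNmx l2normN. Qed.

Lemma opbound0 n : opbound 0 (0 : 'M[C]_n).
Proof. by move=> x; rewrite mul0mx l2norm0 mul0r. Qed.

Lemma opbound_sum n (I : Type) (r : seq I) (P : pred I) (s : I -> R)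
    (F : I -> 'M[C]_n) :
  (forall i, P i -> opbound (s i) (F i)) ->
  opbound (\sum_(i <- r | P i) s i) (\sum_(i <- r | P i) F i).
Proof.
by move=> h; elim/big_rec2: _ => [|i x y Pi IH];
  [exact: opbound0|exact: opboundD (h i Pi) IH].
Qed.

Lemma lowboundW n c d (M : 'M[C]_n) : d <= c -> lowbound c M -> lowbound d M.
Proof.
by move=> st h x; apply: le_trans (h x); rewrite ler_wpM2r ?l2norm_ge0.
Qed.

Lemma lowboundD n c s (M N : 'M[C]_n) :
  lowbound c M -> opbound s N -> lowbound (c - s) (M + N).
Proof.
move=> hM hN x; rewrite mulmxDl mulrBl.
by apply: le_trans (l2normB _ _); apply: lerB.
Qed.

Definition unitaryc n (U : 'M[C]_n) := adj U *m U = 1%:M.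

Lemma unitaryc_adj n (U : 'M[C]_n) : unitaryc U -> unitaryc (adj U).
Proof. by rewrite /unitaryc adjK => /mulmx1C. Qed.

Lemma sqn_unitary n (U : 'M[C]_n) x : unitaryc U -> sqn (U *m x) = sqn x.
Proof.
move=> hU; apply: (@complexI R).
by rewrite !sqn_adj adjM -mulmxA (mulmxA (adj U)) hU mul1mx.
Qed.

Lemma l2norm_unitary n (U : 'M[C]_n) x : unitaryc U -> l2norm (U *m x) = l2norm x.
Proof. by move=> hU; rewrite /l2norm -/(sqn _) sqn_unitary. Qed.

Lemma opbound_diag n s (d : 'rV[C]_n) : 0 <= s ->
  (forall i, normc (d 0 i) <= s) -> opbound s (diag_mx d).
Proof.
move=> s0 h x; rewrite -(@ler_pXn2r _ 2)// ?nnegrE ?mulr_ge0 ?l2norm_ge0//.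
rewrite exprMn !sqr_l2norm mulr_sumr; apply: ler_sum => i _.
rewrite mul_diag_mx mxE normcM exprMn ler_wpM2r ?sqr_ge0//.
by rewrite lerXn2r ?nnegrE ?normc_ge0.
Qed.

Lemma lowbound_diag n c (d : 'rV[C]_n) : 0 <= c ->
  (forall i, c <= normc (d 0 i)) -> lowbound c (diag_mx d).
Proof.
move=> s0 h x; rewrite -(@ler_pXn2r _ 2)// ?nnegrE ?mulr_ge0 ?l2norm_ge0//.
rewrite exprMn !sqr_l2norm mulr_sumr; apply: ler_sum => i _.
rewrite mul_diag_mx mxE normcM exprMn ler_wpM2r ?sqr_ge0//.
by rewrite lerXn2r ?nnegrE ?normc_ge0.
Qed.

Lemma opbound_conj n s (U D : 'M[C]_n) : unitaryc U -> opbound s D ->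
  opbound s (U *m D *m adj U).
Proof.
move=> hU hD x; rewrite -!mulmxA l2norm_unitary//.
by apply: le_trans (hD _) _; rewrite l2norm_unitary//; exact: unitaryc_adj.
Qed.

Lemma lowbound_conj n s (U D : 'M[C]_n) : unitaryc U -> lowbound s D ->
  lowbound s (U *m D *m adj U).
Proof.
move=> hU hD x; rewrite -!mulmxA l2norm_unitary//.
by apply: le_trans (hD _); rewrite l2norm_unitary//; exact: unitaryc_adj.
Qed.

Lemma lowbound_unit n c (M : 'M[C]_n) : 0 < c -> lowbound c M -> M \in unitmx.
Proof.
move=> c0 h; rewrite unitmxE unitfE -det_tr; apply/negP => /det0P[v v0 vM].
have := h v^T; rewrite -[M]trmxK -trmx_mul vM trmx0 l2norm0.
rewrite pmulr_rle0// leNgt l2norm_gt0 => /negP; apply.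
by apply: contra v0 => /eqP e; rewrite -[v]trmxK e trmx0.
Qed.

Lemma opbound_inv n c (M : 'M[C]_n) : 0 < c -> lowbound c M ->
  opbound c^-1 (invmx M).
Proof.
move=> c0 h x; have := h (invmx M *m x).
by rewrite mulmxA mulmxV ?mul1mx ?(lowbound_unit c0)// ler_pdivlMl.
Qed.

(** * Eigenvalues, and determinants under perturbations of low rank *)

Lemma char_poly_prod n (M : 'M[C]_n) :
  char_poly M = \prod_(z <- eigenvalues M) ('X - z%:P).
Proof.
rewrite /eigenvalues; case: closed_field_poly_normal => s /= {1}->.
by rewrite (eqP (char_poly_monic M)) scale1r.
Qed.

Lemma size_eigenvalues n (M : 'M[C]_n) : size (eigenvalues M) = n.
Proof.
have := size_char_poly M; rewrite char_poly_prod size_prod_XsubC.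
by move=> [].
Qed.

Lemma mem_eigenvalues n (M : 'M[C]_n) z :
  (z \in eigenvalues M) = root (char_poly M) z.
Proof. by rewrite char_poly_prod root_prod_XsubC. Qed.

Lemma eigenvaluesP n (M : 'M[C]_n) z : z \in eigenvalues M ->
  exists2 v : 'cV[C]_n, v != 0 & M *m v = z *: v.
Proof.
rewrite mem_eigenvalues => rz.
have : root (char_poly M^T) z.
  rewrite /char_poly -[char_poly_mx _]trmxK det_tr.
  suff -> : (char_poly_mx M^T)^T = char_poly_mx M by [].
  by apply/matrixP => i j; rewrite !mxE eq_sym.
rewrite -eigenvalue_root_char => /eigenvalueP[v vM v0].
exists v^T; last by rewrite -[M]trmxK -trmx_mul vM linearZ.
by apply: contra v0 => /eqP e; rewrite -[v]trmxK e trmx0.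
Qed.

Lemma eigenvalues_le n (M : 'M[C]_n) s z : opbound s M ->
  z \in eigenvalues M -> normc z <= s.
Proof.
move=> h /eigenvaluesP[v v0 vM].
have := h v; rewrite vM l2normZ ler_pM2r// l2norm_gt0//.
Qed.

Lemma det_sub_scalar n (M : 'M[C]_n) z :
  \det (z%:M - M) = \prod_(l <- eigenvalues M) (z - l).
Proof.
have : (char_poly M).[z] = \det (z%:M - M).
  rewrite /char_poly -horner_evalE -det_map_mx; congr (\det _).
  apply/matrixP => i j; rewrite !mxE /= horner_evalE hornerD hornerN hornerC.
  by rewrite hornerMn hornerX.
move=> <-; rewrite char_poly_prod horner_prod; apply: eq_bigr => l _.
by rewrite hornerXsubC.
Qed.

Lemma normc_det n (M : 'M[C]_n) z :
  normc (\det (M - z%:M)) = \prod_(l <- eigenvalues M) normc (l - z).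
Proof.
rewrite -opprB -scaleN1r detZ normcM normcX normcN normc1 expr1n mul1r.
rewrite det_sub_scalar normc_prod; apply: eq_bigr => l _; exact: normcB.
Qed.

(** Sylvester's identity: multiplying the block matrix [A] by the same unipotent matrix on the right
    or on the left makes it block lower triangular, with the two sides of the identity on the
    diagonal. *)
Lemma det1D_comm m n (X : 'M[C]_(m, n)) (Y : 'M[C]_(n, m)) :
  \det (1%:M + X *m Y) = \det (1%:M + Y *m X).
Proof.
pose A := block_mx 1%:M (- X) Y 1%:M.
have e1 : A *m block_mx 1%:M X 0 1%:M = block_mx 1%:M 0 Y (1%:M + Y *m X).
  by rewrite mulmx_block !mul1mx !mulmx1 !mulmx0 !addr0 subrr addrC.
have e2 : block_mx 1%:M X 0 1%:M *m A = block_mx (1%:M + X *m Y) 0 Y 1%:M.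
  by rewrite mulmx_block !mul1mx !mulmx1 !mul0mx !add0r addNr.
have d1 := congr1 determinant e1; have d2 := congr1 determinant e2.
move: d1 d2; rewrite !det_mulmx !det_ublock !det_lblock !det1 !mulr1 !mul1r.
by move=> -> ->.
Qed.

(** A full-rank factorization [D = X *m Y] and Sylvester's identity reduce the determinant to size
    [\rank D]. A nonzero eigenvalue of [Y *m X] with eigenvector [v] is an eigenvalue of [D] with
    eigenvector [X *m v], so [s] bounds it. *)
Lemma normc_det1D n (D : 'M[C]_n) r s : 0 <= s -> (\rank D <= r)%N ->
  opbound s D -> normc (\det (1%:M + D)) <= (1 + s) ^+ r.
Proof.
move=> s0 rD hD.
have [p [X [Y [pr DE]]]] : exists (p : nat) (X : 'M[C]_(n, p)) (Y : 'M[C]_(p, n)),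
    (p <= r)%N /\ D = X *m Y.
  by exists (mxrank D), (col_base D), (row_base D); rewrite mulmx_base.
have -> : \det (1%:M + D) = \det (1%:M + Y *m X) by rewrite -det1D_comm -DE.
set W := Y *m X.
have hW l : l \in eigenvalues W -> normc l <= s.
  move=> /eigenvaluesP[v v0 Wv].
  have [->|l0] := eqVneq l 0; first by rewrite normc0.
  have e : D *m (X *m v) = l *: (X *m v).
    by rewrite scalemxAr -Wv /W DE !mulmxA.
  have nz : X *m v != 0.
    apply/eqP => z; have := Wv; rewrite -mulmxA z mulmx0 => /esym/eqP.
    by rewrite scaler_eq0 (negPf l0) (negPf v0).
  by have := hD (X *m v); rewrite e l2normZ ler_pM2r// l2norm_gt0.
have -> : 1%:M + W = W - (-1)%:M by rewrite raddfN /= opprK addrC.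
rewrite normc_det.
apply: (@le_trans _ _ (\prod_(l <- eigenvalues W) (1 + s))).
  apply: ler_prod_seq => l lW; rewrite normc_ge0 /=.
  by rewrite opprK addrC (le_trans (le_normcD _ _))// normc1 lerD2l hW.
rewrite big_const_seq count_predT size_eigenvalues iter_mulr_1.
by rewrite ler_weXn2l// lerDl.
Qed.

(** After factoring out [A], the correction [invmx A *m L] has rank at most [r] and norm at most
    [s / c]. *)
Lemma normc_detD n (A L : 'M[C]_n) r c s : 0 < c -> 0 <= s ->
  lowbound c A -> opbound s L -> (\rank L <= r)%N ->
  normc (\det (A + L)) <= normc (\det A) * (1 + s / c) ^+ r.
Proof.
move=> c0 s0 hA hL rL.
have uA := lowbound_unit c0 hA.
have -> : A + L = A *m (1%:M + invmx A *m L).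
  by rewrite mulmxDr mulmx1 mulmxA mulmxV// mul1mx.
rewrite det_mulmx normcM ler_wpM2l ?normc_ge0//.
apply: normc_det1D; first by rewrite divr_ge0// ltW.
  by apply: leq_trans rL; apply: mxrankM_maxr.
by rewrite mulrC; apply: opboundM => //; [rewrite invr_ge0 ltW|exact: opbound_inv].
Qed.

End LinearAlgebra.

(** * Singular values and the Schur form *)

Section Spectral.
Variable R : realType.
Local Notation C := R[i].

Lemma conj_normc2 (z : C) : Num.conj z * z = (normc z ^+ 2)%:C.
Proof. by rewrite sqr_normc_conj. Qed.

Lemma adjE n (P : 'M[C]_n) : map_mx Num.conj P^T = adj P.
Proof. by apply/matrixP => i j; rewrite !mxE. Qed.

Lemma unitarymx_adj n (P : 'M[C]_n) : P \is unitarymx -> P *m adj P = 1%:M.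
Proof. by move/unitarymxP; rewrite adjE. Qed.

Lemma unitaryc_unitarymx n (P : 'M[C]_n) : P \is unitarymx -> unitaryc (adj P).
Proof. by move=> /unitarymx_adj; rewrite /unitaryc adjK. Qed.

Lemma char_poly_conj n (U D : 'M[C]_n) : unitaryc U ->
  char_poly (U *m D *m adj U) = char_poly D.
Proof.
move=> hU; have hU' : U *m adj U = 1%:M by exact: mulmx1C.
rewrite /char_poly /char_poly_mx !map_mxM.
set U1 := map_mx _ U; set V1 := map_mx _ (adj U); set D1 := map_mx _ D.
have UV : U1 *m V1 = 1%:M by rewrite -map_mxM hU' map_mx1.
have -> : 'X%:M - U1 *m D1 *m V1 = U1 *m ('X%:M - D1) *m V1.
  rewrite mulmxBr mulmxBl; congr (_ - _).
  by rewrite scalar_mxC -mulmxA UV mulmx1.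
rewrite !det_mulmx mulrAC -det_mulmx UV det1 mul1r //.
Qed.

Lemma eigenvalues_trig n (U D : 'M[C]_n) : unitaryc U -> is_trig_mx D ->
  perm_eq (eigenvalues (U *m D *m adj U)) [seq D i i | i <- enum 'I_n].
Proof.
move=> hU hD; apply: prod_XsubC_eq.
by rewrite -char_poly_prod char_poly_conj// char_poly_trig// big_map big_enum.
Qed.

Lemma adj_conj n (U D : 'M[C]_n) : adj (U *m D *m adj U) = U *m adj D *m adj U.
Proof. by rewrite !adjM adjK mulmxA. Qed.

Lemma conjM n (U D F : 'M[C]_n) : unitaryc U ->
  (U *m D *m adj U) *m (U *m F *m adj U) = U *m (D *m F) *m adj U.
Proof. by move=> hU; rewrite !mulmxA -(mulmxA _ (adj U) U) hU mulmx1. Qed.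

Lemma conj_scalar n (U : 'M[C]_n) (a : C) : unitaryc U ->
  U *m a%:M *m adj U = a%:M.
Proof. by move=> /mulmx1C hU; rewrite scalar_mxC -mulmxA hU mulmx1. Qed.

Lemma conjB n (U D F : 'M[C]_n) :
  U *m D *m adj U - U *m F *m adj U = U *m (D - F) *m adj U.
Proof. by rewrite mulmxBr mulmxBl. Qed.

Lemma conjD n (U D F : 'M[C]_n) :
  U *m D *m adj U + U *m F *m adj U = U *m (D + F) *m adj U.
Proof. by rewrite mulmxDr mulmxDl. Qed.

Lemma det_conj n (U D : 'M[C]_n) : unitaryc U ->
  \det (U *m D *m adj U) = \det D.
Proof.
move=> /mulmx1C hU; rewrite !det_mulmx mulrAC -det_mulmx hU det1 mul1r //.
Qed.

Lemma schur_form n (M : 'M[C]_n) :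
  exists U T : 'M[C]_n, [/\ unitaryc U, is_trig_mx T & M = U *m T *m adj U].
Proof.
(* [Schur] concerns positive sizes, so the empty matrix is set apart. Here [is_trig_mx] means lower
   triangular. *)
case: n M => [|n] M.
  exists 1%:M, 0; split; first by rewrite /unitaryc adj1 mulmx1.
    exact: mx0_is_trig.
  by apply/matrixP => -[].
have [P Pu] := Schur M (ltn0Sn n).
move=> tr; exists (adj P), (conjmx P M); split=> //.
  exact: unitaryc_unitarymx.
have PP := mulmx1C (unitarymx_adj Pu).
by rewrite conjymx// adjE adjK !mulmxA PP mul1mx -mulmxA PP mulmx1.
Qed.

Lemma hermitian_diag n (H : 'M[C]_n) : adj H = H ->
  exists (U : 'M[C]_n) (d : 'rV[C]_n), unitaryc U /\ H = U *m diag_mx d *m adj U.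
Proof.
move=> hH.
have /orthomx_spectralP HE : H \is normalmx.
  by apply/normalmxP; rewrite adjE hH.
exists (adj (spectralmx H)), (spectral_diag H); split.
  exact/unitaryc_unitarymx/spectral_unitarymx.
rewrite adjK -(adjE (spectralmx H)) -(invmx_unitary (spectral_unitarymx H)).
exact: HE.
Qed.

(** The spectral theorem for the Gram matrix. Its eigenvalue [r i] is real and nonnegative because
    it is the squared length of [M] applied to the eigenvector [U *m delta_mx i 0]; its root is a
    singular value. *)
Lemma singular_form n (M : 'M[C]_n) :
  exists (U : 'M[C]_n) (r : 'I_n -> R), [/\ unitaryc U, forall i, 0 <= r i,
    adj M *m M = U *m diag_mx (\row_i (r i)%:C) *m adj U,
    forall x, sqn (M *m x) = \sum_i r i * normc ((adj U *m x) i 0) ^+ 2 &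
    perm_eq (singular_values M) [seq Num.sqrt (r i) | i <- enum 'I_n]].
Proof.
have hH : adj (adj M *m M) = adj M *m M by rewrite adjM adjK.
have [U [d [hU HE]]] := hermitian_diag hH.
have key x : (sqn (M *m x))%:C = \sum_i d 0 i * (normc ((adj U *m x) i 0) ^+ 2)%:C.
  rewrite sqn_adj adjM -mulmxA (mulmxA (adj M)) HE.
  rewrite -!mulmxA (mulmxA (adj x)) -{1}(adjK U) -adjM mxE; apply: eq_bigr => i _.
  rewrite mul_diag_mx -conj_normc2 /adj mxE [in LHS]mxE -/(adj U).
  by rewrite mulrCA [X in _ * (X * _)]mxE.
have dE i : d 0 i = (sqn (M *m (U *m delta_mx i 0)))%:C.
  rewrite key (bigD1 i)//= big1 ?addr0 => [|j ji]; rewrite !mulmxA hU mul1mx mxE ?eqxx.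
    by rewrite normc1 expr1n mulr1.
  by rewrite (negPf ji) normc0 expr0n mulr0.
exists U, (fun i => sqn (M *m (U *m delta_mx i 0))); split => //.
- by move=> i; exact: sqn_ge0.
- rewrite HE; have -> // : d = \row_i (sqn (M *m (U *m delta_mx i 0)))%:C.
  by apply/rowP => i; rewrite mxE; exact: dE.
- move=> x; apply: (@complexI R); rewrite key rmorph_sum; apply: eq_bigr => i _.
  by rewrite dE -rmorphM.
- rewrite /singular_values -/(adj M) HE.
  have := eigenvalues_trig hU (diag_mx_is_trig d).
  move=> /(perm_map (fun l => Num.sqrt (complex.Re l))) /perm_trans; apply.
  rewrite -map_comp; have -> : [seq Num.sqrt (sqn (M *m (U *m delta_mx i 0))) | i <- enum 'I_n]
      = [seq ((fun l => Num.sqrt (complex.Re l)) \o (fun i => diag_mx d i i)) i | i <- enum 'I_n].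
    by apply: eq_map => i /=; rewrite mxE eqxx mulr1n dE.
  exact: perm_refl.
Qed.

Lemma mulmx_trig n (A B : 'M[C]_n) : is_trig_mx A -> is_trig_mx B ->
  is_trig_mx (A *m B) /\ forall i, (A *m B) i i = A i i * B i i.
Proof.
move=> /is_trig_mxP hA /is_trig_mxP hB; split.
  apply/is_trig_mxP => i j ij; rewrite mxE big1// => k _.
  have [ki|ik] := leqP k i; last by rewrite hA// mul0r.
  by rewrite (hB k)// ?mulr0//; apply: leq_ltn_trans ij.
move=> i; rewrite mxE (bigD1 i)//= big1 ?addr0// => k ki.
have [ik|ik|/val_inj e] := ltngtP i k; last by rewrite e eqxx in ki.
  by rewrite hA// mul0r.
by rewrite hB// mulr0.
Qed.

Lemma sub_scalar_trig n (T : 'M[C]_n) (z : C) : is_trig_mx T ->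
  is_trig_mx (T - z%:M) /\ forall i, (T - z%:M) i i = T i i - z.
Proof.
move=> /is_trig_mxP hT; split.
  apply/is_trig_mxP => i j ij; rewrite !mxE hT// sub0r.
  by rewrite (_ : (i == j) = false) ?mulr0n ?oppr0//; apply/eqP => e; rewrite e ltnn in ij.
by move=> i; rewrite !mxE eqxx mulr1n.
Qed.

Lemma adj_mul_ge0 m n (A : 'M[C]_(m, n)) i : 0 <= (adj A *m A) i i.
Proof.
by rewrite mxE sumr_ge0// => j _; rewrite !mxE -normCKC exprn_ge0.
Qed.

(** In an eigenbasis of [adj B *m B] the matrix is diagonal with entries [s + r i]. That the bound
    is the same for all [B] is what makes perturbations of low rank cheap. *)
Lemma posdef_lowbound n (s : R) (B : 'M[C]_n) : 0 < s ->
  lowbound s (s%:C%:M + adj B *m B).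
Proof.
move=> s0 x; set P := _ + _.
have [U [r [hU r0 HE _ _]]] := singular_form B.
have -> : P = U *m diag_mx (\row_i (s + r i)%:C) *m adj U.
  rewrite /P HE -(conj_scalar s%:C hU) conjD; congr (_ *m _ *m _).
  by apply/matrixP => i j; rewrite !mxE -mulrnDl rmorphD.
apply: lowbound_conj => //; apply: lowbound_diag => [|i]; first exact: ltW.
by rewrite mxE normcC ger0_norm ?addr_ge0 ?lerDl// ltW.
Qed.

(** Block elimination of [b] leaves the Schur complement of [P] in the upper left corner. *)
Lemma det_block_unit m n (a : 'M[C]_m) (b : 'M[C]_(m, n)) c (P : 'M[C]_n) :
  P \in unitmx ->
  \det (block_mx a b c P) = \det (a - b *m invmx P *m c) * \det P.
Proof.
move=> uP.
have -> : block_mx a b c P = block_mx 1%:M (b *m invmx P) 0 1%:M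
    *m block_mx (a - b *m invmx P *m c) 0 c P.
  rewrite mulmx_block !mul1mx !mul0mx !add0r subrK.
  by rewrite mulmxKV.
by rewrite det_mulmx det_ublock !det1 !mul1r det_lblock.
Qed.

Lemma quad_posdef k (s : C) (B : 'M[C]_k) (w : 'cV[C]_k) :
  adj w *m ((s%:M + adj B *m B) *m w)
  = s *: (adj w *m w) + adj (B *m w) *m (B *m w).
Proof.
rewrite mulmxDl mulmxDr mul_scalar_mx -scalemxAr; congr (_ + _).
by rewrite adjM !mulmxA.
Qed.

(** Completing the square; meant for [X = B *m w] and [Q = s *: (adj w *m w)]. *)
Lemma adj_sub_sq k (c X : 'cV[C]_k) (Q : 'M[C]_1) :
  adj X *m c = Q + adj X *m X ->
  adj c *m c - adj c *m X = adj (c - X) *m (c - X) + Q.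
Proof.
move=> XcE.
have -> : adj (c - X) = adj c - adj X.
  by apply/matrixP => i j; rewrite !mxE rmorphB.
rewrite mulmxBl (mulmxBr (adj c)) (mulmxBr (adj X)) XcE addrK.
by rewrite subrK.
Qed.

(* The Schur complement of s + B* B in s + T* T, for T with blocks x, 0, c, B,
   is s + |x|^2 + |c - B w|^2 + s |w|^2, where (s + B* B) w = B* c. *)
Lemma det_posdef_trig n (s : R) (T : 'M[C]_n) : 0 < s -> is_trig_mx T ->
  \prod_i (s%:C + `|T i i| ^+ 2) <= \det (s%:C%:M + adj T *m T).
Proof.
move=> s0; elim/trigsqmx_ind => [|k x c B Bt IH]; first by rewrite big_ord0 det_mx00.
set P := s%:C%:M + adj B *m B.
have sC0 : 0 <= s%:C by rewrite ler0c ltW.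
have uP : P \in unitmx := lowbound_unit s0 (posdef_lowbound B s0).
have PE : adj P = P.
  by rewrite /P adjD adjM adjK; congr (_ + _); apply/matrixP => i j;
    rewrite !mxE rmorphMn eq_sym /= (conj_Creal (ger0_real sC0)).
have -> : s%:C%:M + adj (block_mx x 0 c B) *m block_mx x 0 c B
    = block_mx (s%:C%:M + adj x *m x + adj c *m c) (adj c *m B) (adj B *m c) P.
  have -> : adj (block_mx x 0 c B) = block_mx (adj x) (adj c) 0 (adj B).
    by rewrite /adj map_block_mx tr_block_mx map_mx0 trmx0.
  rewrite mulmx_block !mulmx0 !mul0mx !add0r scalar_mx_block add_block_mx.
  by rewrite !add0r addrA.
rewrite det_block_unit// det_mx11.
rewrite big_split_ord /= big_ord1 block_mxEul.
under eq_bigr do rewrite block_mxEdr.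
apply: ler_pM => //.
- by rewrite addr_ge0// exprn_ge0.
- by apply: prodr_ge0 => i _; rewrite addr_ge0// exprn_ge0.
set w := invmx P *m (adj B *m c).
have Pw : P *m w = adj B *m c by rewrite /w mulmxA mulmxV// mul1mx.
have wBc : adj w *m (adj B *m c) = s%:C *: (adj w *m w) + adj (B *m w) *m (B *m w).
  by rewrite -Pw; exact: quad_posdef.
have key : adj c *m c - adj c *m B *m invmx P *m (adj B *m c)
    = adj (c - B *m w) *m (c - B *m w) + s%:C *: (adj w *m w).
  rewrite -!mulmxA -/w; apply: adj_sub_sq.
  by rewrite adjM -mulmxA wBc adjM.
have e1 : (adj x *m x) 0 0 = `|x ord0 ord0| ^+ 2.
  by rewrite mxE big_ord1 !mxE -normCKC.
rewrite -addrA key mxE [X in _ <= X + _]mxE e1 [s%:C%:M 0 0]mxE eqxx mulr1n lerDl.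
by rewrite mxE addr_ge0 ?adj_mul_ge0// mxE mulr_ge0// adj_mul_ge0.
Qed.

(** In Schur form the square of [M - z%:M] is triangular with diagonal entries [(l - z) ^+ 2], whose
    squared moduli are the fourth powers; [det_posdef_trig] then applies. The entries off the
    diagonal can only increase the determinant. *)
Lemma prod_eigenvalues_le_det n (s : R) (M : 'M[C]_n) (z : C) : 0 < s ->
  \prod_(l <- eigenvalues M) (s + normc (l - z) ^+ 4)
  <= normc (\det (s%:C%:M
       + adj ((M - z%:M) *m (M - z%:M)) *m ((M - z%:M) *m (M - z%:M)))).
Proof.
move=> s0; have [U [T [hU hT ->]]] := schur_form M.
rewrite (perm_big _ (eigenvalues_trig hU hT)) big_map big_enum /=.
have [tT dT] := sub_scalar_trig z hT.
have [tS dS] := mulmx_trig tT tT.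
set S := _ *m _ in tS dS.
have -> : U *m T *m adj U - z%:M = U *m (T - z%:M) *m adj U.
  by rewrite -{1}(conj_scalar z hU) conjB.
rewrite conjM// adj_conj conjM// -(conj_scalar s%:C hU) conjD det_conj//.
have := det_posdef_trig s0 tS.
set D := \det _; set L := \prod_i _ => LD.
have LE : L = (\prod_i (s + normc (T i i - z) ^+ 4))%:C.
  rewrite rmorph_prod; apply: eq_bigr => i _.
  rewrite dS dT normcE normcM -rmorphXn -rmorphD; congr (_%:C).
  by ring.
have L0 : 0 <= L.
  by rewrite LE ler0c prodr_ge0// => i _; rewrite addr_ge0 ?exprn_ge0 ?normc_ge0// ltW.
by rewrite -lecR -LE -normcE (le_trans LD)// ger0_norm// (le_trans L0).
Qed.

(** A normal matrix has no part off the diagonal in its Schur form, so nothing is lost here: this is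
    what turns the determinant of the circulant model back into a sum over its eigenvalues. *)
Lemma det_conj_diag n (s : R) (U : 'M[C]_n) (d : 'rV[C]_n) (z : C) : 0 < s ->
  unitaryc U -> let M := U *m diag_mx d *m adj U in
  normc (\det (s%:C%:M
       + adj ((M - z%:M) *m (M - z%:M)) *m ((M - z%:M) *m (M - z%:M))))
  = \prod_i (s + normc (d 0 i - z) ^+ 4).
Proof.
move=> s0 hU M.
have -> : M - z%:M = U *m diag_mx (\row_i (d 0 i - z)) *m adj U.
  rewrite -{1}(conj_scalar z hU) conjB; congr (_ *m _ *m _).
  by apply/matrixP => i j; rewrite !mxE -mulrnBl; case: eqP => [->|]; rewrite ?mulr0n.
rewrite conjM// adj_conj conjM// -(conj_scalar s%:C hU) conjD det_conj//.
have -> : s%:C%:M + adj (diag_mx (\row_i (d 0 i - z)) *m diag_mx (\row_i (d 0 i - z)))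
    *m (diag_mx (\row_i (d 0 i - z)) *m diag_mx (\row_i (d 0 i - z)))
    = diag_mx (\row_i (s + normc (d 0 i - z) ^+ 4)%:C).
  rewrite mulmx_diag.
  have -> (e : 'rV[C]_n) : adj (diag_mx e) = diag_mx (\row_i (Num.conj (e 0 i))).
    apply/matrixP => i j; rewrite !mxE rmorphMn.
    by case: (eqVneq i j) => [->|]; rewrite ?eqxx// eq_sym => /negPf ->; rewrite !mulr0n.
  rewrite mulmx_diag; apply/matrixP => i j; rewrite !mxE -mulrnDl; congr (_ *+ _).
  by rewrite conj_normc2 rmorphD; congr (_ + _); rewrite -expr2 normcX -exprM.
rewrite det_diag normc_prod; apply: eq_bigr => i _.
by rewrite mxE normcC ger0_norm// addr_ge0 ?exprn_ge0 ?normc_ge0// ltW.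
Qed.

Lemma sigma_min_lowbound n (M : 'M[C]_n) c : c <= sigma_min M ->
  0 <= c -> lowbound c M.
Proof.
move=> cM c0 x.
have [U [r [hU r0 _ hr pr]]] := singular_form M.
have cr i : c ^+ 2 <= r i.
  rewrite -[r i]sqr_sqrtr// lerXn2r ?nnegrE ?sqrtr_ge0//.
  apply: (le_trans cM); apply: ge_inf.
    by exists 0 => _ /= /mapP[l _ ->]; exact: sqrtr_ge0.
  by rewrite /= (perm_mem pr); apply/mapP; exists i; rewrite ?mem_enum.
rewrite -(@ler_pXn2r _ 2)// ?nnegrE ?mulr_ge0 ?l2norm_ge0//.
rewrite exprMn !sqr_l2norm hr -(sqn_unitary x (unitaryc_adj hU)) mulr_sumr.
by apply: ler_sum => i _; rewrite ler_wpM2r ?sqr_ge0.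
Qed.

(** Replaces a supremum over vectors by finitely many conditions on singular values, the form in
    which the event is later shown to be measurable. *)
Lemma spectral_norm_le n (M : 'M[C]_n) c : 0 <= c ->
  (spectral_norm M <= c) = all (fun s => s <= c) (singular_values M).
Proof.
move=> c0.
have [U [r [hU r0 _ hr pr]]] := singular_form M.
rewrite (perm_all _ pr) all_map.
have has_s t : (forall i, r i <= t ^+ 2) -> 0 <= t ->
    ubound [set l2norm (M *m x) | x in [set x : 'cV[C]_n | l2norm x <= 1]] t.
  move=> rt t0 _ [x /= x1 <-].
  rewrite -(@ler_pXn2r _ 2)// ?nnegrE ?l2norm_ge0// sqr_l2norm hr.
  apply: (@le_trans _ _ (\sum_i t ^+ 2 * normc ((adj U *m x) i 0) ^+ 2)).
    by apply: ler_sum => i _; rewrite ler_wpM2r ?sqr_ge0.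
  rewrite -mulr_sumr -/(sqn _) (sqn_unitary x (unitaryc_adj hU)) -sqr_l2norm.
  by rewrite -exprMn lerXn2r ?nnegrE ?mulr_ge0 ?l2norm_ge0// ler_piMr.
have ne : [set l2norm (M *m x) | x in [set x : 'cV[C]_n | l2norm x <= 1]] !=set0.
  by exists (l2norm (M *m 0)); exists 0 => //=; rewrite l2norm0.
apply/idP/allP => [sc i _ /=|h].
  have bnd : has_ubound [set l2norm (M *m x) | x in [set x : 'cV[C]_n | l2norm x <= 1]].
    exists (Num.sqrt (\sum_i r i)); apply: has_s; last exact: sqrtr_ge0.
    move=> j; rewrite sqr_sqrtr ?sumr_ge0// (bigD1 j)//= lerDl sumr_ge0//.
  apply: le_trans sc; apply: ub_le_sup => //.
  (* This unit vector is the right singular vector at which the value [Num.sqrt (r i)] is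
     attained. *)
  exists (U *m delta_mx i 0) => /=.
    rewrite l2norm_unitary// /l2norm (bigD1 i)//= big1 ?addr0 => [|j ji].
      by rewrite mxE !eqxx normc1 expr1n sqrtr1.
    by rewrite mxE (negPf ji) normc0 expr0n.
  rewrite /l2norm -/(sqn _) hr mulmxA hU mul1mx (bigD1 i)//= big1 ?addr0 => [|j ji].
    by rewrite mxE !eqxx normc1 expr1n mulr1.
  by rewrite mxE (negPf ji) normc0 expr0n mulr0.
apply: sup_le_ub => //; apply: has_s => // i.
rewrite -[r i]sqr_sqrtr// lerXn2r ?nnegrE ?sqrtr_ge0//.
by apply: h; rewrite mem_enum.
Qed.

Lemma spectral_norm_opbound n (M : 'M[C]_n) c : 0 <= c ->
  spectral_norm M <= c -> opbound c M.
Proof.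
move=> c0; rewrite spectral_norm_le// => /allP h x.
have [U [r [hU r0 _ hr pr]]] := singular_form M.
rewrite -(@ler_pXn2r _ 2)// ?nnegrE ?mulr_ge0 ?l2norm_ge0//.
rewrite exprMn !sqr_l2norm hr -(sqn_unitary x (unitaryc_adj hU)) mulr_sumr.
apply: ler_sum => i _; rewrite ler_wpM2r ?sqr_ge0//.
rewrite -[r i]sqr_sqrtr// lerXn2r ?nnegrE ?sqrtr_ge0//; apply: h.
by rewrite (perm_mem pr); apply/mapP; exists i; rewrite ?mem_enum.
Qed.

End Spectral.

(** * Comparison with a normal matrix *)

Section DeterminantComparison.
Variable R : realType.
Local Notation C := R[i].

Lemma cauchy_schwarz_l2 n (x y : 'cV[C]_n) :
  normc ((adj x *m y) 0 0) <= l2norm x * l2norm y.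
Proof.
rewrite mxE; apply: le_trans (le_normc_sum _ _ _) _.
apply: le_trans (cauchy_schwarz_sum (fun i => normc (x i 0)) (fun i => normc (y i 0))).
by apply: ler_sum => i _; rewrite normcM !mxE normc_conj.
Qed.

(** The squared length of [adj M *m x] is the inner product of [x] with [M *m (adj M *m x)];
    Cauchy-Schwarz and the bound on [M] leave one factor [l2norm (adj M *m x)] to cancel. *)
Lemma opbound_adj n (M : 'M[C]_n) s : opbound s M -> opbound s (adj M).
Proof.
move=> h x; have [->|nz] := eqVneq (adj M *m x) 0.
  rewrite l2norm0; have [->|x0] := eqVneq x 0; first by rewrite l2norm0 mulr0.
  have := le_trans (l2norm_ge0 _) (h x).
  by [].
have pos : 0 < l2norm (adj M *m x) by rewrite l2norm_gt0.
rewrite -(ler_pM2r pos) -expr2 sqr_l2norm.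
have -> : sqn (adj M *m x) = normc ((adj x *m (M *m (adj M *m x))) 0 0).
  rewrite mulmxA; have -> : adj x *m M = adj (adj M *m x) by rewrite adjM adjK.
  by rewrite -sqn_adj normcC ger0_norm// sqn_ge0.
apply: le_trans (cauchy_schwarz_l2 _ _) _.
by rewrite mulrC mulrAC ler_wpM2r ?l2norm_ge0.
Qed.

(** The two Gram matrices differ by [adj a *m D + adj D *m (a + D)], of norm at most [2 * al * be]
    and rank at most [2 * q], while the matrix for [a] is bounded below by [s]. *)
Lemma det_gramD n (a D : 'M[C]_n) (s al be : R) q : 0 < s -> 0 <= al -> 0 <= be ->
  opbound al a -> opbound al (a + D) -> opbound be D -> (\rank D <= q)%N ->
  normc (\det (s%:C%:M + adj (a + D) *m (a + D)))
  <= normc (\det (s%:C%:M + adj a *m a)) * (1 + 2 * al * be / s) ^+ (2 * q).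
Proof.
move=> s0 al0 be0 ha haD hD rD.
have -> : s%:C%:M + adj (a + D) *m (a + D)
    = s%:C%:M + adj a *m a + (adj a *m D + adj D *m (a + D)).
  by rewrite adjD mulmxDl mulmxDr !addrA.
apply: normc_detD => //.
- by rewrite !mulr_ge0.
- exact: posdef_lowbound.
- have -> : 2 * al * be = al * be + be * al by ring.
  apply: opboundD.
    exact: (opboundM al0 (opbound_adj ha) hD).
  exact: (opboundM be0 (opbound_adj hD) haD).
- apply: leq_trans (mxrank_add _ _) _; rewrite mul2n -addnn leq_add//.
    exact: leq_trans (mxrankM_maxr _ _) rD.
  apply: leq_trans (mxrankM_maxl _ _) _.
  by rewrite /adj mxrank_tr mxrank_map.
Qed.

(** The path goes from [X] to [X + N] to [X + N + L], each time with
    [(A + B)^2 - A^2 = A B + B (A + B)]. The noise [N] may have full rank but has norm [de], whence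
    a base close to 1 with exponent [2 * n]; [L] changes the square by rank at most [2 * r], whence
    the exponent [4 * r]. *)
Lemma det_gram_sqrD n (X N L : 'M[C]_n) (s ka de : R) r :
  0 < s -> 0 <= ka -> 0 <= de ->
  opbound ka X -> opbound ka (X + N) -> opbound ka (X + N + L) ->
  opbound de N -> opbound ka L -> (\rank L <= r)%N ->
  forall Y, Y = X + N + L ->
  normc (\det (s%:C%:M + adj (Y *m Y) *m (Y *m Y)))
  <= normc (\det (s%:C%:M + adj (X *m X) *m (X *m X)))
     * (1 + 4 * ka ^+ 3 * de / s) ^+ (2 * n)
     * (1 + 4 * ka ^+ 4 / s) ^+ (4 * r).
Proof.
move=> s0 ka0 de0 hX hX1 hY hN hL rL Y YE.
rewrite {}YE; set X1 := X + N in hX1 hY *.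
have sq (A B : 'M[C]_n) : (A + B) *m (A + B) = A *m A + (A *m B + B *m (A + B)).
  by rewrite mulmxDl !mulmxDr !addrA.
have ka2 A : opbound ka A -> opbound (ka ^+ 2) (A *m A) by move=> hA; exact: (opboundM ka0 hA hA).
have sb t A B : 0 <= t -> opbound ka A -> opbound ka (A + B) -> opbound t B ->
    opbound (2 * ka * t) (A *m B + B *m (A + B)).
  move=> t0 hA hAB hB; have -> : 2 * ka * t = ka * t + t * ka by ring.
  exact: (opboundD (opboundM ka0 hA hB) (opboundM t0 hB hAB)).
have s0' := ltW s0.
apply: (@le_trans _ _ (normc (\det (s%:C%:M + adj (X1 *m X1) *m (X1 *m X1)))
     * (1 + 4 * ka ^+ 4 / s) ^+ (4 * r))).
  have -> : 4 * ka ^+ 4 / s = 2 * ka ^+ 2 * (2 * ka * ka) / s by ring.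
  have -> : (4 * r = 2 * (2 * r))%N by rewrite mulnA.
  rewrite sq; apply: det_gramD => //.
  - exact: exprn_ge0.
  - by rewrite !mulr_ge0.
  - exact: (ka2 _ _ hX1).
  - by rewrite -sq; exact: (ka2 _ _ hY).
  - exact: (sb _ _ _ _ ka0 hX1 hY hL).
  - apply: leq_trans (mxrank_add _ _) _; rewrite mul2n -addnn leq_add//.
      exact: leq_trans (mxrankM_maxr _ _) rL.
    exact: leq_trans (mxrankM_maxl _ _) rL.
rewrite ler_wpM2r ?exprn_ge0 ?addr_ge0 ?divr_ge0 ?mulr_ge0 ?exprn_ge0//.
have -> : 4 * ka ^+ 3 * de / s = 2 * ka ^+ 2 * (2 * ka * de) / s by ring.
rewrite /X1 sq; apply: det_gramD => //.
- exact: exprn_ge0.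
- by rewrite !mulr_ge0.
- exact: (ka2 _ _ hX).
- by rewrite -sq; exact: (ka2 _ _ hX1).
- exact: (sb _ _ _ _ de0 hX hX1 hN).
- exact: rank_leq_row.
Qed.

(** At [x = 0] the quotient is 0 by the convention on inverses, so the kernel vanishes at its pole
    and bounds from below concern nonzero points. *)
Definition hker (s : R) (x : C) := ln (1 + s / normc x ^+ 4).

Lemma hker_ln s x : 0 < s -> x != 0 ->
  hker s x = ln (s + normc x ^+ 4) - ln (normc x ^+ 4).
Proof.
move=> s0; rewrite -normc_gt0 => x0.
have x40 : 0 < normc x ^+ 4 by rewrite exprn_gt0.
rewrite /hker -ln_div ?posrE ?addr_gt0//; congr ln.
by rewrite mulrDl divff ?gt_eqF// addrC.
Qed.

Lemma ln_prod (I : eqType) (s : seq I) (F : I -> R) :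
  {in s, forall i, 0 < F i} -> ln (\prod_(i <- s) F i) = \sum_(i <- s) ln (F i).
Proof.
elim: s => [|i s IH] h; first by rewrite !big_nil ln1.
have hs : {in s, forall i, 0 < F i} by move=> j js; apply: h; rewrite inE js orbT.
rewrite !big_cons lnM ?IH// ?posrE ?h ?mem_head//.
by rewrite big_seq prodr_gt0.
Qed.

Lemma ln_exprD1_le (x : R) m : 0 <= x -> ln ((1 + x) ^+ m) <= m%:R * x.
Proof.
move=> x0; rewrite lnXn ?ltr_wpDr// -[X in X <= _]mulr_natl ler_wpM2l//.
by apply: le_ln1Dx; rewrite (lt_le_trans _ x0)// ltrN10.
Qed.

(* [U diag(d) U*] is the normal (circulant) model; [N] is small, [L] has small
   rank, and only the lower half of the argument needs the bound [tau]. *)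
Lemma sum_hker_le n (U : 'M[C]_n) (d : 'rV[C]_n) (N L : 'M[C]_n) (z : C)
    (s K de tau c : R) r :
  let M := U *m diag_mx d *m adj U + N + L in
  0 < s -> 0 <= K -> 0 <= de -> 0 < tau -> 0 < c -> de <= c / 2 ->
  unitaryc U -> (forall i, normc (d 0 i - z) <= K) ->
  (forall i, c <= normc (d 0 i - z)) ->
  opbound de N -> opbound K L -> (\rank L <= r)%N ->
  lowbound tau (M - z%:M) ->
  forall ka, ka = 2 * K + de ->
  \sum_(l <- eigenvalues M) hker s (l - z)
  <= \sum_i hker s (d 0 i - z)
     + n%:R * (8 * ka ^+ 3 * de / s + 8 * de / c)
     + r%:R * (4 * ln (1 + 4 * ka ^+ 4 / s) + 4 * ln (1 + K / tau)).
Proof.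
move=> M s0 K0 de0 tau0 c0 dec hU dK dc hN hL rL hM ka kaE.
have ka0 : 0 <= ka by rewrite kaE addr_ge0// mulr_ge0.
set A := U *m diag_mx d *m adj U in M hM *.
set X := A - z%:M.
have XE : X = U *m diag_mx (\row_i (d 0 i - z)) *m adj U.
  rewrite /X -{1}(conj_scalar z hU) conjB; congr (_ *m _ *m _).
  by apply/matrixP => i j; rewrite !mxE -mulrnBl; case: eqP => [->|]; rewrite ?mulr0n.
have hX : opbound K X.
  by rewrite XE; apply: (opbound_conj hU); apply: (opbound_diag K0) => i; rewrite mxE.
have lX : lowbound c X.
  rewrite XE; apply: (lowbound_conj hU); apply: lowbound_diag => [|i]; first exact: ltW.
  by rewrite mxE.
have hX1 : opbound (K + de) (X + N) by exact: (opboundD hX hN).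
have YE : M - z%:M = X + N + L by rewrite /M /X addrAC (addrAC A).
have hY : opbound ka (X + N + L).
  have -> : ka = K + de + K by rewrite kaE; ring.
  exact: (opboundD hX1 hL).
have detX : normc (\det X) = \prod_i normc (d 0 i - z).
  rewrite XE det_conj// det_diag normc_prod; apply: eq_bigr => i _; by rewrite mxE.
(* Since [tau] is positive, [z] is not an eigenvalue, and the logarithms below are of positive
   numbers. *)
have eig_nz : {in eigenvalues M, forall l, l - z != 0}.
  move=> l /eigenvaluesP[v v0 Mv]; apply: contraTneq v0 => lz.
  have := hM v; rewrite mulmxBl Mv mul_scalar_mx -scalerBl lz scale0r l2norm0.
  by rewrite pmulr_rle0// -l2norm_eq0 eq_le l2norm_ge0 andbT negbK.
have d_nz i : d 0 i - z != 0 by rewrite -normc_gt0 (lt_le_trans c0).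
(* The way back from [M - z%:M] to [X]: removing [L] is paid with the lower bound [tau] of
   [M - z%:M], removing [N] with the lower bound [c / 2] of [X + N], which comes from
   [de <= c / 2]. *)
have lower : normc (\det X) <= normc (\det (M - z%:M))
    * (1 + K / tau) ^+ r * (1 + 2 * de / c) ^+ n.
  have -> : X = X + N + - N by rewrite addrK.
  have c2 : 0 < c / 2 by rewrite divr_gt0.
  have lX1 : lowbound (c / 2) (X + N).
    apply: lowboundW (lowboundD lX hN).
    by rewrite {2}(splitr c) -addrA lerDl subr_ge0.
  have h1 := normc_detD c2 de0 lX1 (opboundN hN) (rank_leq_row _).
  apply: (le_trans h1).
  have -> : de / (c / 2) = 2 * de / c by rewrite invf_div; ring.
  have c0' := ltW c0.
  rewrite ler_wpM2r ?exprn_ge0 ?addr_ge0 ?divr_ge0 ?mulr_ge0//.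
  have -> : X + N = M - z%:M - L by rewrite YE addrK.
  have rL' : (\rank (- L) <= r)%N by rewrite mxrank_opp.
  exact: (normc_detD tau0 K0 hM (opboundN hL) rL').
have upper := prod_eigenvalues_le_det M z s0.
have K_ka : K <= ka by rewrite kaE; lra.
have Kde_ka : K + de <= ka by rewrite kaE; lra.
have gram := det_gram_sqrD s0 ka0 de0 (opboundW K_ka hX) (opboundW Kde_ka hX1)
  hY hN (opboundW K_ka hL) rL YE.
have {gram}upper := le_trans upper gram.
rewrite (det_conj_diag d z s0 hU) in upper.
rewrite detX normc_det in lower.
have xl : 0 <= 4 * ka ^+ 3 * de / s.
  by rewrite divr_ge0 ?mulr_ge0 ?exprn_ge0// ltW.
have x2 : 0 <= 4 * ka ^+ 4 / s by rewrite divr_ge0 ?mulr_ge0 ?exprn_ge0// ltW.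
have x3 : 0 <= K / tau by rewrite divr_ge0// ltW.
have x4 : 0 <= 2 * de / c by rewrite divr_ge0 ?mulr_ge0// ltW.
have pos1 (x : R) m : 0 <= x -> 0 < (1 + x) ^+ m by move=> x0; rewrite exprn_gt0// ltr_wpDr.
have sp (y : R) : 0 <= y -> 0 < s + y by move=> y0; rewrite ltr_wpDr.
have n4 (y : C) : 0 <= normc y ^+ 4 by rewrite exprn_ge0// normc_ge0.
have Pm0 : 0 < \prod_(l <- eigenvalues M) (s + normc (l - z) ^+ 4).
  by apply: prodr_gt0 => l _; exact: sp.
have Pd0 : 0 < \prod_i (s + normc (d 0 i - z) ^+ 4).
  by apply: prodr_gt0 => l _; exact: sp.
have Qd0 : 0 < \prod_i normc (d 0 i - z).
  by apply: prodr_gt0 => l _; rewrite normc_gt0.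
have Qm0 : 0 < \prod_(l <- eigenvalues M) normc (l - z).
  by rewrite big_seq; apply: prodr_gt0 => l lM; rewrite normc_gt0 eig_nz.
move: upper; rewrite -ler_ln ?posrE ?mulr_gt0 ?pos1// !lnM ?posrE ?mulr_gt0 ?pos1// => upper.
move: lower; rewrite -ler_ln ?posrE ?mulr_gt0 ?pos1// !lnM ?posrE ?mulr_gt0 ?pos1// => lower.
have eM : \sum_(l <- eigenvalues M) hker s (l - z) =
    ln (\prod_(l <- eigenvalues M) (s + normc (l - z) ^+ 4))
    - 4 * ln (\prod_(l <- eigenvalues M) normc (l - z)).
  rewrite !ln_prod; last 2 first.
  - by move=> l lM; rewrite normc_gt0 eig_nz.
  - by move=> l lM; exact: sp.
  rewrite mulr_sumr -sumrB big_seq [RHS]big_seq; apply: eq_bigr => l lM.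
  by rewrite hker_ln ?eig_nz// [in X in _ - X]lnXn ?normc_gt0 ?eig_nz// mulr_natl.
have eD : \sum_i hker s (d 0 i - z) =
    ln (\prod_i (s + normc (d 0 i - z) ^+ 4)) - 4 * ln (\prod_i normc (d 0 i - z)).
  rewrite !ln_prod; last 2 first.
  - by move=> l lM; rewrite normc_gt0.
  - by move=> l lM; exact: sp.
  rewrite mulr_sumr -sumrB; apply: eq_bigr => l _.
  by rewrite hker_ln// [in X in _ - X]lnXn ?normc_gt0// mulr_natl.
rewrite eM eD.
(* The kernel contains [- 4 ln |l - z|], so [lower] counts four times: [n] factors [1 + 2 * de / c]
   give the term [8 * de / c], and [r] factors [1 + K / tau] give [4 * ln (1 + K / tau)]. *)
have l1 := ln_exprD1_le (2 * n) xl.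
have l4 := ln_exprD1_le n x4.
move: l1 upper lower l4; rewrite !lnXn ?ltr_wpDr// !natrM.
move: (ln (1 + _)) (ln (1 + _)) (ln (1 + _)) (ln (1 + _)).
move=> v4 v3 v2 v1; rewrite -(mulr_natl v1) -(mulr_natl v2) -(mulr_natl v3) -(mulr_natl v4) !natrM.
move: (ln _) (ln _) (ln _) (ln _) => u1 u2 u3 u4.
lra.
Qed.

End DeterminantComparison.

(** * Measurability of eigenvalue statistics *)

Lemma continuous_lt (R : realType) (T : topologicalType) (f : T -> R) (x : T) (z : R) :
  {for x, continuous f} -> f x < z -> \forall y \near x, f y < z.
Proof.
move=> cf fz; apply: (cf [set y | y < z]).
by apply: open_nbhs_nbhs; split => //; exact: open_lt.
Qed.

Section ComplexTopology.
Variable R : realType.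
Local Notation C := R[i].

(** The radius of a ball of [C^o] is an element of [R[i]]; being positive, it has zero imaginary
    part, so real radii suffice. *)
Lemma nbhs_normcP (z : C) (A : set C) :
  nbhs (z : C^o) A <-> exists2 e : R, 0 < e & forall y, normc (z - y) < e -> A y.
Proof.
split=> [/nbhs_ballP[e /= e0 h]|[e e0 h]].
  have /andP[/eqP Ie Re0] : (complex.Im e == 0) && (0 < complex.Re e).
    by move: e0; rewrite ltcE /=.
  exists (complex.Re e) => // y zy; apply: h.
  rewrite /ball/= normcE ltcE /= Ie eqxx /=; exact: zy.
apply/nbhs_ballP; exists (e%:C); first by rewrite /= ltcE /= eqxx e0.
by move=> y; rewrite /ball/= normcE ltcR; exact: h.
Qed.

Lemma continuousC_R (T : topologicalType) (g : T -> C^o) :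
  (forall x (e : R), 0 < e -> \forall y \near x, normc (g x - g y) < e) ->
  continuous g.
Proof.
move=> h x A /nbhs_normcP[e e0 eA].
by apply: filterS (h x e e0) => y /eA.
Qed.

Lemma continuousC_epsP (g : C^o -> R) : continuous g <->
  (forall z (e : R), 0 < e ->
    exists2 de : R, 0 < de & forall y, normc (z - y) < de -> `|g z - g y| < e).
Proof.
split=> [h z e e0|h z].
  have /nbhs_normcP[de de0 hd] : nbhs (z : C^o) [set y | `|g z - g y| < e].
    by have /cvgrPdist_lt/(_ e e0) := h z.
  by exists de.
move=> A /nbhs_ballP[e /= e0 hA]; have [de de0 hd] := h z e e0.
apply/nbhs_normcP; exists de => // y /hd; exact: hA.
Qed.

Lemma Re_normc (z : C) : `|complex.Re z| <= normc z.
Proof.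
case: z => a b /=; rewrite -sqrtr_sqr ler_wsqrtr// lerDl sqr_ge0//.
Qed.

Lemma Im_normc (z : C) : `|complex.Im z| <= normc z.
Proof.
case: z => a b /=; rewrite -sqrtr_sqr ler_wsqrtr// lerDr sqr_ge0//.
Qed.

Lemma normc_ReIm (z : C) : normc z <= `|complex.Re z| + `|complex.Im z|.
Proof.
case: z => a b /=.
rewrite -[leRHS]ger0_norm ?addr_ge0// -[leRHS]sqrtr_sqr ler_wsqrtr//.
by rewrite sqrrD !real_normK ?num_real// lerD2r lerDl mulrn_wge0 ?mulr_ge0.
Qed.

Lemma continuous_Re : continuous (@complex.Re R : C^o -> R).
Proof.
apply/continuousC_epsP => z e e0; exists e => // y.
by apply: le_lt_trans; rewrite -raddfB Re_normc.
Qed.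

Lemma continuous_Im : continuous (@complex.Im R : C^o -> R).
Proof.
apply/continuousC_epsP => z e e0; exists e => // y.
by apply: le_lt_trans; rewrite -raddfB Im_normc.
Qed.

Lemma continuous_comp_ReIm (g : C^o -> C^o) : continuous g ->
  continuous (@complex.Re R \o g : C^o -> R) /\ continuous (@complex.Im R \o g : C^o -> R).
Proof.
move=> cg; split=> z.
  by apply: continuous_comp; [exact: cg|exact: continuous_Re].
by apply: continuous_comp; [exact: cg|exact: continuous_Im].
Qed.

Lemma continuous_complex (T : topologicalType) (f g : T -> R) :
  continuous f -> continuous g -> continuous ((fun x => f x +i* g x) : T -> C^o).
Proof.
move=> cf cg; apply: continuousC_R => x e e0.
have e2 : 0 < e / 2 by rewrite divr_gt0.
have /cvgrPdist_lt/(_ _ e2) hf := cf x.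
have /cvgrPdist_lt/(_ _ e2) hg := cg x.
near=> y.
apply: le_lt_trans (normc_ReIm _) _; rewrite [ltRHS]splitr ltrD//=.
  by near: y.
by near: y.
Unshelve. all: by end_near. Qed.

Lemma continuous_borelC_measurable d (S : measurableType d) (phi : C^o -> R)
    (f : S -> borelC R) :
  continuous phi -> measurable_fun [set: S] f -> measurable_fun [set: S] (phi \o f).
Proof.
move=> cphi mf.

apply: (measurability _ (RGenOInfty.measurableE R)) => _ [_ [a ->] <-].
rewrite setTI.
have -> : (phi \o f) @^-1` `]a, +oo[%classic = f @^-1` (phi @^-1` `]a, +oo[%classic) by [].
rewrite -[X in measurable X]setTI; apply: mf => //.
apply: sub_sigma_algebra; apply: (open_comp _ (interval_open _ _)) => // z _; exact: cphi.
Qed.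

End ComplexTopology.

(* Closure of a class [Q] of real functions (measurable or continuous ones)
   under the ring operations, transferred to complex- and polynomial-valued
   functions so as to reach the coefficients of a characteristic polynomial. *)
Section RingOfFunctions.
Variables (R : realType) (S : Type) (Q : (S -> R) -> Prop).
Hypothesis Q_cst : forall c, Q (fun=> c).
Hypothesis Q_add : forall f g, Q f -> Q g -> Q (fun x => f x + g x).
Hypothesis Q_opp : forall f, Q f -> Q (fun x => - f x).
Hypothesis Q_mul : forall f g, Q f -> Q g -> Q (fun x => f x * g x).
Local Notation C := R[i].

Definition cfun (f : S -> C) :=
  Q (fun x => complex.Re (f x)) /\ Q (fun x => complex.Im (f x)).

Lemma cfun_cst c : cfun (fun=> c).
Proof. by split; exact: Q_cst. Qed.

Lemma cfunD f g : cfun f -> cfun g -> cfun (fun x => f x + g x).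
Proof.
move=> [f1 f2] [g1 g2]; split.
  have -> : (fun x => complex.Re (f x + g x))
      = (fun x => complex.Re (f x) + complex.Re (g x)).
    by apply/funext => x; rewrite raddfD.
  exact: Q_add.
have -> : (fun x => complex.Im (f x + g x))
    = (fun x => complex.Im (f x) + complex.Im (g x)).
  by apply/funext => x; rewrite raddfD.
exact: Q_add.
Qed.

Lemma cfunN f : cfun f -> cfun (fun x => - f x).
Proof.
move=> [f1 f2]; split.
  have -> : (fun x => complex.Re (- f x)) = (fun x => - complex.Re (f x)).
    by apply/funext => x; rewrite raddfN.
  exact: Q_opp.
have -> : (fun x => complex.Im (- f x)) = (fun x => - complex.Im (f x)).
  by apply/funext => x; rewrite raddfN.
exact: Q_opp.
Qed.

Lemma cfunM f g : cfun f -> cfun g -> cfun (fun x => f x * g x).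
Proof.
move=> [f1 f2] [g1 g2]; split.
  have -> : (fun x => complex.Re (f x * g x)) = (fun x =>
      complex.Re (f x) * complex.Re (g x) + - (complex.Im (f x) * complex.Im (g x))).
    by apply/funext => x; case: (f x) => a b; case: (g x).
  by apply: Q_add; [exact: Q_mul|apply: Q_opp; exact: Q_mul].
have -> : (fun x => complex.Im (f x * g x)) = (fun x =>
    complex.Re (f x) * complex.Im (g x) + complex.Im (f x) * complex.Re (g x)).
  by apply/funext => x; case: (f x) => a b; case: (g x).
by apply: Q_add; exact: Q_mul.
Qed.

Lemma cfun_conj f : cfun f -> cfun (fun x => Num.conj (f x)).
Proof.
move=> [f1 f2]; split.
  have -> : (fun x => complex.Re (Num.conj (f x))) = (fun x => complex.Re (f x)).
    by apply/funext => x; case: (f x).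
  by [].
have -> : (fun x => complex.Im (Num.conj (f x))) = (fun x => - complex.Im (f x)).
  by apply/funext => x; case: (f x).
exact: Q_opp.
Qed.

Lemma cfun_sum (I : Type) (r : seq I) (P : pred I) (F : I -> S -> C) :
  (forall i, P i -> cfun (F i)) -> cfun (fun x => \sum_(i <- r | P i) F i x).
Proof.
move=> h; elim: r => [|i r IH].
  under eq_fun do rewrite big_nil; exact: cfun_cst.
under eq_fun do rewrite big_cons.
by case: (boolP (P i)) => // Pi; apply: cfunD => //; exact: h.
Qed.

Definition pfun (f : S -> {poly C}) := forall i, cfun (fun x => (f x)`_i).

Lemma pfun_cst p : pfun (fun=> p).
Proof. by move=> i; exact: cfun_cst. Qed.

Lemma pfunC f : cfun f -> pfun (fun x => (f x)%:P).
Proof.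
move=> hf [|i]; first by under eq_fun do rewrite coefC.
under eq_fun do rewrite coefC /=; exact: cfun_cst.
Qed.

Lemma pfunB f g : pfun f -> pfun g -> pfun (fun x => f x - g x).
Proof.
move=> hf hg i; under eq_fun do rewrite coefB.
by apply: cfunD => //; exact: cfunN.
Qed.

Lemma pfunM f g : pfun f -> pfun g -> pfun (fun x => f x * g x).
Proof.
move=> hf hg i; under eq_fun do rewrite coefM.
by apply: cfun_sum => j _; apply: cfunM.
Qed.

Lemma pfun_sum (I : Type) (r : seq I) (P : pred I) (F : I -> S -> {poly C}) :
  (forall i, P i -> pfun (F i)) -> pfun (fun x => \sum_(i <- r | P i) F i x).
Proof.
move=> h i; under eq_fun do rewrite coef_sum.
by apply: cfun_sum => j Pj; exact: h.
Qed.

Lemma pfun_prod (I : Type) (r : seq I) (F : I -> S -> {poly C}) :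
  (forall i, pfun (F i)) -> pfun (fun x => \prod_(i <- r) F i x).
Proof.
move=> h; elim: r => [|i r IH].
  under eq_fun do rewrite big_nil; exact: pfun_cst.
under eq_fun do rewrite big_cons.
by apply: pfunM => //; exact: h.
Qed.

Lemma pfun_char_poly n (N : S -> 'M[C]_n) :
  (forall i j, cfun (fun x => N x i j)) -> pfun (fun x => char_poly (N x)).
Proof.
move=> h; rewrite /char_poly /determinant; apply: pfun_sum => s _.
apply: pfunM; first exact: pfun_cst.
apply: pfun_prod => i.
under eq_fun do rewrite !mxE.
by apply: pfunB; [exact: pfun_cst|exact: pfunC].
Qed.

(** Moduli are squared to make the distance a polynomial in the real and imaginary parts of the
    coefficients, so that it stays in the class [Q]. *)
Definition poly_dist n (p q : {poly C}) : R :=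
  \sum_(i < n.+1) normc (p`_i - q`_i) ^+ 2.

Lemma sqr_normcE (z : C) : normc z ^+ 2 = complex.Re z * complex.Re z + complex.Im z * complex.Im z.
Proof. by case: z => a b /=; rewrite sqr_sqrtr ?addr_ge0 ?sqr_ge0// !expr2. Qed.

Lemma poly_dist_fun n f g : pfun f -> pfun g -> Q (fun x => poly_dist n (f x) (g x)).
Proof.
move=> hf hg; rewrite /poly_dist.
have Qs (I : Type) (r : seq I) (F : I -> S -> R) : (forall i, Q (F i)) ->
    Q (fun x => \sum_(i <- r) F i x).
  move=> h; elim: r => [|i r IH]; first by under eq_fun do rewrite big_nil; exact: Q_cst.
  by under eq_fun do rewrite big_cons; apply: Q_add; [exact: h|exact: IH].
apply: Qs => i; under eq_fun do rewrite sqr_normcE.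
have [d1 d2] : cfun (fun x => (f x)`_i - (g x)`_i).
  by apply: cfunD; [exact: hf|apply: cfunN; exact: hg].
by apply: Q_add; exact: Q_mul.
Qed.

End RingOfFunctions.

Section MeasurableEigenvalues.
Variables (R : realType) (d : measure_display) (S : measurableType d).
Local Notation C := R[i].

Definition cmeas (f : S -> C) := cfun (fun g : S -> R => measurable_fun setT g) f.

Lemma poly_dist_eq0 n (p q : {poly C}) : (size p <= n.+1)%N -> (size q <= n.+1)%N ->
  poly_dist n p q = 0 -> p = q.
Proof.
move=> sp sq /eqP; rewrite psumr_eq0; last by move=> i _; exact: sqr_ge0.
move=> /allP h; apply/polyP => i.
have [ni|ni] := ltnP i n.+1; last by rewrite !nth_default// (leq_trans _ ni).
have /= := h (Ordinal ni); rewrite mem_index_enum => /(_ isT).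
by rewrite sqrf_eq0 normc_eq0 subr_eq0 => /eqP.
Qed.

(** A complex vector coded by a real row, real parts before imaginary parts, so that compactness of
    boxes and density of rational rows are at hand. *)
Definition cvec n (x : 'rV[R]_(n + n)) (i : 'I_n) : C :=
  x 0 (lshift n i) +i* x 0 (rshift n i).

Definition cvec_poly n (x : 'rV[R]_(n + n)) : {poly C} :=
  \prod_i ('X - (cvec x i)%:P).

Lemma cvec_polyE n (x : 'rV[R]_(n + n)) :
  cvec_poly x = \prod_(l <- [seq cvec x i | i <- enum 'I_n]) ('X - l%:P).
Proof. by rewrite big_map big_enum. Qed.

Lemma size_cvec_poly n (x : 'rV[R]_(n + n)) : size (cvec_poly x) = n.+1.
Proof. by rewrite cvec_polyE size_prod_XsubC size_map size_enum_ord. Qed.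

Lemma cvec_exists n (M : 'M[C]_n) : exists x : 'rV[R]_(n + n),
  char_poly M = cvec_poly x.
Proof.
exists (\row_j match fintype.split j with
  | inl i => complex.Re (eigenvalues M)`_i | inr i => complex.Im (eigenvalues M)`_i end).
rewrite char_poly_prod (big_nth 0) size_eigenvalues big_mkord; apply: eq_bigr => i _.
rewrite /cvec !mxE (unsplitK (inl i)) (unsplitK (inr i)).
by case: (_`_i).
Qed.

(** The characteristic polynomial determines the eigenvalues up to order and the sum is symmetric.
    Any vector of roots computes it, which avoids a measurable choice of eigenvalues. *)
Lemma sum_eigenvalues_cvec n (M : 'M[C]_n) (x : 'rV[R]_(n + n)) (phi : C -> R) :
  char_poly M = cvec_poly x ->
  \sum_(l <- eigenvalues M) phi l = \sum_i phi (cvec x i).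
Proof.
move=> e; have /prod_XsubC_eq p : \prod_(l <- eigenvalues M) ('X - l%:P)
    = \prod_(l <- [seq cvec x i | i <- enum 'I_n]) ('X - l%:P).
  by rewrite -char_poly_prod e cvec_polyE.
by rewrite (perm_big _ p) big_map big_enum.
Qed.

Lemma rat_vec_open n (A : set 'rV[R]_n) (x : 'rV[R]_n) : nbhs x A ->
  exists q : 'rV[rat]_n, A (map_mx (@ratr R) q).
Proof.
move=> /nbhs_ballP[e /= e0 hA].
have hq i : exists q : rat, x 0 i - e < ratr q < x 0 i + e.
  have : x 0 i - e < x 0 i + e by lra.
  move=> /rat_in_itvoo[q]; rewrite in_itv /= => hq; by exists q.
have [q hq'] := choice hq.
exists (\row_i q i); apply: hA; split=> // i j; rewrite ord1 !mxE.
have /andP[q1 q2] := hq' j.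
by rewrite /ball /= ltr_distlC q1 q2.
Qed.

(* The sum is < c iff, for some j and k and all m, a rational vector bounded by k
   and with sum of phi at most c - 1/(j+1) has monic polynomial within 1/(m+1)
   of the characteristic polynomial; compactness gives back an exact eigenvalue
   vector. *)
Lemma measurable_sum_eigenvalues n (N : S -> 'M[C]_n) (phi : C^o -> R) :
  (forall i j, cmeas (fun w => N w i j)) -> continuous phi ->
  measurable_fun [set: S] (fun w => \sum_(l <- eigenvalues (N w)) phi l).
Proof.
move=> mN cphi.
pose Psi (x : 'rV[R]_(n + n)) := \sum_i phi (cvec x i).
pose D (x : 'rV[R]_(n + n)) w := poly_dist n (cvec_poly x) (char_poly (N w)).
have cc (j : 'I_(n + n)) : continuous (fun x : 'rV[R]_(n + n) => x 0 j).
  exact: coord_continuous.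
have cPsi : continuous Psi.
  have : forall r : seq 'I_n, continuous (fun x => \sum_(i <- r) phi (cvec x i)).
    elim=> [|i r IH]; first by under eq_fun do rewrite big_nil; exact: cst_continuous.
    under eq_fun do rewrite big_cons; move=> x; apply: continuousD; last exact: IH.
    apply: (@continuous_comp _ _ _ (fun x => cvec x i : C^o)); last exact: cphi.
    by move: x; apply: continuous_complex; exact: cc.
  by apply.
have cD w : continuous (fun x => D x w).
  apply: (poly_dist_fun (Q := fun g : 'rV[R]_(n + n) -> R => continuous g)).
  - by move=> c; exact: cst_continuous.
  - by move=> f g cf cg x; apply: continuousD; [exact: cf|exact: cg].
  - by move=> f cf x; apply: continuousN; exact: cf.
  - by move=> f g cf cg x; apply: continuousM; [exact: cf|exact: cg].
  - apply: pfun_prod.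
    + by move=> c; exact: cst_continuous.
    + by move=> f g cf cg x; apply: continuousD; [exact: cf|exact: cg].
    + by move=> f cf x; apply: continuousN; exact: cf.
    + by move=> f g cf cg x; apply: continuousM; [exact: cf|exact: cg].
    move=> i; apply: pfunB.
    + by move=> f g cf cg x; apply: continuousD; [exact: cf|exact: cg].
    + by move=> f cf x; apply: continuousN; exact: cf.
    + by apply: pfun_cst => c; exact: cst_continuous.
    apply: pfunC; first by move=> c; exact: cst_continuous.
    by split; exact: cc.
  - by apply: pfun_cst => c; exact: cst_continuous.
have mcst c : measurable_fun [set: S] (fun=> c : R) by exact: measurable_cst.
have madd (f g : S -> R) : measurable_fun setT f -> measurable_fun setT g ->
  measurable_fun setT (fun x => f x + g x) by move=> mf mg; exact: measurable_funD.
have mopp (f : S -> R) : measurable_fun setT f ->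
  measurable_fun setT (fun x => - f x) by move=> mf; exact: measurableT_comp.
have mmul (f g : S -> R) : measurable_fun setT f -> measurable_fun setT g ->
  measurable_fun setT (fun x => f x * g x) by exact: measurable_funM.
have mD x : measurable_fun [set: S] (D x).
  apply: (poly_dist_fun (Q := fun g : S -> R => measurable_fun setT g)) => //.
  exact: pfun_char_poly.
apply: (measurability _ (RGenInftyO.measurableE R)).
move=> _ [_ [c ->] <-]; rewrite setTI.
pose X := 'rV[rat]_(n + n).
pose V (q : X) : 'rV[R]_(n + n) := map_mx (@ratr R) q.
have -> : (fun w => \sum_(l <- eigenvalues (N w)) phi l) @^-1` `]-oo, c[%classic
  = \bigcup_(j : nat) \bigcup_(k : nat) \bigcap_(m : nat)
     \bigcup_(q in [set q : X | Psi (V q) <= c - j.+1%:R^-1 /\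
                       forall i, `|V q 0 i| <= k%:R])
       [set w | D (V q) w < m.+1%:R^-1].
  apply/seteqP; split=> w /=; rewrite in_itv /=.
    have [x ex] := cvec_exists (N w).
    rewrite (sum_eigenvalues_cvec _ ex) -/(Psi x) => xc.
    have [j hj] : exists j : nat, j.+1%:R^-1 < c - Psi x.
      by have [j hj] := ltr_add_invr xc; exists j; rewrite ltrBrDl.
    have [k hk] : exists k : nat, forall i, `|x 0 i| < k%:R.
      exists (Num.bound (\sum_i `|x 0 i|)) => i.
      apply: le_lt_trans (archi_boundP (sumr_ge0 _ _)) => //.
      by rewrite (bigD1 i)//= lerDl sumr_ge0.
    exists j => //; exists k => // m _.
    have Dx : D x w = 0 by rewrite /D ex /poly_dist big1// => i _; rewrite subrr normc0 expr0n.
    have : nbhs x [set y | [/\ Psi y < c - j.+1%:R^-1, (forall i, `|y 0 i| < k%:R)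
       & D y w < m.+1%:R^-1]].
      have hj' : Psi x < c - j.+1%:R^-1 by rewrite ltrBrDl -ltrBrDr.
      have n1 : \forall y \near x, Psi y < c - j.+1%:R^-1.
        by apply: continuous_lt => //; exact: cPsi.
      have n2 : nbhs x [set y : 'rV[R]_(n + n) | forall i, `|y 0 i| < k%:R].
        have FF : Filter (nbhs x) := @nbhs_filter _ x.
        apply: (@filter_forall _ _ (fun (i : 'I_(n + n)) => [set y : 'rV[R]_(n + n) | `|y 0 i| < k%:R]) _ FF) => i.
        apply: (@continuous_lt _ _ (fun y : 'rV[R]_(n + n) => `|y 0 i|)) (hk i).
        apply: (@continuous_comp _ _ _ (fun y : 'rV[R]_(n + n) => y 0 i) (fun t : R => `|t|)).
          exact: cc.
        exact: norm_continuous.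
      have n3 : \forall y \near x, D y w < m.+1%:R^-1.
        by apply: continuous_lt; [exact: cD|rewrite Dx invr_gt0].
      by apply: filterS3 n1 n2 n3.
    move=> /rat_vec_open[q /= [q1 q2 q3]]; exists q => //=; split; first exact: ltW.
    by move=> i; exact: ltW.
  move=> [j _ [k _ h]].
  pose K := [set x : 'rV[R]_(n + n) | (forall i, `[- k%:R, k%:R]%classic (x 0 i))]
    `&` [set x | Psi x <= c - j.+1%:R^-1].
  have cK : compact K.
    apply: compact_closedI.
      exact: (@rV_compact R (n + n) (fun=> `[- k%:R, k%:R]%classic) (fun=> @segment_compact _ _ _)).
    rewrite (_ : [set x | _] = Psi @^-1` [set y | y <= c - j.+1%:R^-1])//.
    by apply: closed_comp; [move=> x _; exact: cPsi|exact: closed_le].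
  have inK q : Psi (V q) <= c - j.+1%:R^-1 -> (forall i, `|V q 0 i| <= k%:R) -> K (V q).
    by move=> q1 q2; split=> //= i; rewrite in_itv /= -ler_norml.
  have Kn0 : K !=set0.
    by have [q [q1 q2] _] := h 0%N I; exists (V q); exact: inK.
  have [x /set_mem xK xmin] : exists2 x, x \in K & forall y, y \in K -> D x w <= D y w.
    apply: compact_EVT_min => //; exact: continuous_subspaceT.
  have D0 : D x w = 0.
    apply/eqP; rewrite eq_le; apply/andP; split; last by apply: sumr_ge0 => i _; exact: sqr_ge0.
    apply/ler_addgt0Pr => e e0; rewrite add0r.
    have [m hm] := ltr_add_invr e0; rewrite add0r in hm.
    have [q [q1 q2] /= hq] := h m I.
    apply: le_trans (xmin (V q) _) (ltW (lt_trans hq hm)).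
    by apply/mem_set; exact: inK.
  have ex : char_poly (N w) = cvec_poly x.
    by apply/esym/(poly_dist_eq0 _ _ D0); rewrite ?size_cvec_poly ?size_char_poly.
  rewrite (sum_eigenvalues_cvec _ ex) -/(Psi x).
  apply: le_lt_trans (xK.2) _.
  by rewrite ltrBlDr ltrDl invr_gt0.
apply: bigcup_measurable => j _; apply: bigcup_measurable => k _.
apply: bigcap_measurableType => m _.
have cX : countable [set: X] by exact: countableP.
rewrite bigcup_mkcond; apply: (countable_bigcupT_measurable cX) => q; case: ifP => // _.
have /(_ measurableT [set true]) := measurable_fun_ltr (mD (V q)) (mcst m.+1%:R^-1).
by rewrite setTI; apply.
Qed.

End MeasurableEigenvalues.

(** * Laurent sums on the circle *)

Section Expi.
Variable R : realType.
Local Notation C := R[i].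

Lemma expiD (s t : R) : expi (s + t) = expi s * expi t.
Proof.
rewrite /expi cosD sinD; apply/eqP; rewrite eq_complex /=.
by rewrite eqxx addrC eqxx.
Qed.

Lemma expi0 : expi (0 : R) = 1.
Proof. by rewrite /expi cos0 sin0. Qed.

Lemma normc_expi (t : R) : normc (expi t) = 1.
Proof. by rewrite /normc /expi cos2Dsin2 sqrtr1. Qed.

Lemma expi_neq0 (t : R) : expi t != 0.
Proof. by rewrite -normc_eq0 normc_expi oner_eq0. Qed.

Lemma expiN (t : R) : expi (- t) = (expi t)^-1.
Proof.
apply: (mulfI (expi_neq0 t)); rewrite -expiD subrr expi0 divff//.
exact: expi_neq0.
Qed.

Lemma expi_conj (t : R) : Num.conj (expi t) = expi (- t).
Proof. by rewrite /expi cosN sinN. Qed.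

Lemma expi_natmul (t : R) m : expi (m%:R * t) = expi t ^+ m.
Proof.
elim: m => [|m IH]; first by rewrite mul0r expi0.
by rewrite exprS -IH -expiD -natr1 mulrDl mul1r addrC.
Qed.

Lemma expi_intmul (t : R) (z : int) : expi (z%:~R * t) = expi t ^ z.
Proof.
case: z => m; first exact: expi_natmul.
by rewrite NegzE mulrNz mulNr expiN -pmulrn expi_natmul -exprnN.
Qed.

Lemma expi_2pi : expi (2 * pi : R) = 1.
Proof. by rewrite /expi mulr_natl cos2pi sin2pi. Qed.

Lemma expi_eq1 (t : R) : 0 < t < 2 * pi -> expi t != 1.
Proof.
move=> /andP[t0 t2]; rewrite /expi eq_complex /= negb_and; apply/orP; left.
have -> : t = (t / 2) *+ 2 by rewrite -mulr_natr divfK.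
have s0 : 0 < sin (t / 2) by apply: sin_gt0_pi; lra.
rewrite cos_mulr2n cos2sin2; apply/eqP => h.
have : sin (t / 2) ^+ 2 = 0 by lra.
by move=> /eqP; rewrite sqrf_eq0 gt_eqF.
Qed.

Lemma lipschitz1_of_derive (f f' : R -> R) : (forall x : R, is_derive x 1 f (f' x)) ->
  (forall x, `|f' x| <= 1) -> forall s t, `|f s - f t| <= `|s - t|.
Proof.
move=> df f1.
have cf x : {for x, continuous f}.
  by apply/differentiable_continuous/derivable1_diffP; apply: ex_derive.
have key s t : s < t -> `|f t - f s| <= `|t - s|.
  move=> st; have [c _ ->] := MVT st (fun x _ => df x) (continuous_subspaceT cf).
  by rewrite normrM ler_piMl.
move=> s t; have [st|st|->] := ltgtP s t; last by rewrite !subrr.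
  by rewrite distrC [leRHS]distrC key.
exact: key.
Qed.

Lemma expi_surj (u : C) : normc u = 1 -> exists t : R, u = expi t.
Proof.
case: u => x y /= /(congr1 (fun r => r ^+ 2)).
rewrite sqr_sqrtr ?addr_ge0 ?sqr_ge0// expr1n => xy.
have x1 : -1 <= x <= 1 by apply/andP; split; nra.
have sx : `|y| = sin (acos x).
  by rewrite sin_acos// -xy addrAC subrr add0r sqrtr_sqr.
have cx := acosK x1; have [y0|y0] := leP 0 y.
  by exists (acos x); rewrite /expi cx -sx ger0_norm.
by exists (- acos x); rewrite /expi cosN sinN cx -sx ltr0_norm// opprK.
Qed.

Lemma expi_lipschitz (s t : R) : normc (expi s - expi t) <= 2 * `|s - t|.
Proof.
apply: le_trans (normc_ReIm _) _; rewrite mulr_natl mulr2n lerD//=.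
  apply: (@lipschitz1_of_derive cos (fun x => - sin x)) => x.
  by rewrite normrN sin_max.
by apply: (@lipschitz1_of_derive sin cos) => x; exact: cos_max.
Qed.

End Expi.

Section LaurentSums.
Variable R : realType.
Local Notation C := R[i].

Definition lsum (N : nat) (c : int -> C) (u : C) : C :=
  \sum_(0 <= m < N.*2.+1) c (m%:Z - N%:Z) * u ^ (m%:Z - N%:Z).

Definition asum (N : nat) (c : int -> C) : R :=
  \sum_(0 <= m < N.*2.+1) normc (c (m%:Z - N%:Z)).

Lemma asum_esum (c : int -> C) N :
  (((asum N c)%:E <= \esum_(j in [set: int]) (normc (c j))%:E)%E).
Proof.
pose r := [seq (m%:Z - N%:Z) | m <- index_iota 0 N.*2.+1].
have ur : uniq r.
  by rewrite map_inj_uniq ?iota_uniq// => i j /= /addIr [].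
apply: esum_ge; exists [set` r]; first by split => //; exact: finite_seq.
by rewrite -fsbig_seq//= /asum /r big_map sumEFin.
Qed.

Lemma normc_intr (j : int) : normc (j%:~R : C) = (absz j)%:R.
Proof.
case: j => m; first by rewrite -pmulrn normcMn normc1.
by rewrite NegzE mulrNz normcN -pmulrn normcMn normc1.
Qed.

Lemma sym_sum_S (V : zmodType) (F : int -> V) N :
  \sum_(0 <= m < N.+1.*2.+1) F (m%:Z - N.+1%:Z)
  = \sum_(0 <= m < N.*2.+1) F (m%:Z - N%:Z) + (F (- N.+1%:Z) + F N.+1%:Z).
Proof.
rewrite doubleS big_nat_recl// big_nat_recr//= sub0r addrCA.
congr (_ + _); last first.
  by congr (_ + F _); lia.
by apply: eq_bigr => m _; congr F; lia.
Qed.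

(** For [j != 0] the modulus of [a j] is at most that of [j%:~R * a j], so only [a 0] has to be
    added. [K0] will bound symbols and operator norms uniformly in the truncation, [K1] the
    Lipschitz constants of the symbols. *)
Lemma summable_bounds (a : int -> C) :
  (\esum_(j in [set: int]) (normc (j%:~R * a j))%:E < +oo)%E ->
  exists K0 K1 : R, forall N,
    asum N a <= K0 /\ asum N (fun j => j%:~R * a j) <= K1.
Proof.
move=> h; set K1 := fine (\esum_(j in [set: int]) (normc (j%:~R * a j))%:E)%E.
have hK1 N : asum N (fun j => j%:~R * a j) <= K1.
  rewrite -lee_fin fineK; first exact: (asum_esum (fun j => j%:~R * a j)).
  by rewrite ge0_fin_numE// esum_ge0// => j _; rewrite lee_fin normc_ge0.
exists (normc (a 0) + K1), K1 => N; split=> //.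
apply: (@le_trans _ _ (normc (a 0) + asum N (fun j => j%:~R * a j))); last by rewrite lerD2l.
have step j : j != 0 -> normc (a j) <= normc (j%:~R * a j).
  move=> j0; rewrite normcM normc_intr ler_peMl ?normc_ge0// ler1n.
  by rewrite absz_gt0.
rewrite /asum; elim: N => [|N IH].
  by rewrite !big_nat1 lerDl normc_ge0.
rewrite (sym_sum_S (fun j => normc (a j))).
rewrite (sym_sum_S (fun j => normc (j%:~R * a j))) [leRHS]addrA; apply: lerD => //.
by apply: lerD; apply: step.
Qed.

Lemma asum_nd (c : int -> C) : {homo asum^~ c : N M / (N <= M)%N >-> N <= M}.
Proof.
apply: homo_leq => //; first exact: le_trans.
move=> N; rewrite /asum (sym_sum_S (fun j => normc (c j))) lerDl.
by rewrite addr_ge0// normc_ge0.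
Qed.

(** Telescoping for natural exponents; inversion preserves the distance of two points of the circle,
    which settles the negative ones. *)
Lemma normc_expz_sub (u v : C) (j : int) : normc u = 1 -> normc v = 1 ->
  normc (u ^ j - v ^ j) <= (absz j)%:R * normc (u - v).
Proof.
move=> u1 v1; have nat_case m : normc (u ^+ m - v ^+ m) <= m%:R * normc (u - v).
  elim: m => [|m IH]; first by rewrite !expr0 subrr normc0 mul0r.
  have -> : u ^+ m.+1 - v ^+ m.+1 = u ^+ m * (u - v) + (u ^+ m - v ^+ m) * v.
    by rewrite !exprSr; ring.
  apply: le_trans (le_normcD _ _) _; rewrite !normcM normcX u1 v1 expr1n mul1r mulr1.
  by rewrite -natr1 mulrDl mul1r addrC lerD2r.
case: j => m; first exact: nat_case.
have nz (w : C) : normc w = 1 -> w ^+ m.+1 != 0.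
  by move=> w1; rewrite -normc_eq0 normcX w1 expr1n oner_eq0.
rewrite NegzE -!exprnN /=.
have -> : u ^- m.+1 - v ^- m.+1 = (v ^+ m.+1 - u ^+ m.+1) * (u ^+ m.+1 * v ^+ m.+1)^-1.
  by field; rewrite nz// nz.
rewrite normcM (normcB (v ^+ _)) normcV normcM !normcX u1 v1 !expr1n mulr1 invr1 mulr1.
exact: nat_case.
Qed.

Lemma lsum_lipschitz (a : int -> C) N u v : normc u = 1 -> normc v = 1 ->
  normc (lsum N a u - lsum N a v) <= asum N (fun j => j%:~R * a j) * normc (u - v).
Proof.
move=> u1 v1; rewrite /lsum -sumrB; apply: le_trans (le_normc_sum _ _ _) _.
rewrite /asum mulr_suml; apply: ler_sum => m _.
rewrite -mulrBr !normcM normc_intr (mulrC (_%:R)) -mulrA.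
by apply: ler_wpM2l; [exact: normc_ge0 | exact: normc_expz_sub].
Qed.

Lemma lsum_le (a : int -> C) N t : normc (lsum N a (expi t)) <= asum N a.
Proof.
apply: le_trans (le_normc_sum _ _ _) _; apply: ler_sum => m _.
by rewrite normcM -expi_intmul normc_expi mulr1.
Qed.

Lemma lsumS (c : int -> C) u N : lsum N.+1 c u =
  lsum N c u + (c (- N.+1%:Z) * u ^ (- N.+1%:Z) + c N.+1%:Z * u ^ N.+1%:Z).
Proof. exact: (sym_sum_S (fun j => c j * u ^ j)). Qed.

Lemma lsum_dist (a : int -> C) t N M : (N <= M)%N ->
  normc (lsum M a (expi t) - lsum N a (expi t)) <= asum M a - asum N a.
Proof.
move=> /subnK <-; elim: (M - N)%N => [|k IH]; first by rewrite add0n !subrr normc0.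
rewrite addSn lsumS addrAC.
have -> : asum (k + N).+1 a = asum (k + N) a + (normc (a (- (k + N).+1%:Z)) + normc (a (k + N).+1%:Z)).
  exact: (sym_sum_S (fun j => normc (a j))).
rewrite [leRHS]addrAC; apply: le_trans (le_normcD _ _) _; apply: lerD => //.
apply: le_trans (le_normcD _ _) _.
by rewrite !normcM -!expi_intmul !normc_expi !mulr1.
Qed.

(** Differences of partial sums on the circle are dominated by those of the series of moduli, where
    [t] does not occur: the Cauchy property is uniform in [t]. *)
Lemma asum_tail (a : int -> C) K0 : (forall N, asum N a <= K0) ->
  forall e : R, 0 < e -> exists N0, forall N M t, (N0 <= N)%N -> (N0 <= M)%N ->
    normc (lsum M a (expi t) - lsum N a (expi t)) <= e.
Proof.
move=> hK e e0.
have cv : cvgn (asum^~ a).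
  apply: nondecreasing_is_cvgn; first exact: asum_nd.
  by exists K0 => _ [N _ <-].
have [N0 _ hN0] : \forall N \near \oo, `|limn (asum^~ a) - asum N a| < e.
  by move/cvgrPdist_lt : cv => /(_ e e0).
have lim_ge M : asum M a <= limn (asum^~ a).
  by apply: nondecreasing_cvgn_le => //; exact: asum_nd.
have key N M : (N0 <= N)%N -> asum M a - asum N a <= e.
  move=> /hN0 /ltW; rewrite ger0_norm ?subr_ge0//; apply: le_trans.
  by rewrite lerB.
exists N0 => N M t hN hM; case: (leqP N M) => NM.
  exact: le_trans (lsum_dist _ _ NM) (key _ _ hN).
rewrite normcB; exact: le_trans (lsum_dist _ _ (ltnW NM)) (key _ _ hM).
Qed.

Lemma cauchyC_cvg (u : nat -> C) :
  (forall e : R, 0 < e -> exists N0, forall N M, (N0 <= N)%N -> (N0 <= M)%N ->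
     normc (u M - u N) <= e) ->
  exists l : C, forall e : R, 0 < e -> exists N0, forall N, (N0 <= N)%N ->
     normc (u N - l) <= e.
Proof.
move=> h.
have part (p : C -> R) : (forall x y, p x - p y = p (x - y)) -> (forall x, `|p x| <= normc x) ->
    cvgn (fun n => p (u n)).
  move=> pB pn; apply/cauchy_cvgP/cauchy_exP => e e0.
  have [N0 hN0] := h (e / 2) (divr_gt0 e0 (ltr0n _ 2)).
  exists (p (u N0)); exists N0 => // n /= hn; rewrite /ball /= pB.
  apply: le_lt_trans (pn _) _; apply: le_lt_trans (hN0 _ _ hn (leqnn _)) _.
  by rewrite ltr_pdivrMr// ltr_pMr// ltr1n.
have cRe : cvgn (fun n => complex.Re (u n)).
  by apply: part => [x y|x]; [rewrite raddfB|exact: Re_normc].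
have cIm : cvgn (fun n => complex.Im (u n)).
  by apply: part => [x y|x]; [rewrite raddfB|exact: Im_normc].
exists (limn (fun n => complex.Re (u n)) +i* limn (fun n => complex.Im (u n))) => e e0.
have e2 : 0 < e / 2 by rewrite divr_gt0.
move/cvgrPdist_lt : cRe => /(_ _ e2)[N1 _ h1].
move/cvgrPdist_lt : cIm => /(_ _ e2)[N2 _ h2].
exists (maxn N1 N2) => N; rewrite geq_max => /andP[/h1 H1 /h2 H2].
rewrite normcB; apply: le_trans (normc_ReIm _) _; rewrite [leRHS]splitr.
by case: (u N) H1 H2 => x y /= H1 H2; apply: lerD; exact: ltW.
Qed.

Lemma limnC (u : nat -> C) (l : C) :
  (forall e : R, 0 < e -> exists N0, forall N, (N0 <= N)%N -> normc (u N - l) <= e) ->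
  limn (u : nat -> C^o) = l.
Proof.
move=> h; apply: cvg_lim; first exact: norm_hausdorff.
move=> A /nbhs_normcP[e e0 eA].
have [N0 hN0] := h (e / 2) (divr_gt0 e0 (ltr0n _ 2)).
exists N0 => // N /= /hN0 hN; apply: eA; rewrite normcB; apply: le_lt_trans hN _.
by rewrite ltr_pdivrMr// ltr_pMr// ltr1n.
Qed.

Lemma laurent_sumE (a : int -> C) (k : \bar R) u :
  laurent_sum a k u = limn ((fun N => lsum N
    (fun j => if ((absz j)%:R%:E <= k)%E then a j else 0) u) : nat -> C^o).
Proof.
rewrite /laurent_sum; apply: (congr1 (fun v : nat -> C^o => limn v)); apply/funext => N.
by rewrite /lsum big_mkcond; apply: eq_bigr => m _; case: ifP => //; rewrite mul0r.
Qed.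

Lemma lsum_trunc (a : int -> C) (k N : nat) u : (k <= N)%N ->
  lsum N (fun j => if (absz j <= k)%N then a j else 0) u = lsum k a u.
Proof.
move=> /subnK <-; elim: (N - k)%N => [|d IH].
  rewrite add0n /lsum; apply: eq_big_nat => m /andP[_ mk].
  by rewrite ifT//; lia.
by rewrite addSn lsumS IH !ifF ?mul0r ?addr0//; lia.
Qed.

(** If [k] is finite the integers [k_ n] are eventually equal to it and the error is 0; if [k] is
    [+oo] the uniform tail bound applies; [-oo] contradicts [k_ n] being nonnegative. *)
Lemma laurent_sum_uniform (a : int -> C) (k_ : nat -> nat) (k : \bar R) K0 :
  (forall N, asum N a <= K0) -> (k_ n)%:R%:E @[n --> \oo] --> k ->
  forall e : R, 0 < e -> exists n0, forall n t, (n0 <= n)%N ->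
    normc (lsum (k_ n) a (expi t) - laurent_sum a k (expi t)) <= e.
Proof.
move=> hK kcv e e0.
case: k kcv => [k| |] kcv.
(* Two terms within one half of the limit are at distance less than 1, and integers that close
   coincide. *)
- have [n0 _ hn0] : \forall n \near \oo, `|k - (k_ n)%:R| < 2^-1.
    by move/fine_cvgP : kcv => [_ /cvgrPdist_lt]; apply; rewrite invr_gt0.
  have kE n : (n0 <= n)%N -> k_ n = k_ n0.
    move=> nn; have h1 := hn0 n nn; have h2 := hn0 n0 (leqnn _).
    have : `|(k_ n)%:R - (k_ n0)%:R : R| < 1.
      rewrite (_ : _ - _ = (k - (k_ n0)%:R) - (k - (k_ n)%:R)); last by ring.
      by apply: le_lt_trans (ler_normB _ _) _; rewrite [ltRHS](splitr 1) ltrD// div1r.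
    case: (ltngtP (k_ n) (k_ n0)) => // lt_kk.
      rewrite distrC -natrB 1?ltnW// normr_nat ltrn1 => /eqP; lia.
    by rewrite -natrB 1?ltnW// normr_nat ltrn1 => /eqP; lia.
  have kk : k = (k_ n0)%:R.
    apply/eqP; rewrite -subr_eq0 -normr_le0; apply/ler_addgt0Pr => d d0; rewrite add0r.
    have [n1 _ hn1] : \forall n \near \oo, `|k - (k_ n)%:R| < d.
      by move/fine_cvgP : kcv => [_ /cvgrPdist_lt]; apply.
    by rewrite -(kE (maxn n0 n1)) ?leq_maxl// ltW// hn1//= leq_maxr.
  exists n0 => n t nn; rewrite laurent_sumE (@limnC _ (lsum (k_ n) a (expi t))) ?subrr ?normc0 ?ltW//.
  move=> e' e'0; exists (k_ n) => N kN; rewrite kk -(kE n nn).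
  under [in lsum N _ _]eq_fun do rewrite lee_fin ler_nat.
  by rewrite lsum_trunc// subrr normc0 ltW.
- have [N0 hN0] := asum_tail hK e0.
  have [n0 _ hn0] : \forall n \near \oo, (N0 <= k_ n)%N.
    have /cvgeyPge/(_ N0%:R) := kcv.
    by apply: filterS => n; rewrite lee_fin ler_nat.
  exists n0 => n t /hn0 /= kn; rewrite laurent_sumE.
  have -> : (fun N => lsum N (fun j => if ((absz j)%:R%:E <= +oo :> \bar R)%E then a j else 0) (expi t))
      = (fun N => lsum N a (expi t)).
    by apply/funext => N; congr lsum; apply/funext => j; rewrite leey.
  have [l hl] : exists l : C, forall e : R, 0 < e -> exists N0, forall N, (N0 <= N)%N ->
     normc (lsum N a (expi t) - l) <= e.
    apply: cauchyC_cvg => e' e'0; have [N1 h1] := asum_tail hK e'0.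
    by exists N1 => N M hN hM; exact: h1.
  rewrite (limnC hl); apply/ler_addgt0Pr => d d0.
  have [N1 hN1] := hl d d0.
  apply: le_trans (ler_normc_distD (lsum (maxn N0 N1) a (expi t)) _ _) _.
  by apply: lerD; [apply: hN0 => //; rewrite leq_maxl|apply: hN1; rewrite leq_maxr].
- move/cvgeNyPle : kcv => /(_ (-1))[n0 _ /(_ n0 (leqnn _))].
  by rewrite /= lee_fin leNgt (lt_le_trans _ (ler0n _ _))// ltrN10.
Qed.

End LaurentSums.

(** * Toeplitz and circulant matrices *)

Section Circulant.
Variable R : realType.
Local Notation C := R[i].

Definition root_angle (n : nat) : R := 2 * pi / n%:R.

(** Reducing [d] modulo [n] leaves an angle in [[0, 2 pi[], where [expi] takes the value 1 at 0
    only. *)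
Lemma expi_root_eq1 n (d : int) : (0 < n)%N ->
  (expi (d%:~R * root_angle n) == 1) = (n %| absz d)%N.
Proof.
move=> n0; have nR0 : (n%:R : R) != 0 by rewrite pnatr_eq0 -lt0n.
have hq (q : int) : expi ((q * n%:Z)%:~R * root_angle n) = 1.
  rewrite intrM -mulrA; have -> : (n%:Z)%:~R * root_angle n = 2 * pi :> R.
    by rewrite -pmulrn /root_angle mulrC divfK.
  by rewrite expi_intmul expi_2pi exp1rz.
have dE := divz_eq d n; set q := (d %/ n)%Z in dE; set r := (d %% n)%Z in dE.
have r0 : 0 <= r by rewrite modz_ge0//; lia.
have rn : r < n by rewrite ltz_pmod//; lia.
have -> : expi (d%:~R * root_angle n) = expi (r%:~R * root_angle n).
  by rewrite dE intrD mulrDl expiD hq mul1r.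
have -> : (n %| absz d)%N = (r == 0).
  by change ((n%:Z %| d)%Z = (r == 0)); apply/dvdz_mod0P/eqP.
have [->|rn0] := eqVneq r 0; first by rewrite mul0r expi0 eqxx.
apply/negbTE/expi_eq1.
have rp : 0 < r by rewrite lt_def rn0.
have tau0 : 0 < root_angle n by rewrite divr_gt0 ?twopi_gt0// ltr0n.
rewrite mulr_gt0 ?ltr0z//=.
have -> : 2 * pi = n%:R * root_angle n :> R by rewrite /root_angle [RHS]mulrC divfK.
by rewrite ltr_pM2r// pmulrn ltr_int.
Qed.

Lemma sum_expi_root n (d : int) : (0 < n)%N ->
  \sum_(j < n) expi (j%:R * (d%:~R * root_angle n))
  = if (n %| absz d)%N then n%:R else 0.
Proof.
move=> n0; rewrite -(expi_root_eq1 d n0); set q := expi (d%:~R * _).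
have -> : \sum_(j < n) expi (j%:R * (d%:~R * root_angle n)) = \sum_(j < n) q ^+ j.
  by apply: eq_bigr => j _; rewrite expi_natmul.
have [->|q1] := eqVneq q 1.
  by under eq_bigr do rewrite expr1n; rewrite sumr_const card_ord.
have : (q - 1) * \sum_(j < n) q ^+ j = 0.
  rewrite -subrX1 -expi_natmul mulrCA; have -> : n%:R * root_angle n = 2 * pi.
    by rewrite /root_angle mulrC divfK// pnatr_eq0 -lt0n.
  by rewrite expi_intmul expi_2pi exp1rz subrr.
by move=> /eqP; rewrite mulf_eq0 subr_eq0 (negPf q1) => /eqP.
Qed.

Lemma adj_entry m n (M : 'M[C]_(m, n)) i j : adj M i j = Num.conj (M j i).
Proof. by rewrite !mxE. Qed.

(** With the minus sign, a frequency [j] of the symbol lands on the positions whose row minus column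
    is congruent to [j], as in the Toeplitz convention. *)
Definition dft n : 'M[C]_n := \matrix_(j, l)
  (((Num.sqrt n%:R)^-1)%:C * expi (- (j%:R * l%:R * root_angle n))).

Lemma dft_entry_mul n (i j l : 'I_n) (p : C) : (0 < n)%N ->
  dft n i l * p * Num.conj (dft n j l)
  = n%:R^-1 * (p * expi (l%:R * ((j%:Z - i%:Z)%:~R * root_angle n))).
Proof.
move=> n0; rewrite !mxE rmorphM /= expi_conj opprK.
have -> : Num.conj ((Num.sqrt n%:R)^-1)%:C = ((Num.sqrt (n%:R : R))^-1)%:C.
  by rewrite conj_Creal// ger0_real// ler0c invr_ge0 sqrtr_ge0.
have -> : expi (l%:R * ((j%:Z - i%:Z)%:~R * root_angle n))
    = expi (- (i%:R * l%:R * root_angle n)) * expi (j%:R * l%:R * root_angle n) :> C.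
  by rewrite -expiD intrB -!pmulrn; congr expi; ring.
have -> : n%:R^-1 = ((Num.sqrt (n%:R : R))^-1)%:C * ((Num.sqrt (n%:R : R))^-1)%:C :> C.
  rewrite -rmorphM -expr2 exprVn sqr_sqrtr//= rmorphV ?unitfE ?pnatr_eq0 -?lt0n//.
  by rewrite rmorph_nat.
by ring.
Qed.

Lemma unitaryc_dft n : (0 < n)%N -> unitaryc (dft n).
Proof.
move=> n0; rewrite -[dft n]adjK; apply: unitaryc_adj; rewrite /unitaryc adjK.
apply/matrixP => i j; rewrite !mxE.
have -> : \sum_l dft n i l * adj (dft n) l j
    = n%:R^-1 * \sum_(l < n) expi (l%:R * ((j%:Z - i%:Z)%:~R * root_angle n)).
  rewrite mulr_sumr; apply: eq_bigr => l _.
  by rewrite -[dft n i l]mulr1 adj_entry dft_entry_mul// mul1r.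
rewrite sum_expi_root//.
have -> : (n %| absz (j%:Z - i%:Z))%N = (i == j).
  apply/idP/eqP => [|->]; last by rewrite subrr dvdn0.
  move=> h; apply/val_inj/eqP => /=; move: (ltn_ord i) (ltn_ord j) => hi hj.
  have [//|ij] := eqVneq (i : nat) j.
  have := dvdn_leq _ h; lia.
by case: eqP; rewrite ?mulr0// mulVf// pnatr_eq0 -lt0n.
Qed.

Definition circulant_eigen (a : int -> C) k n : 'rV[C]_n :=
  \row_l lsum k a (expi (l%:R * root_angle n)).

Definition circulant (a : int -> C) k n : 'M[C]_n :=
  dft n *m diag_mx (circulant_eigen a k n) *m adj (dft n).

(** Orthogonality of characters keeps the indices congruent to [i - j] modulo [n]. When [2 * k + 1]
    exceeds [n] several of them may contribute to one entry. *)
Lemma circulantE (a : int -> C) k n (i j : 'I_n) :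
  circulant a k n i j = \sum_(0 <= m < k.*2.+1)
    (if (n %| absz (m%:Z - k%:Z - (i%:Z - j%:Z))%R)%N then a (m%:Z - k%:Z) else 0).
Proof.
have n0 : (0 < n)%N by apply: leq_ltn_trans (ltn_ord i).
rewrite /circulant mxE.
have -> : \sum_l (dft n *m diag_mx (circulant_eigen a k n)) i l * adj (dft n) l j
    = n%:R^-1 * \sum_(l < n) \sum_(0 <= m < k.*2.+1) a (m%:Z - k%:Z) *
        expi (l%:R * ((m%:Z - k%:Z - (i%:Z - j%:Z))%:~R * root_angle n)).
  rewrite mulr_sumr; apply: eq_bigr => l _.
  rewrite mul_mx_diag adj_entry mxE [X in _ * X * _]mxE.
  rewrite dft_entry_mul// /lsum mulr_suml; congr (_ * _); apply: eq_bigr => m _.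
  rewrite -mulrA -expi_intmul -expiD; congr (_ * expi _).
  rewrite [(m%:Z - k%:Z - _)%:~R]intrB -(opprB j%:Z) mulrNz opprK; ring.
rewrite exchange_big /= mulr_sumr; apply: eq_bigr => m _.
rewrite -mulr_sumr sum_expi_root//; case: ifP => _; last by rewrite !mulr0.
by rewrite mulrCA mulVf ?mulr1// pnatr_eq0 -lt0n.
Qed.

Lemma toeplitzE (a : int -> C) k n (i j : 'I_n) :
  toeplitz a k n i j = \sum_(0 <= m < k.*2.+1)
    (if m%:Z - k%:Z == i%:Z - j%:Z then a (m%:Z - k%:Z) else 0).
Proof.
rewrite mxE; case: ifP => h.
  have [m [mk mE]] : exists m : nat, (m < k.*2.+1)%N /\ m%:Z - k%:Z = i%:Z - j%:Z.
    exists (absz (k%:Z + (i%:Z - j%:Z))); lia.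
  rewrite big_mkord (bigD1 (Ordinal mk))//= mE eqxx big1 ?addr0// => p pm.
  case: eqP => // e; case/eqP: pm; apply: val_inj => /=; lia.
rewrite big_nat big1// => m mk; case: eqP => // e; exfalso; move/negbT: h; lia.
Qed.

(** In such a row no index wraps around: an index of the band differs from [i - j] by less than [n],
    so congruence is equality. *)
Lemma toeplitz_circulant_eq (a : int -> C) k n (i j : 'I_n) :
  (k <= i)%N -> (i + k < n)%N -> toeplitz a k n i j = circulant a k n i j.
Proof.
move=> ki ikn; rewrite toeplitzE circulantE; apply: eq_big_nat => m mk.
have -> // : (m%:Z - k%:Z == i%:Z - j%:Z) = (n %| absz (m%:Z - k%:Z - (i%:Z - j%:Z))%R)%N.
apply/eqP/idP => [->|h]; first by rewrite subrr dvdn0.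
have [->//|ne] := eqVneq (m%:Z - k%:Z) (i%:Z - j%:Z).
have := dvdn_leq _ h; have := ltn_ord j; lia.
Qed.

Lemma rank_rows n (L : 'M[C]_n) (P : pred 'I_n) :
  (forall i j, ~~ P i -> L i j = 0) -> (\rank L <= \sum_(i < n) P i)%N.
Proof.
move=> h.
have -> : L = \sum_(i | P i) (delta_mx i (0 : 'I_1) *m row i L).
  apply/matrixP => i j; rewrite summxE.
  have E l : (delta_mx l (0 : 'I_1) *m row l L) i j = (i == l)%:R * L l j.
    by rewrite mxE big_ord1 !mxE eqxx andbT.
  under eq_bigr do rewrite E.
  have [Pi|nPi] := boolP (P i).
    rewrite (bigD1 i)//= eqxx mul1r big1 ?addr0// => l /andP[_ li].
    by rewrite eq_sym (negPf li) mul0r.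
  rewrite h// big1// => l Pl; have [e|] := eqVneq i l; last by rewrite mul0r.
  by rewrite e Pl in nPi.
rewrite [leqRHS](_ : _ = \sum_(i | P i) 1)%N; last by rewrite [RHS]big_mkcond /=; apply: eq_bigr => i _; case: (P i).
elim/big_rec2: _ => [|i x M _ IH]; first by rewrite mxrank0.
apply: leq_trans (mxrank_add _ _) _; apply: leq_add => //.
exact: mulmx_max_rank.
Qed.

Lemma sum_ord_ltn n k : (\sum_(i < n) (i < k) <= k)%N.
Proof.
elim: n => [|n IH]; first by rewrite big_ord0.
have [nk|kn] := ltnP n k; last by rewrite big_ord_recr /= ltnNge kn addn0.
apply: (@leq_trans (\sum_(i < n.+1) 1)); last by rewrite sum1_card card_ord.
by apply: leq_sum => i _; case: (_ < _)%N.
Qed.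

(** The two matrices can differ only in the first [k] and the last [k] rows. *)
Lemma rank_toeplitz_sub_circulant (a : int -> C) k n :
  (mxrank (toeplitz a k n - circulant a k n)%R <= 2 * k)%N.
Proof.
pose P (i : 'I_n) := ((i < k) || (n <= i + k))%N.
apply: leq_trans (@rank_rows n _ P _) _.
  move=> i j; rewrite /P negb_or -leqNgt -ltnNge => /andP[h1 h2].
  by rewrite [LHS]mxE [X in _ + X]mxE toeplitz_circulant_eq ?subrr.
apply: (@leq_trans (\sum_(i < n) ((i < k) + (n <= i + k)))).
  by apply: leq_sum => i _; rewrite /P; case: (i < k)%N; case: (n <= i + k)%N.
rewrite big_split mul2n -addnn; apply: leq_add; first exact: sum_ord_ltn.
rewrite (reindex_inj rev_ord_inj) /=.
apply: leq_trans (sum_ord_ltn n k); apply: leq_sum => i _.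
have i_n := ltn_ord i.
have -> : (n <= n - i.+1 + k)%N = (i < k)%N by apply/idP/idP; lia.
exact: leqnn.
Qed.

Lemma opbound_partial_perm n (P : rel 'I_n) :
  (forall i j j', P i j -> P i j' -> j = j') ->
  (forall i i' j, P i j -> P i' j -> i = i') ->
  opbound 1 (\matrix_(i, j) (P i j)%:R : 'M[C]_n).
Proof.
move=> h1 h2 x; rewrite mul1r -(@ler_pXn2r _ 2)// ?nnegrE ?l2norm_ge0//.
rewrite !sqr_l2norm.
apply: (@le_trans _ _ (\sum_i \sum_j (P i j)%:R * normc (x j 0) ^+ 2)).
  apply: ler_sum => i _; rewrite mxE.
  have [/existsP[j Pj]|/existsPn nP] := boolP [exists j, P i j].
    have F (V : nzRingType) (G : 'I_n -> V) : \sum_j (P i j)%:R * G j = G j.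
      rewrite (bigD1 j)//= Pj mul1r big1 ?addr0// => j' j'j.
      case: (boolP (P i j')) => [Pj'|_]; last by rewrite mul0r.
      by rewrite (h1 _ _ _ Pj Pj') eqxx in j'j.
    rewrite F; under eq_bigr do rewrite mxE.
    by rewrite F.
  rewrite big1 ?normc0 ?expr0n ?sumr_ge0//= => j _; last by rewrite mxE (negPf (nP j)) mul0r.
  by rewrite mulr_ge0 ?sqr_ge0.
rewrite exchange_big /=; apply: ler_sum => j _; rewrite -mulr_suml ler_piMl ?sqr_ge0//.
have [/existsP[i Pi]|/existsPn nP] := boolP [exists i, P i j].
  rewrite (bigD1 i)//= Pi big1 ?addr0// => i' i'i.
  case: (boolP (P i' j)) => [Pi'|//].
  by rewrite (h2 _ _ _ Pi Pi') eqxx in i'i.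
by rewrite big1 ?ler01// => i _; rewrite (negPf (nP i)).
Qed.

(** The matrix is a combination of shifts with coefficients [a j], and each shift is a partial
    permutation, of norm at most 1. *)
Lemma opbound_toeplitz (a : int -> C) k n : opbound (asum k a) (toeplitz a k n).
Proof.
have -> : toeplitz a k n = \sum_(0 <= m < k.*2.+1) a (m%:Z - k%:Z) *:
    \matrix_(i, j) (m%:Z - k%:Z == i%:Z - j%:Z)%:R.
  apply/matrixP => i j; rewrite toeplitzE summxE; apply: eq_bigr => m _.
  by rewrite !mxE; case: eqP; rewrite ?mulr1 ?mulr0.
rewrite /asum; apply: opbound_sum => m _.
rewrite -[normc _]mulr1; apply: opboundZ.
apply: (@opbound_partial_perm n (fun i j => m%:Z - k%:Z == i%:Z - j%:Z)).
  by move=> i j j' /eqP e1 /eqP e2; apply: val_inj => /=; lia.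
by move=> i i' j /eqP e1 /eqP e2; apply: val_inj => /=; lia.
Qed.

Lemma opbound_circulant (a : int -> C) k n : opbound (asum k a) (circulant a k n).
Proof.
case: n => [|n].
  by move=> x; rewrite (_ : x = 0) ?mulmx0 ?l2norm0 ?mulr0//; apply/matrixP => -[].
have K0 : 0 <= asum k a by apply: sumr_ge0 => m _; exact: normc_ge0.
apply: (opbound_conj (unitaryc_dft (ltn0Sn n))); apply: (opbound_diag K0) => i.
by rewrite mxE lsum_le.
Qed.

End Circulant.

(** * The logarithmic kernel on a grid *)

Section Kernel.
Variable R : realType.
Local Notation C := R[i].

Lemma hker_ge0 (s : R) (x : C) : 0 <= s -> 0 <= hker s x.
Proof.
by move=> s0; rewrite /hker ln_ge0// lerDl divr_ge0// exprn_ge0// normc_ge0.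
Qed.

Lemma hker_le (s : R) (x : C) (a : R) : 0 <= s -> 0 < a -> a <= normc x ->
  hker s x <= ln (1 + s / a ^+ 4).
Proof.
move=> s0 a0 ax; have x0 : 0 < normc x by exact: lt_le_trans ax.
have a0' := ltW a0.
rewrite ler_ln ?posrE ?ltr_wpDr ?divr_ge0 ?exprn_ge0 ?normc_ge0//.
rewrite lerD2l ler_wpM2l// lef_pV2 ?posrE ?exprn_gt0//.
by rewrite lerXn2r ?nnegrE ?normc_ge0.
Qed.

Lemma hker_le_div (s : R) (x : C) (a : R) : 0 <= s -> 0 < a -> a <= normc x ->
  hker s x <= s / a ^+ 4.
Proof.
move=> s0 a0 ax; apply: le_trans (hker_le s0 a0 ax) _.
by apply: le_ln1Dx; rewrite (lt_le_trans (ltrN10 _))// divr_ge0// exprn_ge0// ltW.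
Qed.

(** For [|x| <= |y|] the terms [ln (s + |.|^4)] contribute with a favourable sign; what remains is
    [4 (ln |y| - ln |x|)], hence a bound uniform in [s]. *)
Lemma hker_dist (s : R) (x y : C) (a e : R) : 0 < s -> 0 < a ->
  a <= normc x -> a <= normc y -> `|normc x - normc y| <= e ->
  `|hker s x - hker s y| <= 4 * (e / a).
Proof.
move=> s0 a0; wlog xy : x y / normc x <= normc y.
  move=> h ax ay xye; have [xy|/ltW yx] := leP (normc x) (normc y); first exact: h.
  by rewrite distrC h// distrC.
move=> ax ay xye.
have x0 : 0 < normc x by exact: lt_le_trans ax.
have y0 : 0 < normc y by exact: lt_le_trans ay.
rewrite ger0_norm ?subr_ge0; last exact: hker_le (ltW s0) x0 xy.
rewrite !hker_ln -?normc_gt0// !lnXn//.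
rewrite -(mulr_natl (ln (normc x))) -(mulr_natl (ln (normc y))).
have l1 : ln (s + normc x ^+ 4) <= ln (s + normc y ^+ 4).
  rewrite ler_ln ?posrE ?addr_gt0 ?exprn_gt0// lerD2l lerXn2r// ?nnegrE normc_ge0//.
have l2 : ln (normc y) - ln (normc x) <= e / a.
  rewrite -ln_div ?posrE//.
  have -> : normc y / normc x = 1 + (normc y - normc x) / normc x.
    by rewrite mulrBl divff ?gt_eqF// addrC subrK.
  apply: le_trans (le_ln1Dx _) _.
    by rewrite (lt_le_trans (ltrN10 _))// divr_ge0 ?subr_ge0// ltW.
  have e0 : 0 <= e by apply: le_trans xye.
  apply: ler_pM; rewrite ?subr_ge0 ?invr_ge0// ?lef_pV2 ?posrE//; first exact: ltW.
  by apply: le_trans xye; rewrite distrC ler_norm.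
lra.
Qed.

(** The inequalities place the window of radius [M] around [p0], which carries all the nonzero
    terms, inside [[-m, m[]; the sum is then independent of [p0]. *)
Lemma sum_int_shift (V : zmodType) (W : int -> V) (m M : nat) (p0 : int) :
  (forall i, (M < absz i)%N -> W i = 0) ->
  - m%:Z <= p0 - M%:Z -> p0 + M%:Z < m%:Z ->
  \sum_(0 <= p < m.*2) W (p%:Z - m%:Z - p0) = \sum_(0 <= i < M.*2.+1) W (i%:Z - M%:Z).
Proof.
move=> W0 h1 h2; set a := absz (m%:Z + p0 - M%:Z)%R.
have aE : a%:Z = m%:Z + p0 - M%:Z by rewrite /a; lia.
have -> : \sum_(0 <= i < M.*2.+1) W (i%:Z - M%:Z)
    = \sum_(a <= p < M.*2.+1 + a) W (p%:Z - m%:Z - p0).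
  rewrite -[in RHS](add0n a) big_addn addnK; apply: eq_bigr => i _; congr W; lia.
rewrite [RHS](big_nat_widen _ _ m.*2); last by lia.
rewrite [RHS](big_nat_widenl _ 0)// [RHS]big_mkcond; apply: eq_big_nat => p pm.
case: ifP => // /negbT h; apply: W0; lia.
Qed.

Lemma sum_indic (n a b : nat) : (b <= n)%N -> (a <= b)%N ->
  \sum_(0 <= i < n) ((a <= i < b)%N%:R : R) = (b - a)%:R.
Proof.
move=> bn ab; have <- : \sum_(a <= i < b) (1 : R) = (b - a)%:R by rewrite sumr_const_nat.
rewrite [RHS](big_nat_widen _ _ n)// [RHS](big_nat_widenl _ 0)// [RHS]big_mkcond.
by apply: eq_bigr => i _; rewrite /= andbC; case: ifP.
Qed.

Lemma Num_floor_cell (x : R) : exists p : int, p%:~R <= x /\ x < (p + 1)%:~R.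
Proof. by exists (Num.floor x); have /andP[-> ->] := real_floor_itv (num_real x). Qed.

(* [W] is the kernel centred at a lattice point, cut off near and far away;
   the mesh is 1/N. *)
Definition wcell (s : R) (N M R1 : nat) (i j : int) : R :=
  if [&& (absz i <= M)%N, (absz j <= M)%N & (R1 < absz i)%N || (R1 < absz j)%N]
  then hker s ((i%:~R / N%:R) +i* (j%:~R / N%:R)) else 0.

(** The normalizing constant of the grid sums, by translation the same for every cell that may
    contain the point of evaluation. *)
Definition wmass (s : R) (N M R1 : nat) : R :=
  \sum_(0 <= i < M.*2.+1) \sum_(0 <= j < M.*2.+1) wcell s N M R1 (i%:Z - M%:Z) (j%:Z - M%:Z).

Definition in_cell (N : nat) (z : C) (p q : int) :=
  [/\ p%:~R <= N%:R * complex.Re z, N%:R * complex.Re z <= (p + 1)%:~R,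
      q%:~R <= N%:R * complex.Im z & N%:R * complex.Im z <= (q + 1)%:~R].

Lemma sum2_int_shift (V : zmodType) (W : int -> int -> V) (m M : nat) (p0 q0 : int) :
  (forall i j, (M < absz i)%N || (M < absz j)%N -> W i j = 0) ->
  - m%:Z <= p0 - M%:Z -> p0 + M%:Z < m%:Z ->
  - m%:Z <= q0 - M%:Z -> q0 + M%:Z < m%:Z ->
  \sum_(0 <= p < m.*2) \sum_(0 <= q < m.*2) W (p%:Z - m%:Z - p0) (q%:Z - m%:Z - q0)
  = \sum_(0 <= i < M.*2.+1) \sum_(0 <= j < M.*2.+1) W (i%:Z - M%:Z) (j%:Z - M%:Z).
Proof.
move=> W0 h1 h2 h3 h4.
rewrite -(@sum_int_shift _ (fun i => \sum_(0 <= j < M.*2.+1) W i (j%:Z - M%:Z)) m M p0)//.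
  apply: eq_bigr => p _; apply: sum_int_shift => // j hj.
  by apply: W0; rewrite hj orbT.
by move=> i hi; apply: big1 => j _; apply: W0; rewrite hi.
Qed.

Lemma hker_ge (s : R) (x : C) (b : R) : 0 <= s -> 0 < normc x -> normc x <= b ->
  ln (1 + s / b ^+ 4) <= hker s x.
Proof.
move=> s0 x0 xb; have b0 : 0 < b by exact: lt_le_trans xb.
have b0' := ltW b0.
rewrite ler_ln ?posrE ?ltr_wpDr ?divr_ge0 ?exprn_ge0 ?normc_ge0//.
rewrite lerD2l ler_wpM2l// lef_pV2 ?posrE ?exprn_gt0//.
by rewrite lerXn2r ?nnegrE ?normc_ge0.
Qed.

Lemma wcell_ge0 s N M R1 i j : 0 <= s -> 0 <= wcell s N M R1 i j.
Proof. by move=> s0; rewrite /wcell; case: ifP => // _; exact: hker_ge0. Qed.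

(** Only the offsets with both coordinates in []R1, L]] are kept; there are [(L - R1) ^ 2] of them,
    of modulus at most [2 * L / N]. *)
Lemma wmass_ge (s : R) (N M R1 L : nat) : 0 <= s -> (0 < N)%N -> (R1 <= L)%N -> (L <= M)%N ->
  ((L - R1)%:R ^+ 2) * ln (1 + s / (2 * L%:R / N%:R) ^+ 4) <= wmass s N M R1.
Proof.
move=> s0 N0 RL LM; set v := ln _.
pose chi (i : nat) : R := ((M + R1).+1 <= i < (M + L).+1)%N%:R.
have sumchi : \sum_(0 <= i < M.*2.+1) chi i = (L - R1)%:R.
  rewrite sum_indic; [congr (_%:R)| |]; lia.
rewrite -sumchi expr2 mulr_suml mulr_suml; apply: ler_sum => i _.
rewrite mulr_sumr mulr_suml; apply: ler_sum => j _.
rewrite /chi; case: (boolP (M + R1 < i < (M + L).+1)%N) => [ci|_]; last by rewrite !mul0r wcell_ge0.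
case: (boolP (M + R1 < j < (M + L).+1)%N) => [cj|_]; last by rewrite mulr0 mul0r wcell_ge0.
rewrite !mul1r /wcell ifT; last by lia.
have NR : 0 < N%:R :> R by rewrite ltr0n.
have [ii iE] : exists ii : nat, i%:Z - M%:Z = ii%:Z /\ (0 < ii <= L)%N by exists (i - M)%N; lia.
have [jj jE] : exists jj : nat, j%:Z - M%:Z = jj%:Z /\ (0 < jj <= L)%N by exists (j - M)%N; lia.
case: iE jE => -> /andP[i0 iL] [-> /andP[j0 jL]]; rewrite -!pmulrn.
apply: hker_ge => //.
  rewrite normc_gt0 eq_complex /= negb_and; apply/orP; left.
  by rewrite mulf_neq0 ?invr_neq0 ?pnatr_eq0 -?lt0n.
apply: le_trans (normc_ReIm _) _ => /=.
rewrite !ger0_norm ?divr_ge0//  -mulrDl ler_pM2r ?invr_gt0// mulr_natl mulr2n.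
by rewrite lerD// ler_nat.
Qed.

(** Scaled by [N], each coordinate of [z - la] is within 1 of its integer offset. Adding the two
    coordinates gives [2 / N]; the coordinate with the larger offset alone gives the lower bound. *)
Lemma cell_dist (N : nat) (la z : C) (p0 q0 p q : int) : (0 < N)%N ->
  in_cell N la p0 q0 -> in_cell N z p q ->
  `|normc (la - z) - normc (((p - p0)%:~R / N%:R) +i* ((q - q0)%:~R / N%:R))| <= 2 / N%:R
  /\ ((maxn (absz (p - p0)) (absz (q - q0)))%:R - 1) / N%:R <= normc (la - z).
Proof.
move=> N0 [a1 a2 a3 a4] [b1 b2 b3 b4].
have NR : 0 < N%:R :> R by rewrite ltr0n.
set v := _ +i* _; set w := z - la.
have -> : normc (la - z) = normc w by rewrite normcB.
rewrite !intrD in a1 a2 a3 a4 b1 b2 b3 b4.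
have eR : `|N%:R * complex.Re w - (p - p0)%:~R| <= 1.
  rewrite raddfB mulrBr intrB ler_norml; apply/andP; split; lra.
have eI : `|N%:R * complex.Im w - (q - q0)%:~R| <= 1.
  rewrite raddfB mulrBr intrB ler_norml; apply/andP; split; lra.
have scale (x y : R) : `|N%:R * x - y| <= 1 -> `|x - y / N%:R| <= 1 / N%:R.
  move=> h; have -> : x - y / N%:R = (N%:R * x - y) / N%:R.
    by rewrite mulrBl mulrAC divff ?gt_eqF// mul1r.
  by rewrite normrM normfV (gtr0_norm NR) ler_pM2r ?invr_gt0.
split.
  apply: (@le_trans _ _ (normc (w - v))).
    rewrite ler_norml; apply/andP; split.
      by rewrite lerNl opprB lerBlDr normcB -{1}(subrK w v) le_normcD.
    by rewrite lerBlDr -{1}(subrK v w) le_normcD.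
  apply: le_trans (normc_ReIm _) _.
  have -> : complex.Re (w - v) = complex.Re w - (p - p0)%:~R / N%:R by rewrite raddfB.
  have -> : complex.Im (w - v) = complex.Im w - (q - q0)%:~R / N%:R by rewrite raddfB.
  by apply: le_trans (lerD (scale _ _ eR) (scale _ _ eI)) _; rewrite -mulrDl.
rewrite ler_pdivrMr// mulrC.
have part (x : R) (i : int) : `|N%:R * x - i%:~R| <= 1 -> `|x| <= normc w ->
    (absz i)%:R - 1 <= N%:R * normc w.
  move=> h xw; apply: (@le_trans _ _ (N%:R * `|x|)); last by rewrite ler_wpM2l.
  rewrite lerBlDr; have -> : (absz i)%:R = `|i%:~R : R| by rewrite -intr_norm -abszE -pmulrn.
  have -> : N%:R * `|x| = `|N%:R * x| by rewrite normrM (gtr0_norm NR).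
  rewrite -[i%:~R](subKr (N%:R * x)).
  by apply: le_trans (ler_normB _ _) _; rewrite lerD2l.
have := part _ _ eR (Re_normc w); have := part _ _ eI (Im_normc w).
by case: (leqP (absz (p - p0)) (absz (q - q0))) => h.
Qed.

Definition box (M : nat) (i j : int) : R := ((absz i <= M)%N && (absz j <= M)%N)%:R.

Lemma sum2_box (m M : nat) (p0 q0 : int) :
  - m%:Z <= p0 - M%:Z -> p0 + M%:Z < m%:Z ->
  - m%:Z <= q0 - M%:Z -> q0 + M%:Z < m%:Z ->
  \sum_(0 <= p < m.*2) \sum_(0 <= q < m.*2) box M (p%:Z - m%:Z - p0) (q%:Z - m%:Z - q0)
  = (M.*2.+1)%:R ^+ 2.
Proof.
move=> h1 h2 h3 h4; rewrite (@sum2_int_shift _ (box M) m M p0 q0)//; last first.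
  by move=> i j h; rewrite /box; case: andP => // -[]; lia.
rewrite (eq_big_nat _ _ (F2 := fun=> (M.*2.+1)%:R)).
  by rewrite sumr_const_nat subn0 expr2 mulr_natl.
move=> i hi; rewrite (eq_big_nat _ _ (F2 := fun=> 1)).
  by rewrite sumr_const_nat subn0.
by move=> j hj; rewrite /box; case: andP => // -[]; lia.
Qed.

Lemma wcell_out s N M R1 (i j : int) : (M < absz i)%N || (M < absz j)%N ->
  wcell s N M R1 i j = 0.
Proof.
by move=> h; rewrite /wcell ifF//; apply/negbTE; case/orP: h => h; rewrite !negb_and -!ltnNge h ?orbT.
Qed.

Lemma shift_range (m M R1 : nat) (p0 : int) : (R1 <= M)%N ->
  - m%:Z <= p0 - M%:Z -> p0 + M%:Z < m%:Z ->
  - m%:Z <= p0 - R1%:Z /\ p0 + R1%:Z < m%:Z.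
Proof. by lia. Qed.

(** * The kernel sum at one point, split into near, middle and far cells *)

Section GridEstimate.
Variables (g : C -> R) (B om s : R) (N M R1 m : nat) (la : C) (p0 q0 : int).
Variable zz : nat -> nat -> C.
Hypothesis gB : forall z, 0 <= g z <= B.
Hypotheses (s0 : 0 < s) (om0 : 0 <= om) (N0 : (0 < N)%N) (R10 : (0 < R1)%N).
Hypotheses (RM : (R1 <= M)%N) (la_cell : in_cell N la p0 q0).
Hypotheses (p1 : - m%:Z <= p0 - M%:Z) (p2 : p0 + M%:Z < m%:Z).
Hypotheses (q1 : - m%:Z <= q0 - M%:Z) (q2 : q0 + M%:Z < m%:Z).
Hypothesis zz_cell : forall p q, (p < m.*2)%N -> (q < m.*2)%N ->
  in_cell N (zz p q) (p%:Z - m%:Z) (q%:Z - m%:Z).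
Hypothesis g_close : forall z, normc (la - z) <= 2 * (M.+1)%:R / N%:R -> `|g z - g la| <= om.

Let gridsum := \sum_(0 <= p < m.*2) \sum_(0 <= q < m.*2) g (zz p q) * hker s (la - zz p q).
Let W p q := wcell s N M R1 (p%:Z - m%:Z - p0) (q%:Z - m%:Z - q0).
Let c := wmass s N M R1.
(** The value of [hker_dist] for a displacement [2 / N] at distance [R1 / N] from the pole. *)
Let e : R := 8 / R1%:R.

Lemma wcell_close p q (i := p%:Z - m%:Z - p0) (j := q%:Z - m%:Z - q0) :
  (p < m.*2)%N -> (q < m.*2)%N ->
  (absz i <= M)%N -> (absz j <= M)%N -> (R1 < absz i)%N || (R1 < absz j)%N ->
  `|hker s (la - zz p q) - W p q| <= e /\ `|g (zz p q) - g la| <= om.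
Proof.
move=> pm qm iM jM ij.
have NR : 0 < N%:R :> R by rewrite ltr0n.
have RR : 0 < R1%:R :> R by rewrite ltr0n.
have [d1 d2] := cell_dist N0 la_cell (zz_cell pm qm).
rewrite -/i -/j in d1 d2.
set v := _ +i* _ in d1.
have maxR : (R1.+1 <= maxn (absz i) (absz j))%N by rewrite leq_max.
have v_le : normc v <= 2 * M%:R / N%:R.
  apply: le_trans (normc_ReIm _) _ => /=; rewrite !normrM normfV (gtr0_norm NR) -mulrDl.
  rewrite ler_pM2r ?invr_gt0// mulr_natl mulr2n -!intr_norm -!abszE -!pmulrn.
  by rewrite lerD// ler_nat.
have v_ge : R1%:R / N%:R <= normc v.
  have [h|h] := orP ij.
    apply: le_trans (Re_normc _) => /=; rewrite normrM normfV (gtr0_norm NR).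
    by rewrite ler_pM2r ?invr_gt0// -intr_norm -abszE -pmulrn ler_nat ltnW.
  apply: le_trans (Im_normc _) => /=; rewrite normrM normfV (gtr0_norm NR).
  by rewrite ler_pM2r ?invr_gt0// -intr_norm -abszE -pmulrn ler_nat ltnW.
split.
  rewrite /W /wcell ifT; last by rewrite -/i -/j iM jM ij.
  apply: le_trans (hker_dist s0 (a := R1%:R / N%:R) _ _ v_ge d1) _.
  - by rewrite divr_gt0.
  - apply: le_trans d2; rewrite ler_pM2r ?invr_gt0//.
    by rewrite lerBrDr natr1 ler_nat.
  have -> : 2 / N%:R / (R1%:R / N%:R) = 2 / R1%:R :> R by field; rewrite !gt_eqF.
  by rewrite /e mulrA -natrM.
apply: g_close; have := le_trans (ler_norm _) d1.
rewrite lerBlDr => /le_trans; apply.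
have -> : 2 * M.+1%:R / N%:R = 2 / N%:R + 2 * M%:R / N%:R :> R by rewrite -[M.+1%:R]natr1; ring.
by rewrite lerD2l.
Qed.

(** Near and far cells contribute nonnegative terms and are dropped. In a middle cell the kernel is
    replaced by [W], at the cost of [(B + om) * e] for each cell of the box of radius [M]. *)
Lemma grid_lower : (g la - om) * c - (B + om) * e * (M.*2.+1)%:R ^+ 2 <= gridsum.
Proof.
have e0 : 0 <= e by rewrite divr_ge0.
have g0 := gB la; have B0 : 0 <= B by case/andP: g0 => /le_trans h /h.
rewrite -(sum2_box p1 p2 q1 q2) /c /wmass.
rewrite -(@sum2_int_shift _ (wcell s N M R1) m M p0 q0)//; last first.
  exact: wcell_out.
rewrite !mulr_sumr -sumrB; apply: ler_sum_nat => p pm.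
rewrite !mulr_sumr -sumrB; apply: ler_sum_nat => q qm.
have /andP[gz0 gzB] := gB (zz p q); case/andP: g0 => gl0 glB.
have h0 : 0 <= hker s (la - zz p q) by apply: hker_ge0; exact: ltW.
rewrite -/(W p q).
have := @wcell_close p q pm qm.
set i := p%:Z - m%:Z - p0; set j := q%:Z - m%:Z - q0.
have box0 : 0 <= box M i j by rewrite /box.
have err0 : 0 <= (B + om) * e * box M i j by rewrite !mulr_ge0// addr_ge0.
have [/and3P[iM jM ij]|nmid] := boolP [&& (absz i <= M)%N, (absz j <= M)%N & (R1 < absz i)%N || (R1 < absz j)%N].
  move=> /(_ iM jM ij)[]; rewrite !ler_distlC => /andP[w1 w2] /andP[gl1 gl2].
  rewrite /box iM jM mulr1; move: (hker _ _) (W p q) (g (zz p q)) (g la) h0 w1 w2 gl1 gl2 gz0 gl0 glB => h w gz gl h0 w1 w2 gl1 gl2 gz0 gl0 glB.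
  apply: (@le_trans _ _ ((gl - om) * h)); last by rewrite ler_wpM2r// lerBlDr.
  have hw : `|w - h| <= e by rewrite ler_norml; apply/andP; split; lra.
  have glo : `|gl - om| <= B + om by rewrite ler_norml; apply/andP; split; lra.
  rewrite lerBlDr -lerBlDl -mulrBr (le_trans (ler_norm _))// normrM.
  exact: ler_pM.
move=> _; have -> : W p q = 0 by rewrite /W /wcell -/i -/j (negPf nmid).
by rewrite mulr0 sub0r (@le_trans _ _ 0) ?oppr_le0// mulr_ge0.
Qed.

(** The last three terms are the errors of the three zones: the middle one as in [grid_lower]; the
    near one, [(2 R1 + 1)^2] cells where the kernel is bounded through the distance [rho]; the far
    one, where its decay beyond [M / N] is charged to every cell of the grid. *)
Lemma grid_upper rho : 0 < rho ->
  (forall p q, (p < m.*2)%N -> (q < m.*2)%N -> rho <= normc (la - zz p q)) ->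
  gridsum <= (g la + om) * c + (B + om) * e * (M.*2.+1)%:R ^+ 2
    + B * ln (1 + s / rho ^+ 4) * (R1.*2.+1)%:R ^+ 2
    + B * (s / (M%:R / N%:R) ^+ 4) * (m.*2)%:R ^+ 2.
Proof.
move=> rho0 far.
have NR : 0 < N%:R :> R by rewrite ltr0n.
have MR : 0 < M%:R :> R by rewrite ltr0n (leq_trans R10).
have e0 : 0 <= e by rewrite divr_ge0.
have g0 := gB la; have B0 : 0 <= B by case/andP: g0 => /le_trans h /h.
have sM0 : 0 <= B * (s / (M%:R / N%:R) ^+ 4).
  by rewrite mulr_ge0// divr_ge0 ?exprn_ge0 ?divr_ge0// ltW.
have ln0 : 0 <= ln (1 + s / rho ^+ 4).
  by rewrite ln_ge0// lerDl divr_ge0 ?exprn_ge0// ltW.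
have -> : (m.*2)%:R ^+ 2 = \sum_(0 <= p < m.*2) \sum_(0 <= q < m.*2) 1 :> R.
  by rewrite !sumr_const_nat !subn0 expr2 mulr_natl.
have [r1 r2] := shift_range RM p1 p2.
have [r3 r4] := shift_range RM q1 q2.
rewrite -(sum2_box p1 p2 q1 q2) -(sum2_box r1 r2 r3 r4) /c /wmass.
rewrite -(@sum2_int_shift _ (wcell s N M R1) m M p0 q0)//; last exact: wcell_out.
rewrite !mulr_sumr -!big_split; apply: ler_sum_nat => p pm.
rewrite !mulr_sumr -!big_split; apply: ler_sum_nat => q qm /=.
have /andP[gz0 gzB] := gB (zz p q); case/andP: g0 => gl0 glB.
have h0 : 0 <= hker s (la - zz p q) by apply: hker_ge0; exact: ltW.
rewrite -/(W p q) mulr1.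
have := @wcell_close p q pm qm.
have [_] := cell_dist N0 la_cell (zz_cell pm qm).
set i := p%:Z - m%:Z - p0; set j := q%:Z - m%:Z - q0 => d2.
have box0 k : 0 <= box k i j by rewrite /box.
have err0 : 0 <= (B + om) * e * box M i j by rewrite !mulr_ge0// addr_ge0.
have near0 : 0 <= B * ln (1 + s / rho ^+ 4) * box R1 i j by rewrite !mulr_ge0.
have W0 : 0 <= (g la + om) * W p q by rewrite mulr_ge0 ?addr_ge0 ?wcell_ge0// ltW.
have [iM|iM] := boolP ((absz i <= M)%N && (absz j <= M)%N); last first.
  move=> _; apply: (@le_trans _ _ (B * (s / (M%:R / N%:R) ^+ 4))); last by rewrite lerDr !addr_ge0.
  apply: ler_pM => //; apply: hker_le_div; [exact: ltW|by rewrite divr_gt0|].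
  apply: le_trans d2; rewrite ler_pM2r ?invr_gt0// lerBrDr natr1 ler_nat leq_max.
  by move: iM; rewrite negb_and -!ltnNge.
case/andP: iM => iM jM.
have [ij|ij] := boolP ((R1 < absz i)%N || (R1 < absz j)%N); last first.
  move=> _; apply: (@le_trans _ _ (B * ln (1 + s / rho ^+ 4) * box R1 i j)); last first.
    by rewrite -[leRHS]addrA [leRHS]addrC -addrA lerDl (addr_ge0 sM0)// addr_ge0.
  move: ij; rewrite negb_or -!leqNgt => /andP[iR jR]; rewrite /box iR jR mulr1.
  by apply: ler_pM => //; apply: hker_le => //; [exact: ltW|exact: far].
move=> /(_ iM jM isT)[]; rewrite !ler_distlC => /andP[w1 w2] /andP[gl1 gl2].
apply: (@le_trans _ _ ((g la + om) * W p q + (B + om) * e * box M i j)); last first.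
  by rewrite -addrA lerDl addr_ge0.
rewrite /box iM jM mulr1; move: (hker _ _) (W p q) (g (zz p q)) (g la) h0 w1 w2 gl1 gl2 gz0 gl0 glB => h w gz gl h0 w1 w2 gl1 gl2 gz0 gl0 glB.
apply: (@le_trans _ _ ((gl + om) * h)); first by rewrite ler_wpM2r// addrC -lerBlDl; lra.
have hw : `|h - w| <= e by rewrite ler_norml; apply/andP; split; lra.
have glo : `|gl + om| <= B + om by rewrite ler_norml; apply/andP; split; lra.
rewrite -lerBlDl -mulrBr (le_trans (ler_norm _))// normrM.
exact: ler_pM.
Qed.

End GridEstimate.

Lemma compact_square (r : R) :
  compact ((fun p : R * R => p.1 +i* p.2 : C^o) @`
    (`[- r, r]%classic `*` `[- r, r]%classic)).
Proof.
apply: continuous_compact; last by apply: compact_setX; exact: segment_compact.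
apply: continuous_subspaceT; apply: continuous_complex => x; [exact: cvg_fst|exact: cvg_snd].
Qed.

(** Only [la] is confined to a compact set while [z] may leave it, so compactness of an enclosing
    square is used in its covering form, along radii tending to 0 from the right. *)
Lemma ball_unif_continuous (g : C^o -> R) (r om : R) : continuous g -> 0 < om ->
  exists2 de : R, 0 < de & forall la z, normc la <= r -> normc (la - z) <= de ->
    `|g z - g la| <= om.
Proof.
move=> /continuousC_epsP cg om0.
have om2 : 0 < om / 2 by rewrite divr_gt0.
have cov := (compact_near_coveringP _).1 (@compact_square r).
have [] := cov R (0^'+)%R (fun de la => forall z, normc (la - z) <= de -> `|g z - g la| <= om) _.
  move=> la _; have [de de0 hde] := cg la _ om2.
  have de2 : 0 < de / 2 by rewrite divr_gt0.
  near=> x d => z /= xz.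
  have lx : normc (la - x) < de / 2.
    by near: x; apply/nbhs_normcP; exists (de / 2).
  have dd : d < de / 2 by near: d; exact: nbhs_right_lt.
  have h1 : `|g la - g x| < om / 2 by apply: hde; lra.
  have h2 : `|g la - g z| < om / 2.
    apply: hde; apply: le_lt_trans (ler_normc_distD x _ _) _; lra.
  rewrite (_ : g z - g x = (g la - g x) - (g la - g z)); last by ring.
  by apply: le_trans (ler_normB _ _) _; rewrite [leRHS]splitr; apply: lerD; exact: ltW.
move=> d /= d0 hd; exists (d / 2); first by rewrite divr_gt0.
move=> la z lar laz; apply: (hd (d / 2)) laz.
- by rewrite /ball_ /= sub0r normrN gtr0_norm ?divr_gt0// ltr_pdivrMr// ltr_pMr// ltr1n.
- by rewrite /= divr_gt0.
- exists (complex.Re la, complex.Im la); last by case: (la).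
  split; rewrite /= in_itv /= -ler_norml; first exact: le_trans (Re_normc _) lar.
  exact: le_trans (Im_normc _) lar.
Unshelve. all: by end_near. Qed.

(** * Sizes of the grid parameters *)

Lemma ln1D_ge (x : R) : 0 <= x -> x / (1 + x) <= ln (1 + x).
Proof.
move=> x0; have x1 : 0 < 1 + x by rewrite ltr_wpDr.
have h := @le_ln1Dx R (- (x / (1 + x))).
have E : 1 + - (x / (1 + x)) = (1 + x)^-1 by field; rewrite gt_eqF.
rewrite E lnV ?posrE// in h.
have : x / (1 + x) < 1 by rewrite ltr_pdivrMr// mul1r ltrDr.
by move=> x_lt; rewrite -lerN2; apply: h; rewrite ltrN2.
Qed.

Lemma nat_large (x : R) : exists2 n : nat, (0 < n)%N & forall m, (n <= m)%N -> x <= m%:R.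
Proof.
exists (Num.bound x).+1 => // m nm; apply: le_trans (ler_norm x) _.
apply: le_trans (ltW (archi_boundP (normr_ge0 x))) _.
apply: (@le_trans _ _ (Num.bound x).+1%:R); last by rewrite ler_nat.
by rewrite /Num.bound /= normr_id ler_nat.
Qed.

(** [1 / 16] is the value of [s / (2 * L / N) ^+ 4] for [s = (t * A) ^- 4] and [N = t * A * L]. *)
Lemma ln1D16_ge : 17^-1 <= ln (1 + 1 / 16) :> R.
Proof.
have e16 : (1 + 1 / 16 : R) = 17 / 16 by lra.
have -> : 17^-1 = 1 / 16 / (1 + 1 / 16) :> R by rewrite e16 invf_div; lra.
by apply: ln1D_ge; rewrite divr_ge0.
Qed.

(** Here 68 is 4 times 17: [2 * R1 <= L] gives [(L - R1)^2 >= L^2 / 4], and 17 comes from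
    [ln1D16_ge]. *)
Lemma wmass_lower (t A L R1 : nat) : (0 < t)%N -> (0 < A)%N -> (0 < R1)%N ->
  (2 * R1 <= L)%N ->
  L%:R ^+ 2 / 68 <= wmass ((t * A)%:R ^+ 4)^-1 (t * A * L) (t * L) R1.
Proof.
move=> t0 A0 R10 LR.
have L0 : (0 < L)%N by lia.
have RL : (R1 <= L)%N by lia.
have L2 : (L <= 2 * (L - R1))%N by lia.
have N0 : (0 < t * A * L)%N by rewrite !muln_gt0 t0 A0.
have LM : (L <= t * L)%N by rewrite leq_pmull.
have s0 : 0 <= ((t * A)%:R ^+ 4)^-1 :> R by rewrite invr_ge0 exprn_ge0.
apply: le_trans (wmass_ge s0 N0 RL LM).
have -> : ((t * A)%:R ^+ 4)^-1 / (2 * L%:R / (t * A * L)%:R) ^+ 4 = 1 / 16 :> R.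
  by rewrite !natrM; field; rewrite !pnatr_eq0 -!lt0n t0 A0 L0.
have h2 : L%:R / 2 <= (L - R1)%:R :> R.
  by rewrite ler_pdivrMr// mulrC -natrM ler_nat.
have h4 : (L%:R / 2) ^+ 2 <= (L - R1)%:R ^+ 2 :> R.
  by rewrite lerXn2r// nnegrE// divr_ge0.
apply: (@le_trans _ _ ((L%:R / 2) ^+ 2 * 17^-1)); first by rewrite expr_div_n; lra.
by apply: ler_pM => //; exact: ln1D16_ge.
Qed.

(** The cutoff radius [t * L / (t * A * L)] is [1 / A]; one extra cell at most doubles it. *)
Lemma close_bound (t A L : nat) (de : R) : (0 < t)%N -> (0 < A)%N -> (0 < L)%N ->
  0 < de -> 4 / de <= A%:R -> 2 * (t * L).+1%:R / (t * A * L)%:R <= de.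
Proof.
move=> t0 A0 L0 de0 hA.
have tL1 : 1 <= (t * L)%:R :> R by rewrite ler1n muln_gt0 t0.
have -> : (t * A * L)%:R = A%:R * (t * L)%:R :> R by rewrite -natrM mulnA (mulnC A).
rewrite -[(t * L).+1%:R]natr1; set x := (t * L)%:R in tL1 *.
have x0 : 0 < x by exact: lt_le_trans tL1.
have aR : 0 < A%:R :> R by rewrite ltr0n.
rewrite ler_pdivrMr ?mulr_gt0//.
rewrite ler_pdivrMr// in hA.
rewrite mulrA (mulrC de); move: (A%:R * de) (x) hA tL1; clear => b y hA y1; nra.
Qed.

(** The margin of 2 below [K] leaves room for the window of [M] cells, of width at most 1, and for
    rounding. *)
Lemma floor_range (N M K : nat) (x : R) (p : int) : (0 < N)%N -> (M <= N)%N ->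
  p%:~R <= N%:R * x -> N%:R * x < (p + 1)%:~R -> `|x| <= K%:R - 2 ->
  - (N * K)%N%:Z <= p - M%:Z /\ p + M%:Z < (N * K)%N%:Z.
Proof.
move=> N0 MN h1 h2; rewrite ler_norml => /andP[x1 x2].
have NR : 0 < N%:R :> R by rewrite ltr0n.
have e1 : p <= (N * K)%N%:Z - (2 * N)%N%:Z.
  rewrite -(ler_int R) rmorphB /= -!pmulrn !natrM; apply: le_trans h1 _.
  by rewrite mulrC -(mulrC K%:R) -mulrBl ler_pM2r.
have e2 : - ((N * K)%N%:Z - (2 * N)%N%:Z) <= p + 1.
  rewrite -(ler_int R) rmorphN rmorphB /= -!pmulrn !natrM; apply: le_trans (ltW h2).
  by rewrite [leRHS]mulrC -(mulrC K%:R) -mulrBl -mulNr ler_pM2r.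
by move: (N * K)%N e1 e2 => m e1 e2; lia.
Qed.

(** 4896 is 8 times 9 times 68, where 9 comes from [2 t L + 1 <= 3 t L]. *)
Lemma mid_bound (B om c : R) (t L R1 : nat) : 0 <= B -> 0 < om ->
  (0 < t)%N -> (0 < L)%N -> (0 < R1)%N ->
  4896 * t%:R ^+ 2 * (B + om) / om <= R1%:R -> L%:R ^+ 2 / 68 <= c ->
  (B + om) * (8 / R1%:R) * (t * L).*2.+1%:R ^+ 2 <= om * c.
Proof.
move=> B0 om0 t0 L0 R10 h hc.
have tL1 : 1 <= (t * L)%:R :> R by rewrite ler1n muln_gt0 t0.
have h3 : (t * L).*2.+1%:R <= 3 * (t * L)%:R :> R.
  by rewrite -natr1 -addnn natrD; lra.
have h9 : (t * L).*2.+1%:R ^+ 2 <= 9 * (t%:R ^+ 2 * L%:R ^+ 2) :> R.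
  have -> : 9 * (t%:R ^+ 2 * L%:R ^+ 2) = (3 * (t * L)%:R) ^+ 2 :> R by rewrite natrM; ring.
  by rewrite lerXn2r// nnegrE.
have RR : 0 < R1%:R :> R by rewrite ltr0n.
apply: le_trans (ler_wpM2l _ h9) _; first by rewrite mulr_ge0 ?divr_ge0// addr_ge0// ltW.
apply: le_trans (ler_wpM2l (ltW om0) hc).
rewrite ler_pdivrMr// in h.
have -> : (B + om) * (8 / R1%:R) * (9 * (t%:R ^+ 2 * L%:R ^+ 2))
    = (4896 * t%:R ^+ 2 * (B + om)) * (L%:R ^+ 2 / 68) / R1%:R.
  by field; rewrite gt_eqF.
have L2 : 0 <= L%:R ^+ 2 / 68 :> R by rewrite divr_ge0 ?exprn_ge0.
rewrite ler_pdivrMr// [leRHS]mulrAC (mulrC om).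
exact: ler_wpM2r.
Qed.

(** At distance [L^-3] the kernel is at most [ln 2 + 12 ln L <= 13 L], against a mass of order
    [L^2]; 884 is 13 times 68. *)
Lemma near_bound (B om c : R) (t A L R1 : nat) : 0 <= B -> 0 < om ->
  (0 < t)%N -> (0 < A)%N -> (0 < L)%N ->
  884 * R1.*2.+1%:R ^+ 2 * B / om <= L%:R -> L%:R ^+ 2 / 68 <= c ->
  B * ln (1 + ((t * A)%:R ^+ 4)^-1 / (L%:R ^+ 3)^-1 ^+ 4) * R1.*2.+1%:R ^+ 2 <= om * c.
Proof.
move=> B0 om0 t0 A0 L0 h hc.
have LR1 : 1 <= L%:R :> R by rewrite ler1n.
have LR : 0 < L%:R :> R by rewrite ltr0n.
set s := (_ ^+ 4)^-1.
have s1 : s <= 1 by rewrite invf_le1 ?exprn_gt0 ?ltr0n ?muln_gt0 ?t0// exprn_ege1// ler1n muln_gt0 t0.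
have s0 : 0 <= s by rewrite invr_ge0 exprn_ge0.
have lnb : ln (1 + s / (L%:R ^+ 3)^-1 ^+ 4) <= 13 * L%:R.
  have L12 : 1 <= L%:R ^+ 12 :> R by rewrite exprn_ege1.
  have -> : s / (L%:R ^+ 3)^-1 ^+ 4 = s * L%:R ^+ 12.
    by rewrite exprVn invrK -exprM.
  have L12s : s * L%:R ^+ 12 <= L%:R ^+ 12 by rewrite ler_piMl// (le_trans _ L12).
  apply: (@le_trans _ _ (ln (2 * L%:R ^+ 12))).
    rewrite ler_ln ?posrE; first lra.
      by rewrite ltr_wpDr// mulr_ge0// (le_trans _ L12).
    by rewrite mulr_gt0// (lt_le_trans _ L12).
  rewrite lnM ?posrE ?exprn_gt0// lnXn//.
  have l2 : ln 2 <= 1 :> R by apply: (@le_ln1Dx R 1); lra.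
  have lL := ltW (ln_sublinear LR).
  rewrite -(mulr_natl (ln L%:R) 12); lra.
apply: le_trans (ler_wpM2l (ltW om0) hc).
rewrite ler_pdivrMr// in h.
apply: (@le_trans _ _ (B * (13 * L%:R) * R1.*2.+1%:R ^+ 2)).
  by rewrite ler_wpM2r ?exprn_ge0// ler_wpM2l.
have -> : B * (13 * L%:R) * R1.*2.+1%:R ^+ 2 = (884 * R1.*2.+1%:R ^+ 2 * B) * (L%:R / 68) by field.
have -> : om * (L%:R ^+ 2 / 68) = (L%:R * om) * (L%:R / 68) by ring.
by rewrite ler_wpM2r// divr_ge0.
Qed.

(** The left side is [4 B K^2 A^2 L^2 / t^2]. The negative power of [t] is the gain from the fourth
    power in the kernel; 272 is 4 times 68. *)
Lemma far_bound (B om c : R) (t A L K : nat) : 0 <= B -> 0 < om ->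
  (0 < t)%N -> (0 < A)%N -> (0 < L)%N ->
  272 * K%:R ^+ 2 * B * A%:R ^+ 2 / om <= t%:R -> L%:R ^+ 2 / 68 <= c ->
  B * (((t * A)%:R ^+ 4)^-1 / ((t * L)%:R / (t * A * L)%:R) ^+ 4)
    * (t * A * L * K).*2%:R ^+ 2 <= om * c.
Proof.
move=> B0 om0 t0 A0 L0 h hc.
have t1 : 1 <= t%:R :> R by rewrite ler1n.
have tR : 0 < t%:R :> R by rewrite ltr0n.
rewrite ler_pdivrMr// in h.
have -> : B * (((t * A)%:R ^+ 4)^-1 / ((t * L)%:R / (t * A * L)%:R) ^+ 4)
    * (t * A * L * K).*2%:R ^+ 2
    = (272 * K%:R ^+ 2 * B * A%:R ^+ 2) * (L%:R ^+ 2 / 68) / t%:R ^+ 2.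
  by rewrite -mul2n !natrM; field; rewrite !pnatr_eq0 -!lt0n t0 A0 L0.
apply: le_trans (ler_wpM2l (ltW om0) hc).
rewrite ler_pdivrMr ?exprn_gt0// [leRHS]mulrAC.
apply: ler_wpM2r; first by rewrite divr_ge0 ?exprn_ge0.
apply: le_trans h _; rewrite [leRHS]mulrC; apply: ler_wpM2r; first exact: ltW.
by rewrite expr2 ler_peMr// ltW.
Qed.

(* Only the upper estimate needs [la] to stay away from the points [zz]: hker has
   a logarithmic pole, and the lower estimate discards the nearby cells. *)
Theorem kernel_approx (g : C^o -> R) (B eps : R) (K : nat) :
  (forall z, 0 <= g z <= B) -> continuous g -> 0 < eps -> (2 <= K)%N ->
  exists (s : R) (D L0 : nat), [/\ 0 < s, (0 < D)%N, (0 < L0)%N &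
  forall L, (L0 <= L)%N -> exists2 c : R, 0 < c &
  forall zz : nat -> nat -> C,
  (forall p q, (p < (D * L * K).*2)%N -> (q < (D * L * K).*2)%N ->
     in_cell (D * L) (zz p q) (p%:Z - (D * L * K)%N%:Z) (q%:Z - (D * L * K)%N%:Z)) ->
  forall la, normc la <= K%:R - 2 ->
  let S := \sum_(0 <= p < (D * L * K).*2) \sum_(0 <= q < (D * L * K).*2)
              g (zz p q) * hker s (la - zz p q) in
  (g la - eps) * c <= S /\
  ((forall p q, (p < (D * L * K).*2)%N -> (q < (D * L * K).*2)%N ->
     (L%:R ^+ 3)^-1 <= normc (la - zz p q)) -> S <= (g la + eps) * c)].
Proof.
move=> gB cg eps0 K2.
have B0 : 0 <= B by have /andP[/le_trans h /h] := gB 0.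
(* One quarter each for the oscillation of [g] and the middle, near and far errors. *)
set om := eps / 4; have om0 : 0 < om by rewrite divr_gt0.
have [de de0 hde] := ball_unif_continuous (K%:R - 2) cg om0.
(* The order of choice matters: [A] fixes the cutoff radius, [t] then kills the far error, [R1] the
   middle error given [t], and [L0] the near error given [R1]. *)
have [A A0 hA] := nat_large (4 / de).
have {}hA := hA _ (leqnn _).
have [t t0 ht] := nat_large (272 * K%:R ^+ 2 * B * A%:R ^+ 2 / om).
have {}ht := ht _ (leqnn _).
have [R1 R10 hR1] := nat_large (4896 * t%:R ^+ 2 * (B + om) / om).
have {}hR1 := hR1 _ (leqnn _).
have [L0 L00 hL0] := nat_large (884 * (R1.*2.+1)%:R ^+ 2 * B / om).
(* The kernel has width [1 / (t * A)], that is [L] cells of mesh [1 / (t * A * L)], and the cutoff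
   lies at [t * L] cells. *)
exists ((t * A)%:R ^+ 4)^-1, (t * A)%N, (maxn L0 (2 * R1)); split.
- by rewrite invr_gt0 exprn_gt0// ltr0n muln_gt0 t0.
- by rewrite muln_gt0 t0.
- by rewrite leq_max muln_gt0 R10 orbT.
move=> L; rewrite geq_max => /andP[/hL0 {}hL0 LR].
set N := (t * A * L)%N; set m := (N * K)%N; set s := _^-1.
have L_gt0 : (0 < L)%N by apply: leq_trans LR; rewrite muln_gt0.
have N0 : (0 < N)%N by rewrite !muln_gt0 t0 A0.
have RL : (R1 <= L)%N by apply: leq_trans LR; rewrite leq_pmull.
have LM : (L <= t * L)%N by rewrite leq_pmull.
have s0 : 0 < s by rewrite invr_gt0 exprn_gt0// ltr0n muln_gt0 t0.
have LR0 : 0 < L%:R :> R by rewrite ltr0n.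
have c_ge := wmass_lower t0 A0 R10 LR; rewrite -/N -/s in c_ge.
set c := wmass s N (t * L) R1 in c_ge.
have c0 : 0 < c by apply: lt_le_trans c_ge; rewrite divr_gt0// exprn_gt0.
exists c => // zz zz_cell la la_le.
have [p0 [p01 p02]] := Num_floor_cell (N%:R * complex.Re la).
have [q0 [q01 q02]] := Num_floor_cell (N%:R * complex.Im la).
have la_cell : in_cell N la p0 q0 by split => //; exact: ltW.
have RM := leq_trans RL LM.
have g_close z : normc (la - z) <= 2 * (t * L).+1%:R / N%:R -> `|g z - g la| <= om.
  by move=> lz; apply: hde => //; exact: le_trans lz (close_bound t0 A0 L_gt0 de0 hA).
have tLN : (t * L <= N)%N by rewrite /N mulnAC leq_pmulr.
have [r1 r2] := floor_range N0 tLN p01 p02 (le_trans (Re_normc _) la_le).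
have [r3 r4] := floor_range N0 tLN q01 q02 (le_trans (Im_normc _) la_le).
have gB' := gB : forall z : C, 0 <= g z <= B.
have low := grid_lower gB' s0 (ltW om0) N0 R10 la_cell r1 r2 r3 r4 zz_cell g_close.
have up := grid_upper gB' s0 (ltW om0) N0 R10 RM la_cell r1 r2 r3 r4 zz_cell g_close.
have mid := mid_bound B0 om0 t0 L_gt0 R10 hR1 c_ge.
have eE : eps = 4 * om by rewrite /om mulrC divfK.
split.
  by apply: le_trans low; rewrite -/c eE; move: mid (mulr_gt0 om0 c0); clear; nra.
move=> hfar; have rho0 : 0 < (L%:R ^+ 3)^-1 :> R by rewrite invr_gt0 exprn_gt0.
apply: le_trans (up _ rho0 hfar) _; rewrite -/c eE.
have near := near_bound B0 om0 t0 A0 L_gt0 hL0 c_ge.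
have far := far_bound B0 om0 t0 A0 L_gt0 ht c_ge.
rewrite -/N -/s -/m in near far; move: mid near far (mulr_gt0 om0 c0).
rewrite -/N -/s -/m; clear; move: (_ * _ ^+ 2) (_ * _ ^+ 2) (_ * _ ^+ 2) => u1 u2 u3.
by nra.
Qed.

End Kernel.

(** * Grid points off the curve *)

Section GoodPoints.
Variable R : realType.
Local Notation C := R[i].
Local Notation leb2 := (lebesgue_measure \x lebesgue_measure)%E.

Lemma measure_rectangle (x y u v : R) : x <= y -> u <= v ->
  leb2 (`[x, y] `*` `[u, v]) = ((y - x) * (v - u))%:E.
Proof.
have itv (a b : R) : a <= b -> lebesgue_measure (`[a, b] : set R) = (b - a)%:E.
  rewrite lebesgue_measure_itv /= lte_fin.
  by case: ltgtP => // -> _; rewrite subrr.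
move=> xy uv; rewrite product_measure1E// EFinM.
by congr (_ * _)%E; exact: itv.
Qed.

(** Discs of radius [h] lie in squares of area [(2 * h) ^+ 2]; [M] such squares and a null set
    cannot cover a rectangle of larger area. [F 0] is the null set. *)
Lemma rectangle_avoid (x y u v h : R) (M : nat) (c : nat -> C)
    (G : R * R -> Prop) : x <= y -> u <= v -> 0 <= h ->
  {ae leb2, forall xy, G xy} -> M%:R * (2 * h) ^+ 2 < (y - x) * (v - u) ->
  exists z : C, [/\ x <= complex.Re z <= y, u <= complex.Im z <= v,
    G (complex.Re z, complex.Im z) &
    forall i, (i < M)%N -> h < normc (c i - z)].
Proof.
move=> xy uv h0 [N [mN N0 GN]] area; apply: contrapT => hno.
pose F i := if i is j.+1 then
    `[complex.Re (c j) - h, complex.Re (c j) + h] `*`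
    `[complex.Im (c j) - h, complex.Im (c j) + h] else N.
have mF k : measurable (F k) by case: k => [|k] //=; exact: measurableX.
have sub : (`[x, y] `*` `[u, v] `<=` \big[setU/set0]_(i < M.+1) F i)%classic.
  move=> [p q] [/= hp hq]; apply: contrapT => nF; apply: hno.
  rewrite !in_itv /= in hp hq; exists (p +i* q); split => //=.
    apply: contrapT => nG; apply: nF; rewrite big_ord_recl; left.
    exact: GN.
  move=> i iM; rewrite ltNge; apply/negP => hi; apply: nF.
  rewrite (bigD1 (Ordinal (iM : (i.+1 < M.+1)%N)))//=; left.
  have := le_trans (Re_normc _) hi; have := le_trans (Im_normc _) hi.
  rewrite !raddfB /= !in_itv /= !ler_norml => /andP[a1 a2] /andP[b1 b2].
  by split => /=; lra.
have : (leb2 (`[x, y] `*` `[u, v]) <= \sum_(i < M.+1) leb2 (F i))%E.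
  apply: content_subadditive => //; exact: measurableX.
rewrite measure_rectangle//.
rewrite big_ord_recl N0 add0e (eq_bigr (fun=> ((2 * h) ^+ 2)%:E)); last first.
  by move=> i _; rewrite /= measure_rectangle; [congr EFin; ring|lra|lra].
by rewrite sumEFin lee_fin sumr_const card_ord -[leRHS]mulr_natl leNgt area.
Qed.

(** Sample the curve at [L^3 + 1] parameters. Discs of radius [A / L^3] around the samples have
    total area of order [L^-3], less than the cell area [(D L)^-2] for large [L]. The Lipschitz loss
    between samples is at most [2 pi La / L^3], so [A = 2 + 2 pi La] leaves [2 / L^3]. *)
Lemma good_points (f : R -> C) (La : R) (G : R * R -> Prop) (D : nat) :
  0 <= La -> (forall s t, normc (f s - f t) <= La * `|s - t|) ->
  {ae leb2, forall xy, G xy} -> (0 < D)%N ->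
  exists L0, forall L, (L0 <= L)%N -> forall p q : int, exists z : C,
    [/\ in_cell (D * L) z p q, G (complex.Re z, complex.Im z) &
    forall t, 0 <= t <= 2 * pi -> 2 * (L%:R ^+ 3)^-1 <= normc (f t - z)].
Proof.
move=> La0 fL aeG D0.
pose A := 2 + 2 * pi * La; have pi0 : 0 < pi :> R := pi_gt0 _.
have A0 : 0 < A by rewrite ltr_wpDr// !mulr_ge0// ltW.
(* The area condition reads [8 A^2 D^2 < L], where [L^3 + 1 <= 2 L^3] was used; the added 1 makes it
   strict. *)
have [L0 L00 hL0] := nat_large (8 * A ^+ 2 * D%:R ^+ 2 + 1).
exists L0 => L /[dup] LL0 /hL0 {}hL0 p q.
have L_gt0 : (0 < L)%N by apply: leq_trans LL0.
have LR : 1 <= L%:R :> R by rewrite ler1n.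
have L3 : 0 < L%:R ^+ 3 :> R by rewrite exprn_gt0// ltr0n.
have DL : 0 < (D * L)%:R :> R by rewrite ltr0n muln_gt0 D0.
have DL0 : (D * L)%:R != 0 :> R by rewrite gt_eqF.
pose c i := f (i%:R * (2 * pi) / L%:R ^+ 3).
have [||||z [hp hq Gz hz]] := @rectangle_avoid (p%:~R / (D * L)%:R)
  ((p + 1)%:~R / (D * L)%:R) (q%:~R / (D * L)%:R)
  ((q + 1)%:~R / (D * L)%:R) (A / L%:R ^+ 3) (L ^ 3).+1 c G _ _ _ aeG.
- by rewrite ler_pM2r ?invr_gt0// ler_int lerDl.
- by rewrite ler_pM2r ?invr_gt0// ler_int lerDl.
- by rewrite divr_ge0// ltW.
- have -> : ((p + 1)%:~R / (D * L)%:R - p%:~R / (D * L)%:R)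
     * ((q + 1)%:~R / (D * L)%:R - q%:~R / (D * L)%:R) = ((D * L)%:R ^+ 2)^-1 :> R.
    rewrite -!mulrBl !rmorphD /= !(addrC _ 1) !addrK.
    by rewrite mulf_div mulr1 -expr2 mul1r.
  have h8 : (L ^ 3).+1%:R <= 2 * L%:R ^+ 3 :> R.
    by rewrite -natr1 natrX mulr_natl mulr2n lerD2l exprn_ege1.
  apply: (@le_lt_trans _ _ (2 * L%:R ^+ 3 * (2 * (A / L%:R ^+ 3)) ^+ 2)).
    by apply: ler_wpM2r => //; exact: sqr_ge0.
  rewrite -[ltRHS]mul1r ltr_pdivlMr ?exprn_gt0//.
  have -> : 2 * L%:R ^+ 3 * (2 * (A / L%:R ^+ 3)) ^+ 2 * (D * L)%:R ^+ 2
     = 8 * A ^+ 2 * D%:R ^+ 2 / L%:R.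
    by rewrite natrM; field; rewrite pnatr_eq0 -lt0n.
  rewrite ltr_pdivrMr ?ltr0n// mul1r; apply: lt_le_trans hL0.
  by rewrite ltrDl.
exists z; split => //.
  move: hp hq => /andP[p1 p2] /andP[q1 q2].
  rewrite !(ler_pdivrMr, ler_pdivlMr)// in p1 p2 q1 q2.
  by split; rewrite mulrC.
move=> t /andP[t0 t2].
pose i := Num.trunc (t * L%:R ^+ 3 / (2 * pi)).
have pi2 : 0 < 2 * pi :> R by rewrite mulr_gt0.
have x0 : 0 <= t * L%:R ^+ 3 / (2 * pi) by rewrite divr_ge0 ?mulr_ge0// ltW.
have /andP[i1 i2] : i%:R <= t * L%:R ^+ 3 / (2 * pi) < i.+1%:R.
  exact: truncn_itv.
have iM : (i < (L ^ 3).+1)%N.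
  rewrite ltnS -(ler_nat R) natrX; apply: le_trans i1 _.
  by rewrite ler_pdivrMr// mulrC ler_pM2l.
have := hz i iM.
have fe : normc (c i - f t) <= (2 * pi * La) / L%:R ^+ 3.
  apply: le_trans (fL _ _) _.
  rewrite distrC ger0_norm; last first.
    by rewrite subr_ge0 ler_pdivrMr//; rewrite ler_pdivlMr// in i1.
  have -> : 2 * pi * La / L%:R ^+ 3 = La * (2 * pi / L%:R ^+ 3) by ring.
  apply: ler_wpM2l => //.
  rewrite -(natr1 i) ltr_pdivrMr// in i2; rewrite lerBlDr -mulrDl ler_pdivlMr//.
  by rewrite ltW//; apply: lt_le_trans i2 _; rewrite mulrDl mul1r addrC.
have := ler_normc_distD (f t) (c i) z; rewrite /A mulrDl => h1 h2.
by lra.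
Qed.

End GoodPoints.

(** * The one-sided eigenvalue comparison *)

Section UpperBound.
Variable R : realType.
Local Notation C := R[i].
Local Notation leb2 := (lebesgue_measure \x lebesgue_measure)%E.

Lemma near_nat_ge (x : R) : \forall n \near \oo, x <= n%:R.
Proof. by have [N _ h] := nat_large x; exists N. Qed.

Lemma near_ln_ge (x : R) : \forall n \near \oo, x <= ln n%:R.
Proof.
apply: filterS (near_nat_ge (expR x)) => n h.
rewrite -(expRK x) ler_ln ?posrE ?expR_gt0//.
by apply: lt_le_trans h; exact: expR_gt0.
Qed.

Lemma near_powRN_le (C0 gamma e : R) : 0 <= C0 -> 0 < gamma -> 0 < e ->
  \forall n \near \oo, C0 * n%:R `^ (- gamma) <= e.
Proof.
move=> C00 g0 e0; apply: filterS (near_nat_ge (1 + (C0 / e) `^ gamma^-1)) => n h.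
have n0 : 0 < n%:R :> R.
  by apply: lt_le_trans h; rewrite ltr_pwDl// powR_ge0.
rewrite powRN ler_pdivrMr ?powR_gt0//.
have -> : C0 = e * ((C0 / e) `^ gamma^-1) `^ gamma.
  rewrite -powRrM mulVf ?gt_eqF// powRr1; last by rewrite divr_ge0// ltW.
  by rewrite mulrC divfK ?gt_eqF.
rewrite ler_pM2l//; apply: ge0_ler_powR; rewrite ?nnegrE ?powR_ge0 ?ltW//.
by apply: lt_le_trans h; rewrite ltrDr.
Qed.

Lemma near_allP (I : eqType) (s : seq I) (Q : nat -> I -> Prop) :
  {in s, forall i, \forall n \near \oo, Q n i} ->
  \forall n \near \oo, {in s, forall i, Q n i}.
Proof.
elim: s => [|i s IH] h; first by near=> n.
have hs : {in s, forall i, \forall n \near \oo, Q n i}.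
  by move=> j js; apply: h; rewrite inE js orbT.
apply: filterS2 (h i (mem_head _ _)) (IH hs) => n h1 h2 j.
by rewrite inE => /predU1P[->//|]; exact: h2.
Unshelve. all: by end_near.
Qed.

(** A polynomially small singular value costs [ln (1 + Kb) + kappa * ln n]. Once [ln n] exceeds the
    constants, the bracket is at most [(1 + 4 * kappa) * ln n], and [k_ n * ln n] is [o(n)]. *)
Lemma near_rank_term (k_ : nat -> nat) (A Kb kappa e : R) :
  (fun n => (k_ n)%:R : R) =o_\oo (fun n => n%:R / ln n%:R) ->
  0 <= A -> 0 <= Kb -> 0 < kappa -> 0 < e ->
  \forall n \near \oo,
    (2 * k_ n)%:R * (A + 4 * ln (1 + Kb / n%:R `^ (- kappa))) <= n%:R * e.
Proof.
move=> /eqoP ksmall A0 Kb0 kp0 e0.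
pose q := 2 * (1 + 4 * kappa); have q0 : 0 < q.
  by rewrite mulr_gt0// addr_gt0// mulr_gt0.
near=> n.
have n1 : 1 <= n%:R :> R by near: n; exact: near_nat_ge.
have n0 : 0 < n%:R :> R by exact: lt_le_trans n1.
have l1 : 1 <= ln n%:R :> R by near: n; exact: near_ln_ge.
have lA : A + 4 * ln (1 + Kb) <= ln n%:R by near: n; exact: near_ln_ge.
have hk : (k_ n)%:R <= e / q * (n%:R / ln n%:R).
  have : `|(k_ n)%:R : R| <= e / q * `|n%:R / ln n%:R|.
    by near: n; apply: ksmall; rewrite divr_gt0.
  by rewrite !ger0_norm// divr_ge0//; exact: le_trans l1.
have l0 : 0 < ln n%:R :> R by exact: lt_le_trans l1.
rewrite mulrA ler_pdivlMr// in hk.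
have lnle : ln (1 + Kb / n%:R `^ (- kappa)) <= ln (1 + Kb) + kappa * ln n%:R.
  have K1 : 0 < 1 + Kb by rewrite ltr_pwDl.
  rewrite -ln_powR -lnM ?posrE ?powR_gt0// ler_ln ?posrE; last 2 first.
  - by rewrite ltr_pwDl// divr_ge0// powR_ge0.
  - by rewrite mulr_gt0// powR_gt0.
  rewrite powRN invrK mulrDl mul1r lerD2r.
  by rewrite -[leLHS](powRr0 n%:R) ler_powR// ltW.
rewrite natrM; set x := (k_ n)%:R in hk *; have x0 : 0 <= x by exact: ler0n.
apply: (@le_trans _ _ (2 * x * ((1 + 4 * kappa) * ln n%:R))).
  by apply: ler_wpM2l; [exact: mulr_ge0 | lra].
have -> : 2 * x * ((1 + 4 * kappa) * ln n%:R) = q * (x * ln n%:R) by rewrite /q; ring.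
apply: le_trans (ler_wpM2l (ltW q0) hk) _.
by rewrite mulrA (mulrC q) divfK ?gt_eqF// mulrC.
Unshelve. all: by end_near.
Qed.

Lemma asum_ge0 (c : int -> C) N : 0 <= asum N c.
Proof. by apply: sumr_ge0 => m _; exact: normc_ge0. Qed.

Lemma normc_dist_approx (x y : C) (r : R) :
  (forall e : R, 0 < e -> exists u v : C,
     [/\ normc (u - x) <= e, normc (v - y) <= e & normc (u - v) <= r]) ->
  normc (x - y) <= r.
Proof.
move=> h; apply/ler_addgt0Pr => e e0.
have [u [v [h1 h2 h3]]] := h (e / 2) (divr_gt0 e0 (ltr0n R 2)).
have := ler_normc_distD u x y; have := ler_normc_distD v u y.
by rewrite (normcB x u); lra.
Qed.

Lemma laurent_sum_lipschitz (a : int -> C) (k_ : nat -> nat) (k : \bar R) K1 u v :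
  (forall N, asum N (fun j => j%:~R * a j) <= K1) ->
  (forall e : R, 0 < e -> exists n0, forall n t, (n0 <= n)%N ->
    normc (lsum (k_ n) a (expi t) - laurent_sum a k (expi t)) <= e) ->
  normc u = 1 -> normc v = 1 ->
  normc (laurent_sum a k u - laurent_sum a k v) <= K1 * normc (u - v).
Proof.
move=> hK1 hunif /expi_surj[s ->] /expi_surj[t ->]; apply: normc_dist_approx => e e0.
have [n0 h] := hunif e e0; exists (lsum (k_ n0) a (expi s)), (lsum (k_ n0) a (expi t)).
split; [exact: h | exact: h |].
apply: le_trans (lsum_lipschitz _ _ (normc_expi _) (normc_expi _)) _.
by apply: ler_wpM2r => //; exact: normc_ge0.
Qed.

Lemma small_noise (Kb s c e : R) : 0 <= Kb -> 0 < s -> 0 < c -> 0 < e ->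
  exists de : R, [/\ 0 < de, de <= 1, de <= c / 2 &
    8 * (2 * Kb + 1) ^+ 3 * de / s + 8 * de / c <= e].
Proof.
move=> Kb0 s0 c0 e0; set A := 8 * (2 * Kb + 1) ^+ 3 / s + 8 / c.
have A0 : 0 < A.
  by rewrite ltr_wpDl ?divr_gt0// ?divr_ge0 ?mulr_ge0 ?exprn_ge0 ?addr_ge0 ?mulr_ge0// ltW.
exists (Num.min 1 (Num.min (c / 2) (e / A))); split.
- by rewrite !lt_min ltr01 !divr_gt0.
- by rewrite ge_min lexx.
- by rewrite !ge_min lexx orbT.
set de := Num.min _ _; have : de <= e / A by rewrite !ge_min lexx !orbT.
rewrite ler_pdivlMr// => h; apply: le_trans h; rewrite le_eqVlt; apply/orP; left; apply/eqP.
by rewrite /A; ring.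
Qed.

Lemma root_angle_dom n (i : 'I_n) : 0 <= i%:R * root_angle R n <= 2 * pi.
Proof.
have pi2 : 0 <= 2 * pi :> R by rewrite mulr_ge0// pi_ge0.
have n0 : (0 < n)%N by apply: leq_ltn_trans (ltn_ord i).
rewrite mulr_ge0 ?divr_ge0//= /root_angle mulrA ler_pdivrMr ?ltr0n// mulrC.
by rewrite ler_wpM2l// ler_nat ltnW.
Qed.

Lemma cell_norm_le (N K p q : nat) (z : C) : (0 < N)%N ->
  (p < (N * K).*2)%N -> (q < (N * K).*2)%N ->
  in_cell N z (p%:Z - (N * K)%N%:Z) (q%:Z - (N * K)%N%:Z) ->
  normc z <= 2 * K%:R.
Proof.
move=> N0 hp hq [h1 h2 h3 h4]; have NR : 0 < N%:R :> R by rewrite ltr0n.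
have b (j : nat) (y : R) : (j < (N * K).*2)%N ->
    (j%:Z - (N * K)%N%:Z)%:~R <= N%:R * y -> N%:R * y <= (j%:Z - (N * K)%N%:Z + 1)%:~R ->
    `|y| <= K%:R.
  move=> hj a1 a2; rewrite -(ler_pM2l NR) -{1}(gtr0_norm NR) -normrM ler_norml -natrM.
  apply/andP; split.
    by apply: le_trans a1; rewrite rmorphB /= lerBrDr addNr ler0n.
  apply: le_trans a2 _; rewrite -[leRHS]/((N * K)%N%:Z%:~R) ler_int; lia.
apply: le_trans (normc_ReIm _) _; rewrite mulr_natl mulr2n.
by apply: lerD; [exact: (b p) | exact: (b q)].
Qed.

(** Average the kernel inequalities with the weights [g (zz p q)], which must be nonnegative, and
    divide by [c]. The choice of [e1] keeps the accumulated error over the [m^2] grid points below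
    [n * (eps / 3) * c]; the 1 in its denominator covers [B = 0]. *)
Lemma kernel_sum_le n m (zz : nat -> nat -> C) (ls : seq C) (x : 'I_n -> C)
    (g : C -> R) (s c B eps e1 : R) : size ls = n -> 0 < c -> 0 < eps ->
  (forall z, 0 <= g z <= B) -> e1 = eps / 3 * c / (B * m%:R ^+ 2 + 1) ->
  {in ls, forall l, (g l - eps / 3) * c <=
     \sum_(0 <= p < m) \sum_(0 <= q < m) g (zz p q) * hker s (l - zz p q)} ->
  (forall i, \sum_(0 <= p < m) \sum_(0 <= q < m) g (zz p q) * hker s (x i - zz p q)
     <= (g (x i) + eps / 3) * c) ->
  (forall p q, (p < m)%N -> (q < m)%N ->
     \sum_(l <- ls) hker s (l - zz p q) <= \sum_i hker s (x i - zz p q) + n%:R * e1) ->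
  \sum_(l <- ls) g l <= \sum_i g (x i) + n%:R * eps.
Proof.
move=> sz c0 eps0 gB e1E h1 h2 h3.
have B0 : 0 <= B by have /andP[/le_trans h /h] := gB 0.
have swap (I : Type) (r : seq I) (F : I -> C) :
    \sum_(i <- r) \sum_(0 <= p < m) \sum_(0 <= q < m) g (zz p q) * hker s (F i - zz p q)
    = \sum_(0 <= p < m) \sum_(0 <= q < m) g (zz p q) * \sum_(i <- r) hker s (F i - zz p q).
  rewrite exchange_big /=; apply: eq_bigr => p _.
  by rewrite exchange_big /=; apply: eq_bigr => q _; rewrite mulr_sumr.
have l1 : (\sum_(l <- ls) g l - n%:R * (eps / 3)) * c <=
    \sum_(0 <= p < m) \sum_(0 <= q < m) g (zz p q) * \sum_(l <- ls) hker s (l - zz p q).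
  rewrite -swap.
  have -> : (\sum_(l <- ls) g l - n%:R * (eps / 3)) * c = \sum_(l <- ls) (g l - eps / 3) * c.
    rewrite -mulr_suml big_split /= sumrN big_const_seq count_predT sz iter_addr_0.
    by rewrite mulr_natl.
  by rewrite big_seq [leRHS]big_seq; apply: ler_sum.
have l2 : \sum_(0 <= p < m) \sum_(0 <= q < m) g (zz p q) * \sum_i hker s (x i - zz p q)
    <= (\sum_i g (x i) + n%:R * (eps / 3)) * c.
  rewrite -swap.
  have -> : (\sum_i g (x i) + n%:R * (eps / 3)) * c = \sum_i (g (x i) + eps / 3) * c.
    by rewrite -mulr_suml big_split /= sumr_const card_ord mulr_natl.
  by apply: ler_sum => i _.
have e10 : 0 <= e1.
  by rewrite e1E divr_ge0 ?mulr_ge0 ?divr_ge0 ?addr_ge0 ?mulr_ge0 ?exprn_ge0// ltW.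
have l3 : \sum_(0 <= p < m) \sum_(0 <= q < m) g (zz p q) * \sum_(l <- ls) hker s (l - zz p q)
    <= \sum_(0 <= p < m) \sum_(0 <= q < m) g (zz p q) * \sum_i hker s (x i - zz p q)
       + m%:R * (m%:R * (B * (n%:R * e1))).
  have -> : m%:R * (m%:R * (B * (n%:R * e1)))
      = \sum_(0 <= p < m) \sum_(0 <= q < m) B * (n%:R * e1).
    by rewrite !sumr_const_nat subn0 !mulr_natl.
  rewrite -big_split /= big_nat [leRHS]big_nat; apply: ler_sum => p /andP[_ pm].
  rewrite -big_split /= big_nat [leRHS]big_nat; apply: ler_sum => q /andP[_ qm].
  have /andP[g0 gB'] := gB (zz p q).
  apply: le_trans (ler_wpM2l g0 (h3 p q pm qm)) _; rewrite mulrDr lerD2l.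
  by apply: ler_wpM2r => //; rewrite mulr_ge0.
have l4 : m%:R * (m%:R * (B * (n%:R * e1))) <= n%:R * (eps / 3) * c.
  have -> : m%:R * (m%:R * (B * (n%:R * e1))) = n%:R * (B * m%:R ^+ 2 * e1) by ring.
  rewrite -[leRHS]mulrA; apply: ler_wpM2l => //.
  have d0 : 0 < B * m%:R ^+ 2 + 1 by rewrite ltr_wpDl// mulr_ge0// exprn_ge0.
  rewrite e1E mulrA ler_pdivrMr// mulrC; apply: ler_wpM2l; last by rewrite lerDl.
  by rewrite mulr_ge0 ?divr_ge0// ltW.
rewrite -(ler_pM2r c0).
have := le_trans l1 (le_trans l3 (lerD l2 l4)).
set u := \sum_(l <- ls) g l; set v := \sum_i g (x i).
have -> : (v + n%:R * eps) * c = (v + n%:R * (eps / 3)) * c + n%:R * (eps / 3) * c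
  + n%:R * (eps / 3) * c by field.
by rewrite mulrBl; lra.
Qed.

Lemma perturbed_noise n (alpha gamma C0 : R) (E : 'M[C]_n) : (0 < n)%N -> 0 <= C0 ->
  spectral_norm E <= C0 * n%:R `^ alpha ->
  opbound (C0 * n%:R `^ (- gamma)) (((n%:R : R) `^ (- alpha - gamma))%:C *: E).
Proof.
move=> n0 C00 hE; have nR : 0 < n%:R :> R by rewrite ltr0n.
have -> : C0 * n%:R `^ (- gamma)
    = normc (n%:R `^ (- alpha - gamma))%:C * (C0 * n%:R `^ alpha).
  rewrite normcC ger0_norm ?powR_ge0// mulrCA; congr (_ * _).
  by rewrite -powRD ?pnatr_eq0 -?lt0n ?n0 ?implybT//; congr (_ `^ _); ring.
by apply/opboundZ/spectral_norm_opbound => //; rewrite mulr_ge0// powR_ge0.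
Qed.

(* [I] has one point per grid cell; applied to [B - g] as well, this one-sided
   comparison becomes two-sided. *)
Theorem sum_eigenvalues_le (a : int -> C) (k_ : nat -> nat) (k : \bar R)
    (gamma alpha C0 : R) (g : C^o -> R) (B eps : R) (G : R * R -> Prop) :
  (\esum_(j in [set: int]) (normc (j%:~R * a j))%:E < +oo)%E ->
  (k_ n)%:R%:E @[n --> \oo] --> k ->
  (fun n => (k_ n)%:R : R) =o_\oo (fun n => n%:R / ln n%:R) ->
  0 < gamma -> 0 <= C0 -> (forall z, 0 <= g z <= B) -> continuous g ->
  0 < eps -> {ae leb2, forall xy, G xy} ->
  exists I : seq C, {in I, forall z, G (complex.Re z, complex.Im z)} /\
  forall kappa : C -> R, {in I, forall z, 0 < kappa z} ->
  \forall n \near \oo, forall E : 'M[C]_n,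
    spectral_norm E <= C0 * n%:R `^ alpha ->
    {in I, forall z, n%:R `^ (- kappa z) <=
       sigma_min (perturbed alpha gamma (toeplitz a (k_ n) n) E - z%:M)} ->
    \sum_(l <- eigenvalues (perturbed alpha gamma (toeplitz a (k_ n) n) E)) g l
    <= \sum_(i < n) g (lsum (k_ n) a (expi (i%:R * root_angle R n))) + n%:R * eps.
Proof.
move=> a_sum k_cvg k_small gamma0 C00 gB cg eps0 aeG.
have [K0 [K1 hK]] := summable_bounds a_sum.
have hK0 N : asum N a <= K0 by case: (hK N).
have K00 : 0 <= K0 by apply: le_trans (hK0 0%N); exact: asum_ge0.
have K10 : 0 <= K1 by have [_] := hK 0%N; apply: le_trans; exact: asum_ge0.
have B0 : 0 <= B by have /andP[/le_trans h /h] := gB 0.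
have Hunif := laurent_sum_uniform hK0 k_cvg.
set f := fun t : R => laurent_sum a k (expi t).
have f_lip s t : normc (f s - f t) <= 2 * K1 * `|s - t|.
  have hK1 N : asum N (fun j => j%:~R * a j) <= K1 by case: (hK N).
  apply: le_trans (laurent_sum_lipschitz hK1 Hunif (normc_expi s) (normc_expi t)) _.
  by rewrite -mulrA mulrCA; apply: ler_wpM2l => //; exact: expi_lipschitz.
(* Nodes have modulus at most [K0] and eigenvalues at most [K0 + 1], both within the radius [K - 2]
   where the kernel approximation holds. *)
have [K K2 hKK] := nat_large (K0 + 3).
have {}hKK := hKK _ (leqnn _).
have Kge2 : (2 <= K)%N.
  by rewrite -(ler_nat R); apply: le_trans hKK; lra.
have e3 : 0 < eps / 3 by rewrite divr_gt0.
have [s [D [L0 [s0 D0 L00 hker_approx]]]] := kernel_approx gB cg e3 Kge2.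
have La0 : 0 <= 2 * K1 by rewrite mulr_ge0.
have [L1 hL1] := good_points La0 f_lip aeG D0.
pose L := maxn L0 L1.
have [c c0 {}hker_approx] := hker_approx L (leq_maxl _ _).
have {hL1} := hL1 L (leq_maxr _ _).
set m := (D * L * K)%N in hker_approx *.
(* The grid points are chosen before [kappa] and [n], so only finitely many fixed exponents
   intervene. *)
move=> hz; pose zz p q := sval (cid (hz (p%:Z - m%:Z) (q%:Z - m%:Z))).
have zzP p q : [/\ in_cell (D * L) (zz p q) (p%:Z - m%:Z) (q%:Z - m%:Z),
    G (complex.Re (zz p q), complex.Im (zz p q)) &
    forall t, 0 <= t <= 2 * pi -> 2 * (L%:R ^+ 3)^-1 <= normc (f t - zz p q)].
  exact: (svalP (cid (hz (p%:Z - m%:Z) (q%:Z - m%:Z)))).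
have zz_cell p q : (p < m.*2)%N -> (q < m.*2)%N ->
  in_cell (D * L) (zz p q) (p%:Z - m%:Z) (q%:Z - m%:Z) by have [] := zzP p q.
have L_gt0 : (0 < L)%N by rewrite leq_max L00.
pose I := [seq zz p q | p <- index_iota 0 m.*2, q <- index_iota 0 m.*2].
have zzI p q : (p < m.*2)%N -> (q < m.*2)%N -> zz p q \in I.
  by move=> hp hq; apply/allpairsP; exists (p, q); rewrite !mem_index_iota.
exists I; split=> [z /allpairsP[[p q] [_ _ ->]]|kappa kappa0]; first by have [] := zzP p q.
(* Half of the distance given by [good_points]; the other half absorbs the passage from the limit
   curve to the truncated symbol. *)
pose c1 := (L%:R ^+ 3)^-1 : R.
have c10 : 0 < c1 by rewrite invr_gt0 exprn_gt0// ltr0n.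
(* Bounds both the distances from nodes to grid points, at most [(K - 2) + 2 K], and the norm [2 K0]
   of the part of low rank. *)
pose Kb := 3 * K%:R : R; have Kb0 : 0 <= Kb by rewrite mulr_ge0.
pose e1 := eps / 3 * c / (B * m.*2%:R ^+ 2 + 1).
have e10 : 0 < e1.
  by rewrite divr_gt0 ?mulr_gt0// ltr_wpDl// mulr_ge0// exprn_ge0.
have [de [de0 de1 dec deb]] : exists de : R, [/\ 0 < de, de <= 1, de <= c1 / 2 &
    8 * (2 * Kb + 1) ^+ 3 * de / s + 8 * de / c1 <= e1 / 2].
  by apply: small_noise => //; exact: divr_gt0.
pose ka := 2 * Kb + de.
near=> n => E hE hsig.
have n0 : (0 < n)%N by near: n; exists 1%N.
set A := toeplitz a (k_ n) n in hsig *; set M := perturbed _ _ _ _ in hsig *.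
pose N := ((n%:R : R) `^ (- alpha - gamma))%:C *: E.
have hN : opbound de N.
  apply: opboundW (perturbed_noise gamma n0 C00 hE).
  by near: n; exact: near_powRN_le.
have node_dom (i : 'I_n) : 0 <= i%:R * root_angle R n <= 2 * pi.
  exact: root_angle_dom.
have near_f t : normc (lsum (k_ n) a (expi t) - f t) <= c1.
  move: t; near: n; have [n1 hn1] := Hunif c1 c10.
  by exists n1 => // n nn t; exact: hn1.
pose x (i : 'I_n) := lsum (k_ n) a (expi (i%:R * root_angle R n)).
have x_le i : normc (x i) <= K%:R - 2.
  by apply: le_trans (lsum_le _ _ _) _; apply: le_trans (hK0 _) _; lra.
have x_far i p q : c1 <= normc (x i - zz p q).
  have [_ _ /(_ _ (node_dom i))] := zzP p q.
  have := ler_normc_distD (x i) (f (i%:R * root_angle R n)) (zz p q).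
  rewrite (normcB (f _) (x i)) -/c1; have := near_f (i%:R * root_angle R n).
  by rewrite -/(x i); lra.
have eig_le l : l \in eigenvalues M -> normc l <= K%:R - 2.
  have hM : opbound (asum (k_ n) a + de) M.
    exact: (opboundD (@opbound_toeplitz _ a (k_ n) n) hN).
  move=> /(eigenvalues_le hM) h; apply: le_trans h _.
  by have := hK0 (k_ n); lra.
have zz_le p q : (p < m.*2)%N -> (q < m.*2)%N -> normc (zz p q) <= 2 * K%:R.
  by move=> hp hq; have [+ _ _] := zzP p q; apply: cell_norm_le => //; rewrite muln_gt0 D0.
have MU : M = dft R n *m diag_mx (circulant_eigen a (k_ n) n) *m adj (dft R n)
    + N + (A - circulant a (k_ n) n).
  by rewrite -/(circulant a (k_ n) n) addrC addrA subrK.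
have rank_term : {in I, forall z, (2 * k_ n)%:R * (4 * ln (1 + 4 * ka ^+ 4 / s)
    + 4 * ln (1 + Kb / n%:R `^ (- kappa z))) <= n%:R * (e1 / 2)}.
  near: n; apply: near_allP => z zI; apply: near_rank_term => //; last 2 first.
  - exact: kappa0.
  - by rewrite divr_gt0.
  have ka0 : 0 <= ka by rewrite addr_ge0 ?mulr_ge0// ltW.
  apply: mulr_ge0 => //; apply: ln_ge0; rewrite lerDl; apply: divr_ge0; last exact: ltW.
  by rewrite mulr_ge0// exprn_ge0.
have kernel_le p q : (p < m.*2)%N -> (q < m.*2)%N ->
    \sum_(l <- eigenvalues M) hker s (l - zz p q)
    <= \sum_i hker s (x i - zz p q) + n%:R * e1.
  move=> hp hq; have zI := zzI _ _ hp hq.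
  have tau0 : 0 < n%:R `^ (- kappa (zz p q)) :> R by apply: powR_gt0; rewrite ltr0n.
  have hM := sigma_min_lowbound (hsig _ zI) (ltW tau0).
  have hd i : normc (circulant_eigen a (k_ n) n 0 i - zz p q) <= Kb.
    rewrite mxE -/(x i); apply: le_trans (le_normcB _ _) _.
    by move: (x_le i) (zz_le _ _ hp hq); rewrite /Kb; clear; lra.
  have hfar i : c1 <= normc (circulant_eigen a (k_ n) n 0 i - zz p q).
    by rewrite mxE; exact: x_far.
  have hL : opbound Kb (A - circulant a (k_ n) n).
    apply: opboundW (opboundD (@opbound_toeplitz _ a (k_ n) n)
      (opboundN (@opbound_circulant _ a (k_ n) n))).
    by move: (hK0 (k_ n)) hKK K00; rewrite /Kb; clear; lra.
  rewrite MU in hM *.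
  apply: le_trans (sum_hker_le s0 Kb0 (ltW de0) tau0 c10 dec (unitaryc_dft R n0)
    hd hfar hN hL (rank_toeplitz_sub_circulant a (k_ n) n) hM (erefl _)) _.
  rewrite -/ka -addrA; apply: lerD.
    by apply: ler_sum => i _; rewrite mxE.
  rewrite [X in _ <= X](_ : _ = n%:R * (e1 / 2) + n%:R * (e1 / 2)); last by field.
  apply: lerD.
    apply: ler_wpM2l => //; apply: le_trans deb; rewrite lerD2r.
    rewrite ler_pM2r ?invr_gt0// ler_pM2r// ler_pM2l//.
    apply: lerXn2r; rewrite ?nnegrE ?lerD2l// addr_ge0 ?mulr_ge0//; exact: ltW.
  exact: rank_term.
apply: (kernel_sum_le (size_eigenvalues M) c0 eps0 gB (erefl e1) _ _ kernel_le) => //.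
  by move=> l lM; have [+ _] := hker_approx _ zz_cell l (eig_le l lM).
move=> i; have [_ +] := hker_approx _ zz_cell (x i) (x_le i).
by apply => p q _ _; exact: x_far.
Unshelve. all: by end_near.
Qed.

End UpperBound.

(** * Integrals and Riemann sums *)

Section Measures.
Variable R : realType.
Local Notation C := R[i].
Local Notation circle_unif := (uniform_prob (@twopi_gt0 R)).

Lemma bounded_integrable d (S : measurableType d) (mu : {measure set S -> \bar R})
    (A : set S) (f : S -> R) (B : R) : measurable A -> (mu A < +oo)%E ->
  measurable_fun A f -> (forall x, `|f x| <= B) -> mu.-integrable A (EFin \o f).
Proof.
move=> mA fA mf fB; apply: measurable_bounded_integrable => //.
exists B; split => [|M BM x _]; first exact: num_real.
apply: le_trans (fB x) (ltW BM).
Qed.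

(** Lets formulas established for nonnegative integrands extend to bounded ones, by adding a
    constant to both sides. *)
Lemma Rintegral_shift d (S : measurableType d) (mu : {measure set S -> \bar R})
    (f : S -> R) (B : R) : mu setT = 1%E -> measurable_fun setT f ->
  (forall x, `|f x| <= B) ->
  (\int[mu]_x (f x + B) = \int[mu]_x f x + B)%R.
Proof.
move=> mu1 mf fB; have fin : (mu setT < +oo)%E by rewrite mu1 ltry.
rewrite RintegralD//.
- by rewrite Rintegral_cst// mu1 mulr1.
- exact: (@bounded_integrable _ _ mu setT f B).
- by apply: (@bounded_integrable _ _ mu setT (fun=> B) `|B|).
Qed.

Lemma esm_setT n (M : 'M[C]_n) : (0 < n)%N -> esm M setT = 1%E.
Proof.
move=> n0; have -> : esm M setT = ((n%:R^-1)%:E * \sum_(i < n) \d_((eigenvalues M)`_i : borelC R) setT)%E by [].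
rewrite (eq_bigr (fun=> 1%E)); last by move=> i _; rewrite diracT.
rewrite sumEFin sumr_const card_ord -EFinM mulVf// pnatr_eq0 -lt0n//.
Qed.

Lemma Rintegral_esm n (M : 'M[C]_n) (phi : C^o -> R) (B : R) : (0 < n)%N ->
  continuous phi -> (forall z, `|phi z| <= B) ->
  (\int[esm M]_z phi z)%R = n%:R^-1 * \sum_(l <- eigenvalues M) phi l.
Proof.
move=> n0 cphi phiB.
have mphi : measurable_fun [set: borelC R] (phi : borelC R -> R).
  by apply: (continuous_borelC_measurable cphi (f := id)); exact: measurable_id.
have ge0 (psi : borelC R -> R) : measurable_fun setT psi -> (forall z, 0 <= psi z) ->
    (\int[esm M]_z psi z)%R = n%:R^-1 * \sum_(l <- eigenvalues M) psi l.
  move=> mpsi psi0; rewrite /Rintegral /esm ge0_integral_mscale//=; last first.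
  - by move=> z _; rewrite lee_fin.
  - exact/measurable_EFinP.
  rewrite ge0_integral_measure_sum//=; last first.
  - exact/measurable_EFinP.
  - by move=> z _; rewrite lee_fin.
  rewrite (eq_bigr (fun i : 'I_n => (psi (eigenvalues M)`_i)%:E)); last first.
    move=> i _; rewrite integral_dirac//; last exact/measurable_EFinP.
    by rewrite diracT mul1e.
  rewrite sumEFin -EFinM /=; congr (_ * _).
  by rewrite (big_nth 0) size_eigenvalues big_mkord.
have := Rintegral_shift (esm_setT M n0) mphi phiB.
rewrite ge0; last 2 first.
- by apply: measurable_funD => //.
- by move=> z; have := phiB z; rewrite ler_norml => /andP[? _]; lra.
rewrite big_split /= big_const_seq count_predT size_eigenvalues iter_addr_0 -[B *+ n]mulr_natl.
rewrite mulrDr mulKf ?pnatr_eq0 -?lt0n// => /addIr; exact: esym.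
Qed.

Lemma Rintegral_itv_approx (h : R -> R) (B e x y : R) : measurable_fun setT h ->
  (forall t, `|h t| <= B) -> 0 <= x <= y ->
  (forall t, x <= t <= y -> `|h t - h x| <= e) ->
  `|(\int[lebesgue_measure]_(t in `[0, y]) h t)%R
    - (\int[lebesgue_measure]_(t in `[0, x]) h t)%R - (y - x) * h x| <= (y - x) * e.
Proof.
move=> mh hB /andP[x0 xy] he.
have int A : measurable A -> (lebesgue_measure A < +oo)%E ->
    lebesgue_measure.-integrable A (EFin \o h).
  by move=> mA fA; apply: (bounded_integrable mA fA _ hB); exact: measurable_funTS.
rewrite Rintegral_itvB ?bnd_simp//; last first.
  apply: int; rewrite ?lebesgue_measure_itv//=.
  by case: ifP => _; rewrite ?ltry// -EFinB ltry.
have leb : lebesgue_measure (`]x, y] : set R) = (y - x)%:E.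
  rewrite lebesgue_measure_itv /= lte_fin -EFinB.
  by case: ltgtP xy => // -> _; rewrite subrr.
have lebf : (lebesgue_measure (`]x, y] : set R) < +oo)%E by rewrite leb ltry.
have cst c : (\int[lebesgue_measure]_(t in `]x, y]) c)%R = (y - x) * c.
  by rewrite Rintegral_cst// mulrC; congr (_ * _); exact: (congr1 fine leb).
have icst c : lebesgue_measure.-integrable (`]x, y] : set R) (EFin \o (fun=> c)).
  by apply: (@bounded_integrable _ _ _ _ _ `|c|).
set I := (\int[_]_(_ in _) _)%R.
have lo : (y - x) * (h x - e) <= I.
  rewrite -cst; apply: le_Rintegral => // [|t]; first exact: int.
  rewrite /= in_itv /= => /andP[xt ty].
  by have := he t; rewrite ltW// ty => /(_ isT); rewrite ler_norml => /andP[? _]; lra.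
have hi : I <= (y - x) * (h x + e).
  rewrite -cst; apply: le_Rintegral => // [|t]; first exact: int.
  rewrite /= in_itv /= => /andP[xt ty].
  by have := he t; rewrite ltW// ty => /(_ isT); rewrite ler_norml => /andP[_ ?]; lra.
by move: lo hi; rewrite ler_norml mulrBr mulrDr; clear; lra.
Qed.

(** Induction over the intervals of length [w], comparing the integral over [[0, l w]] with the
    left-endpoint sum; each interval costs at most [w * e]. Nonnegativity serves
    [integral_uniform]. *)
Lemma riemann_sum_ge0 n (h : R -> R) (B e : R) : (0 < n)%N -> measurable_fun setT h ->
  (forall t, 0 <= h t <= B) ->
  (forall s t, `|s - t| <= root_angle R n -> `|h s - h t| <= e) ->
  `|\sum_(i < n) h (i%:R * root_angle R n) - n%:R * (\int[circle_unif]_t h t)%R|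
    <= n%:R * e.
Proof.
move=> n0 mh hB he; have nR : 0 < n%:R :> R by rewrite ltr0n.
have pi0 : 0 < pi :> R := pi_gt0 _.
set w := root_angle R n in he *.
have w0 : 0 < w by rewrite divr_gt0// mulr_gt0.
have hB' t : `|h t| <= B by have /andP[h0 h1] := hB t; rewrite ger0_norm.
pose F l := (\int[lebesgue_measure]_(t in `[0%R, (l%:R * w)%R]) h t)%R.
have step l : `|F l - w * \sum_(i < l) h (i%:R * w)| <= l%:R * (w * e).
  elim: l => [|l IH].
    rewrite big_ord0 mulr0 subr0 mul0r /F mul0r set_itv1 Rintegral_set1 normr0//.
  have Sl : l.+1%:R * w = l%:R * w + w by rewrite -(natr1 l) mulrDl mul1r.
  have := @Rintegral_itv_approx h B e (l%:R * w) (l.+1%:R * w) mh hB'.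
  rewrite -/(F l) -/(F l.+1) Sl (addrC (l%:R * w)) addrK addrC.
  rewrite mulr_ge0 ?(ltW w0)//= lerDl (ltW w0) => /(_ isT) h1.
  have {}h1 : `|F l.+1 - F l - w * h (l%:R * w)| <= w * e.
    apply: h1 => t /andP[t1 t2]; apply: he.
    by rewrite ger0_norm ?subr_ge0// lerBlDl.
  rewrite big_ord_recr /=; move: IH h1; set S := \sum_(i < l) _.
  rewrite -(natr1 l) mulrDl mul1r => IH h1; apply: le_trans (lerD IH h1).
  apply: le_trans (ler_normD _ _); rewrite le_eqVlt; apply/orP; left; apply/eqP.
  by congr (`|_|); ring.
have hint : (\int[circle_unif]_t h t)%R = (2 * pi)^-1 * F n.
  rewrite /Rintegral integral_uniform; last 2 first.
  - exact/measurable_EFinP.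
  - by move=> t; rewrite lee_fin; case/andP: (hB t).
  rewrite subr0 /F /Rintegral [n%:R * _]mulrC divfK ?gt_eqF// fineM//.
  have fin : (lebesgue_measure (`[0%R, (2 * pi)%R] : set R) < +oo)%E.
    rewrite lebesgue_measure_itv /=.
    by case: ifP => _; rewrite ?ltry// -EFinB ltry.
  apply: integrable_fin_num => //.
  by apply: (bounded_integrable _ fin _ hB') => //; exact: measurable_funTS.
have {step} := step n; rewrite hint.
set S := \sum_(i < n) _; move: (F n) => I hI.
rewrite distrC.
have -> : n%:R * ((2 * pi)^-1 * I) - S = w^-1 * (I - w * S).
  by rewrite mulrBr mulKf ?gt_eqF// invf_div mulrA.
rewrite normrM gtr0_norm ?invr_gt0// mulrC ler_pdivrMr//.
by apply: le_trans hI _; rewrite le_eqVlt; apply/orP; left; apply/eqP; ring.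
Qed.

Lemma riemann_sum n (h : R -> R) (B e : R) : (0 < n)%N -> measurable_fun setT h ->
  (forall t, `|h t| <= B) ->
  (forall s t, `|s - t| <= root_angle R n -> `|h s - h t| <= e) ->
  `|\sum_(i < n) h (i%:R * root_angle R n) - n%:R * (\int[circle_unif]_t h t)%R|
    <= n%:R * e.
Proof.
move=> n0 mh hB he; have shift (x y b : R) : x + b - (y + b) = x - y by ring.
have := @riemann_sum_ge0 n (fun t => h t + B) (2 * B) e n0 _ _ _.
rewrite (Rintegral_shift (mu := circle_unif) (probability_setT _) mh hB).
rewrite big_split /= sumr_const card_ord -[B *+ n]mulr_natl mulrDr shift; apply.
- exact: measurable_funD.
- by move=> t; have := hB t; rewrite ler_norml => /andP[? ?]; apply/andP; split; lra.
- by move=> s t st; rewrite shift; exact: he.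
Qed.

End Measures.

(** * Measurability along the circle and the law of the symbol *)

Section CurveLaw.
Variable R : realType.
Local Notation C := R[i].
Local Notation circle_unif := (uniform_prob (@twopi_gt0 R)).

Lemma continuous_normc : continuous (@normc R : C^o -> R).
Proof.
apply/continuousC_epsP => z e e0; exists e => // y.
apply: le_lt_trans; have := le_normcD (z - y) y; have := le_normcD (y - z) z.
by rewrite !subrK (normcB y z) ler_norml => h1 h2; apply/andP; split; lra.
Qed.

Lemma measurable_circle : measurable [set u : borelC R | normc u = 1].
Proof.
have mn : measurable_fun [set: borelC R] (@normc R : borelC R -> R).
  by apply: (continuous_borelC_measurable continuous_normc (f := id)); exact: measurable_id.
by have := mn measurableT _ (measurable_set1 (1 : R)); rewrite setTI.
Qed.

Lemma lipschitz_measurable (f : R -> C) (La : R) : 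
  (forall s t, normc (f s - f t) <= La * `|s - t|) ->
  measurable_fun [set: measurableTypeR R] (f : measurableTypeR R -> borelC R).
Proof.
move=> fL; have cf : continuous (f : R -> C^o).
  apply: continuousC_R => x e e0.
  have L0 : 0 < `|La| + 1 by rewrite ltr_wpDl.
  exists (e / (`|La| + 1)); first exact: divr_gt0.
  move=> y /=; rewrite ltr_pdivlMr// => h; apply: le_lt_trans (fL x y) _.
  apply: le_lt_trans h; rewrite mulrC; apply: ler_wpM2l => //.
  by apply: le_trans (ler_norm _) _; rewrite lerDl.
apply: (@measurability _ _ _ (borelC R) _ _ (@open C^o)) => // _ [A oA <-].
rewrite setTI; apply: open_measurable.
by apply: open_comp => // x _; exact: cf.
Qed.

(** Nothing is known about [S] off the circle, where a Laurent sum may diverge, so measurability is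
    proved on the circle only. *)
Lemma circle_lipschitz_measurable (S : C -> C) (K : R) :
  (forall u v, normc u = 1 -> normc v = 1 -> normc (S u - S v) <= K * normc (u - v)) ->
  forall B : set (borelC R), measurable B ->
    measurable [set u : borelC R | normc u = 1 /\ B (S u)].
Proof.
move=> SL; suff mS : measurable_fun [set u : borelC R | normc u = 1] (S : borelC R -> borelC R).
  by move=> B mB; exact: (mS measurable_circle B mB).
apply: (@measurability _ _ _ (borelC R) _ _ (@open C^o)) => // _ [A oA <-].
(* The implication holds vacuously off the circle, so the Lipschitz bound on the circle makes every
   point of the circle sent into [A] interior. *)
pose O := interior ([set v | normc v = 1 -> A (S v)] : set C^o).
have -> : [set u : borelC R | normc u = 1] `&` S @^-1` A
    = [set u : borelC R | normc u = 1] `&` (O : set (borelC R)).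
  apply/seteqP; split=> u [/= u1 h]; split => //; last by exact: (interior_subset h).
  have /nbhs_normcP[e e0 eA] : nbhs (S u : C^o) A by exact: open_nbhs_nbhs.
  have L0 : 0 < `|K| + 1 by rewrite ltr_wpDl.
  apply/nbhs_normcP; exists (e / (`|K| + 1)); first exact: divr_gt0.
  move=> v; rewrite ltr_pdivlMr// => uv v1; apply: eA.
  apply: le_lt_trans (SL _ _ u1 v1) _; apply: le_lt_trans uv.
  rewrite mulrC; apply: ler_wpM2l; first exact: normc_ge0.
  by apply: le_trans (ler_norm _) _; rewrite lerDl.
apply: measurableI; first exact: measurable_circle.
by apply: sub_sigma_algebra; exact: open_interior.
Qed.

Lemma laurent_sum_le (a : int -> C) (k_ : nat -> nat) (k : \bar R) K0 t :
  (forall N, asum N a <= K0) ->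
  (forall e : R, 0 < e -> exists n0, forall n t, (n0 <= n)%N ->
    normc (lsum (k_ n) a (expi t) - laurent_sum a k (expi t)) <= e) ->
  normc (laurent_sum a k (expi t)) <= K0.
Proof.
move=> hK hunif; apply/ler_addgt0Pr => e e0; have [n0 h] := hunif e e0.
have := h n0 t (leqnn _); rewrite normcB; set x := laurent_sum _ _ _.
have := le_trans (lsum_le a (k_ n0) t) (hK _); set y := lsum _ _ _ => h1 h2.
have := le_normcD (x - y) y; rewrite subrK => h3; lra.
Qed.

Theorem mean_nodes_cvg (a : int -> C) (k_ : nat -> nat) (k : \bar R) (K0 K1 : R)
    (phi : C^o -> R) (B eps : R) :
  (forall N, asum N a <= K0) -> (forall N, asum N (fun j => j%:~R * a j) <= K1) ->
  (forall e : R, 0 < e -> exists n0, forall n t, (n0 <= n)%N ->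
    normc (lsum (k_ n) a (expi t) - laurent_sum a k (expi t)) <= e) ->
  continuous phi -> (forall z, `|phi z| <= B) -> 0 < eps ->
  \forall n \near \oo,
    `|\sum_(i < n) phi (lsum (k_ n) a (expi (i%:R * root_angle R n)))
      - n%:R * (\int[circle_unif]_t phi (laurent_sum a k (expi t)))%R| <= n%:R * eps.
Proof.
move=> hK0 hK1 hunif cphi phiB eps0; set f := fun t => laurent_sum a k (expi t).
have f_lip s t : normc (f s - f t) <= 2 * K1 * `|s - t|.
  apply: le_trans (laurent_sum_lipschitz hK1 hunif (normc_expi s) (normc_expi t)) _.
  have K10 : 0 <= K1 by apply: le_trans (hK1 0%N); exact: asum_ge0.
  by rewrite -mulrA mulrCA; apply: ler_wpM2l => //; exact: expi_lipschitz.
have K10 : 0 <= K1 by apply: le_trans (hK1 0%N); exact: asum_ge0.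
have f_le t : normc (f t) <= K0 := laurent_sum_le t hK0 hunif.
have e2 : 0 < eps / 2 by rewrite divr_gt0.
have [de de0 hde] := ball_unif_continuous K0 cphi e2.
have mh : measurable_fun [set: measurableTypeR R] (phi \o f).
  exact: continuous_borelC_measurable cphi (lipschitz_measurable f_lip).
near=> n.
have n0 : (0 < n)%N by near: n; exists 1%N.
have nR : 0 < n%:R :> R by rewrite ltr0n.
have close t : normc (lsum (k_ n) a (expi t) - f t) <= de.
  move: t; near: n; have [n1 hn1] := hunif de de0.
  by exists n1 => // n nn t; exact: hn1.
have fine_mesh : 2 * K1 * root_angle R n <= de.
  rewrite /root_angle mulrA ler_pdivrMr// (mulrC de) -ler_pdivrMr//.
  by near: n; exact: near_nat_ge.
have h1 : `|\sum_(i < n) phi (f (i%:R * root_angle R n))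
    - n%:R * (\int[circle_unif]_t phi (f t))%R| <= n%:R * (eps / 2).
  apply: (riemann_sum n0 mh (fun t => phiB (f t))) => s t st; apply: hde; first exact: f_le.
  rewrite normcB; apply: le_trans (f_lip _ _) _; apply: le_trans fine_mesh.
  by apply: ler_wpM2l => //; exact: mulr_ge0.
have h2 : `|\sum_(i < n) phi (lsum (k_ n) a (expi (i%:R * root_angle R n)))
    - \sum_(i < n) phi (f (i%:R * root_angle R n))| <= n%:R * (eps / 2).
  rewrite -sumrB; apply: le_trans (ler_norm_sum _ _ _) _.
  have -> : n%:R * (eps / 2) = \sum_(i < n) (eps / 2).
    by rewrite sumr_const card_ord mulr_natl.
  apply: ler_sum => i _; apply: hde; first exact: f_le.
  by rewrite normcB; exact: close.
have -> : n%:R * eps = n%:R * (eps / 2) + n%:R * (eps / 2) by field.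
by apply: le_trans (ler_distD _ _ _) (lerD h2 h1).
Unshelve. all: by end_near.
Qed.

End CurveLaw.

(** * Measurability of the events *)

Section MeasurableEvents.
Variables (R : realType) (d : measure_display) (S : measurableType d).
Local Notation C := R[i].

Lemma cmeas_cst (c : C) : cmeas (fun _ : S => c).
Proof. by apply: cfun_cst => r; exact: measurable_cst. Qed.

Lemma cmeasD (f g : S -> C) : cmeas f -> cmeas g -> cmeas (fun w => f w + g w).
Proof. by apply: cfunD => ? ? ? ?; exact: measurable_funD. Qed.

Lemma cmeasM (f g : S -> C) : cmeas f -> cmeas g -> cmeas (fun w => f w * g w).
Proof.
apply: cfunM => [? ? ? ?|? ?|? ? ? ?].
- exact: measurable_funD.
- exact: measurableT_comp.
- exact: measurable_funM.
Qed.

Lemma cmeas_gram n (N : S -> 'M[C]_n) : (forall i j, cmeas (fun w => N w i j)) ->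
  forall i j, cmeas (fun w => (adj (N w) *m N w) i j).
Proof.
move=> mN i j; under eq_fun do rewrite mxE.
apply: cfun_sum => [?|? ? ? ?|k _]; first exact: measurable_cst.
  exact: measurable_funD.
apply: cmeasM; last exact: mN.
under eq_fun do rewrite !mxE.
by apply: cfun_conj; [move=> ? ?; exact: measurableT_comp | exact: mN].
Qed.

Lemma cmeas_borelC (f : S -> C) :
  measurable_fun setT (f : S -> borelC R) -> cmeas f.
Proof.
move=> mf; split.
  exact: (continuous_borelC_measurable (@continuous_Re R) mf).
exact: (continuous_borelC_measurable (@continuous_Im R) mf).
Qed.

Lemma cmeas_perturbed n (N : S -> 'M[C]_n) (alpha gamma : R) (A : 'M[C]_n) (z : C) :
  (forall i j, cmeas (fun w => N w i j)) ->
  forall i j, cmeas (fun w => (perturbed alpha gamma A (N w) - z%:M) i j).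
Proof.
move=> mN i j; under eq_fun do rewrite !mxE addrAC.
by apply: cmeasD; [exact: cmeas_cst | apply: cmeasM; [exact: cmeas_cst | exact: mN]].
Qed.

Lemma continuous_sqrt_Re : continuous ((fun l => Num.sqrt (complex.Re l)) : C^o -> R).
Proof.
move=> l; apply: (@continuous_comp _ _ _ (@complex.Re R : C^o -> R)).
  exact: continuous_Re.
exact: sqrt_continuous.
Qed.

(** For nonnegative [psi] this event is the zero set of a sum over the eigenvalues of the Gram
    matrix, which is measurable. *)
Lemma measurable_all_singular n (N : S -> 'M[C]_n) (psi : R -> R) :
  (forall i j, cmeas (fun w => N w i j)) -> continuous psi -> (forall s, 0 <= psi s) ->
  measurable [set w | all (fun s => psi s == 0) (singular_values (N w))].
Proof.
move=> mN cpsi psi0; pose phi (l : C) := psi (Num.sqrt (complex.Re l)).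
have cphi : continuous (phi : C^o -> R).
  move=> l; apply: (@continuous_comp _ _ _ (fun l : C^o => Num.sqrt (complex.Re l))).
    exact: continuous_sqrt_Re.
  exact: cpsi.
have mphi := measurable_sum_eigenvalues (cmeas_gram mN) cphi.
have := mphi measurableT _ (measurable_set1 (0 : R)); rewrite setTI.
congr (measurable _); apply/seteqP; split=> w /=; rewrite all_map.
  by move=> /eqP; rewrite psumr_eq0// => l _; exact: psi0.
by move=> h; apply/eqP; rewrite psumr_eq0// => l _; exact: psi0.
Qed.

(** Twice the positive part: a continuous nonnegative function that turns inequalities on singular
    values into the vanishing condition of [measurable_all_singular]. *)
Lemma excess_eq0 (x : R) : (`|x| + x == 0) = (x <= 0).
Proof. by rewrite addr_eq0 eqr_normN. Qed.

Lemma excess_ge0 (x : R) : 0 <= `|x| + x.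
Proof. by rewrite -lerBlDr sub0r -normrN ler_norm. Qed.

Lemma continuous_excess (psi : R -> R) : continuous psi ->
  continuous (fun s => `|psi s| + psi s).
Proof.
move=> cpsi s; apply: (@continuousD _ _ _ (fun s => `|psi s|) psi); last exact: cpsi.
by apply: (@continuous_comp _ _ _ psi); [exact: cpsi | exact: norm_continuous].
Qed.

Lemma spectral_norm_ge0 n (M : 'M[C]_n) : 0 <= spectral_norm M.
Proof.
rewrite /spectral_norm; set A := [set _ | _ in _].
have [hs|hs] := pselect (has_sup A); last by rewrite sup_out.
apply: ub_le_sup; first by case: hs.
by exists 0; rewrite /= ?mulmx0 l2norm0.
Qed.

Lemma measurable_spectral_norm_le n (N : S -> 'M[C]_n) (c : R) :
  (forall i j, cmeas (fun w => N w i j)) ->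
  measurable [set w | spectral_norm (N w) <= c].
Proof.
move=> mN; have [c0|c0] := leP 0 c.
  have -> : [set w | spectral_norm (N w) <= c]
      = [set w | all (fun s => `|s - c| + (s - c) == 0) (singular_values (N w))].
    apply/funext => w; rewrite /= spectral_norm_le//; congr is_true.
    by apply: eq_all => s; rewrite excess_eq0 subr_le0.
  apply: measurable_all_singular => // [|s]; last exact: excess_ge0.
  apply: continuous_excess => s; apply: continuousB => //; exact: cst_continuous.
rewrite (_ : [set w | _] = set0)//; apply/seteqP; split=> // w /= h.
by have := lt_le_trans c0 (spectral_norm_ge0 (N w)); rewrite ltNge h.
Qed.

(** Trades a strict inequality on an infimum for a countable union of non-strict conditions on all
    singular values. *)
Lemma sigma_min_gtP n (M : 'M[C]_n) (c : R) : (0 < n)%N ->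
  c < sigma_min M <-> exists k, all (fun s => c + k.+1%:R^-1 <= s) (singular_values M).
Proof.
move=> n0; have lb : has_lbound [set` singular_values M].
  by exists 0 => s /= /mapP[l _ ->]; exact: sqrtr_ge0.
have ne : [set` singular_values M] !=set0.
  have : size (singular_values M) = n by rewrite size_map size_eigenvalues.
  case: (singular_values M) => [|s ss _]; first by move=> e; rewrite -e in n0.
  by exists s; rewrite /= inE eqxx.
split=> [/ltr_add_invr[k hk]|[k /allP h]].
  exists k; apply/allP => s hs; apply: le_trans (ltW hk) _.
  exact: ge_inf.
apply: (@lt_le_trans _ _ (c + k.+1%:R^-1)); first by rewrite ltrDl invr_gt0.
by apply: lb_le_inf => // s /=; exact: h.
Qed.

Lemma measurable_sigma_min_le n (N : S -> 'M[C]_n) (c : R) :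
  (forall i j, cmeas (fun w => N w i j)) ->
  measurable [set w | sigma_min (N w) <= c].
Proof.
case: n N => [|n] N mN.
  rewrite (_ : [set w | _] = [set _ | sigma_min (0 : 'M[C]_0) <= c]).
    by have [h|h] := pselect (is_true (sigma_min (0 : 'M[C]_0) <= c));
      [rewrite (_ : [set _ | _] = setT) | rewrite (_ : [set _ | _] = set0)] => //;
      apply/seteqP; split.
  by apply/seteqP; split=> w /=; rewrite (flatmx0 (N w)).
rewrite -[[set w | _]]setCK; apply: measurableC.
have -> : ~` [set w | sigma_min (N w) <= c]
    = \bigcup_k [set w | all (fun s => c + k.+1%:R^-1 <= s) (singular_values (N w))].
  apply/seteqP; split=> w /=.
    by move=> /negP; rewrite -ltNge => /(sigma_min_gtP (N w) c (ltn0Sn n)).1[k hk]; exists k.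
  move=> [k _ hk]; apply/negP; rewrite -ltNge.
  by apply/(sigma_min_gtP (N w) c (ltn0Sn n)); exists k.
apply: bigcupT_measurable => k; set x := c + _.
have -> : [set w | all (fun s => x <= s) (singular_values (N w))]
    = [set w | all (fun s => `|x - s| + (x - s) == 0) (singular_values (N w))].
  apply/funext => w /=; congr is_true.
  by apply: eq_all => s; rewrite excess_eq0 subr_le0.
apply: measurable_all_singular => // [|s]; last exact: excess_ge0.
apply: (@continuous_excess (fun s => x - s)) => s.
by apply: (@continuousB _ _ _ (fun=> x) id); [exact: cst_continuous | exact: cvg_id].
Qed.

Lemma cintegral_esmE n (M : 'M[C]_n) (g : C^o -> C^o) (B : R) : (0 < n)%N ->
  continuous g -> (forall z, normc (g z) <= B) ->
  cintegral (esm M) g = (n%:R^-1 * \sum_(l <- eigenvalues M) complex.Re (g l))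
     +i* (n%:R^-1 * \sum_(l <- eigenvalues M) complex.Im (g l)).
Proof.
move=> n0 /continuous_comp_ReIm[cR cI] gB; congr (_ +i* _).
  by apply: (Rintegral_esm M n0 cR (B := B)) => z; apply: le_trans (gB z); exact: Re_normc.
by apply: (Rintegral_esm M n0 cI (B := B)) => z; apply: le_trans (gB z); exact: Im_normc.
Qed.

Lemma measurable_cintegral_dev n (N : S -> 'M[C]_n) (g : C^o -> C^o) (B eps : R) (c : C) :
  (0 < n)%N -> (forall i j, cmeas (fun w => N w i j)) -> continuous g ->
  (forall z, normc (g z) <= B) ->
  measurable [set w | eps < normc (cintegral (esm (N w)) g - c)].
Proof.
move=> n0 mN cg gB; have [cR cI] := continuous_comp_ReIm cg.
pose dR w := n%:R^-1 * (\sum_(l <- eigenvalues (N w)) complex.Re (g l)) - complex.Re c.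
pose dI w := n%:R^-1 * (\sum_(l <- eigenvalues (N w)) complex.Im (g l)) - complex.Im c.
have mR : measurable_fun setT dR.
  by apply: measurable_funB => //; apply: measurable_funM => //; exact: measurable_sum_eigenvalues.
have mI : measurable_fun setT dI.
  by apply: measurable_funB => //; apply: measurable_funM => //; exact: measurable_sum_eigenvalues.
have mh : measurable_fun setT (fun w => Num.sqrt (dR w ^+ 2 + dI w ^+ 2)).
  apply: (@measurableT_comp _ _ _ _ _ _ (@Num.sqrt R)).
    by apply: continuous_measurable_fun; exact: sqrt_continuous.
  by apply: measurable_funD; exact: measurable_funX.
have := mh measurableT _ (measurable_itv `]eps, +oo[); rewrite setTI.
congr (measurable _); apply/funext => w /=; rewrite in_itv /= andbT.
by rewrite (cintegral_esmE _ n0 cg gB) /dR /dI; clear; case: c.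
Qed.

End MeasurableEvents.

(** * Convergence in probability *)

Section Convergence.
Variable R : realType.
Local Notation C := R[i].
Local Notation leb2 := (lebesgue_measure \x lebesgue_measure)%E.
Local Notation circle_unif := (uniform_prob (@twopi_gt0 R)).

Lemma mem_catl (I : eqType) (s2 s1 : seq I) x : x \in s1 -> x \in s1 ++ s2.
Proof. by rewrite mem_cat => ->. Qed.

Lemma mem_catr (I : eqType) (s1 s2 : seq I) x : x \in s2 -> x \in s1 ++ s2.
Proof. by rewrite mem_cat orbC => ->. Qed.

Theorem esm_integral_close (a : int -> C) (k_ : nat -> nat) (k : \bar R)
    (gamma alpha C0 : R) (phi : C^o -> R) (B eps : R) (G : R * R -> Prop) :
  (\esum_(j in [set: int]) (normc (j%:~R * a j))%:E < +oo)%E ->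
  (k_ n)%:R%:E @[n --> \oo] --> k ->
  (fun n => (k_ n)%:R : R) =o_\oo (fun n => n%:R / ln n%:R) ->
  0 < gamma -> 0 <= C0 -> continuous phi -> (forall z, `|phi z| <= B) ->
  0 < eps -> {ae leb2, forall xy, G xy} ->
  exists I : seq C, {in I, forall z, G (complex.Re z, complex.Im z)} /\
  forall kappa : C -> R, {in I, forall z, 0 < kappa z} ->
  \forall n \near \oo, forall E : 'M[C]_n,
    spectral_norm E <= C0 * n%:R `^ alpha ->
    {in I, forall z, n%:R `^ (- kappa z) <=
       sigma_min (perturbed alpha gamma (toeplitz a (k_ n) n) E - z%:M)} ->
    `|(\int[esm (perturbed alpha gamma (toeplitz a (k_ n) n) E)]_z phi z)%R
      - (\int[circle_unif]_t phi (laurent_sum a k (expi t)))%R| <= eps.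
Proof.
move=> a_sum k_cvg k_small gamma0 C00 cphi phiB eps0 aeG.
have e2 : 0 < eps / 2 by rewrite divr_gt0.
pose up (z : C^o) := B + phi z; pose dn (z : C^o) := B - phi z.
have up_bd z : 0 <= up z <= 2 * B.
  by have := phiB z; rewrite ler_norml /up => /andP[? ?]; apply/andP; split; lra.
have dn_bd z : 0 <= dn z <= 2 * B.
  by have := phiB z; rewrite ler_norml /dn => /andP[? ?]; apply/andP; split; lra.
have c_up : continuous up.
  by move=> z; apply: (@continuousD _ _ _ (fun=> B) phi); [exact: cst_continuous | exact: cphi].
have c_dn : continuous dn.
  by move=> z; apply: (@continuousB _ _ _ (fun=> B) phi); [exact: cst_continuous | exact: cphi].
have [I1 [I1G h1]] := sum_eigenvalues_le alpha a_sum k_cvg k_small gamma0 C00 up_bd c_up e2 aeG.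
have [I2 [I2G h2]] := sum_eigenvalues_le alpha a_sum k_cvg k_small gamma0 C00 dn_bd c_dn e2 aeG.
exists (I1 ++ I2); split=> [z|kappa kp0].
  by rewrite mem_cat => /orP[/I1G|/I2G].
have {}h1 := h1 kappa (fun z zI => kp0 z (mem_catl I2 zI)).
have {}h2 := h2 kappa (fun z zI => kp0 z (mem_catr I1 zI)).
have [K0 [K1 hK]] := summable_bounds a_sum.
have hK0 N : asum N a <= K0 by case: (hK N).
have hK1 N : asum N (fun j => j%:~R * a j) <= K1 by case: (hK N).
have h3 := mean_nodes_cvg hK0 hK1 (laurent_sum_uniform hK0 k_cvg) cphi phiB e2.
near=> n => E hE hsig.
have n0 : (0 < n)%N by near: n; exists 1%N.
have nR : 0 < n%:R :> R by rewrite ltr0n.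
have : `|\sum_(i < n) phi (lsum (k_ n) a (expi (i%:R * root_angle R n)))
    - n%:R * (\int[circle_unif]_t phi (laurent_sum a k (expi t)))%R| <= n%:R * (eps / 2).
  by near: n; exact: h3.
rewrite (Rintegral_esm _ n0 cphi phiB); set M := perturbed _ _ _ _ in hsig *.
have : \sum_(l <- eigenvalues M) up l
    <= \sum_(i < n) up (lsum (k_ n) a (expi (i%:R * root_angle R n))) + n%:R * (eps / 2).
  have hs1 : {in I1, forall z, n%:R `^ (- kappa z) <= sigma_min (M - z%:M)}.
    by move=> z zI; apply: hsig; exact: mem_catl.
  by move: E hE @M hs1 {hsig}; near: n; exact: h1.
have : \sum_(l <- eigenvalues M) dn l
    <= \sum_(i < n) dn (lsum (k_ n) a (expi (i%:R * root_angle R n))) + n%:R * (eps / 2).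
  have hs2 : {in I2, forall z, n%:R `^ (- kappa z) <= sigma_min (M - z%:M)}.
    by move=> z zI; apply: hsig; exact: mem_catr.
  by move: E hE @M hs2 {hsig}; near: n; exact: h2.
(* Spectrum and nodes both have [n] points, so the constant contributes [n * B] to each side and
   cancels. *)
rewrite /dn /up !big_split /= !sumrN !sumr_const card_ord.
rewrite !big_const_seq !count_predT size_eigenvalues iter_addr_0.
set u := \sum_(l <- _) _; set v := \sum_(i < n) _; move: (Rintegral _ _ _) => J.
move=> d1 d2 d3.
have uv : `|u - v| <= n%:R * (eps / 2) by rewrite ler_norml; apply/andP; split; lra.
have -> : n%:R^-1 * u - J = n%:R^-1 * (u - n%:R * J) by rewrite mulrBr mulKf ?gt_eqF.
rewrite normrM gtr0_norm ?invr_gt0// mulrC ler_pdivrMr//.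
have -> : eps * n%:R = n%:R * (eps / 2) + n%:R * (eps / 2) by field.
by apply: le_trans (ler_distD v _ _) (lerD uv d3).
Unshelve. all: by end_near.
Qed.

(** Convergence to 0 for nonnegative terms, in a form that passes to unions and smaller events
    without discussing finiteness. *)
Definition vanishing (u : nat -> \bar R) :=
  forall e : R, 0 < e -> \forall n \near \oo, (u n <= e%:E)%E.

Lemma vanishingP (u : nat -> \bar R) : (forall n, (0 <= u n)%E) ->
  u n @[n --> \oo] --> 0%E <-> vanishing u.
Proof.
move=> u0; split=> [/fine_cvgP[fu /cvgrPdist_le cu] e e0|hu].
  apply: filterS2 fu (cu e e0) => n fn; rewrite sub0r normrN /= => h.
  rewrite -(fineK fn) lee_fin; apply: le_trans h; exact: ler_norm.
apply/fine_cvgP; split.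
  apply: filterS (hu 1 ltr01) => n h.
  by rewrite ge0_fin_numE//; apply: le_lt_trans h _; exact: ltry.
apply/cvgrPdist_le => e e0; apply: filterS (hu e e0) => n h.
have fn : u n \is a fin_num.
  by rewrite ge0_fin_numE//; apply: le_lt_trans h _; exact: ltry.
rewrite sub0r normrN ger0_norm /= ?fine_ge0//.
by rewrite -lee_fin fineK.
Qed.

Section Events.
Variables (d : nat -> measure_display) (T : forall n, measurableType (d n)).
Variable P : forall n, probability (T n) R.

Lemma vanishing_compl (A : forall n, set (T n)) : (forall n, measurable (A n)) ->
  P n (A n) @[n --> \oo] --> 1%E -> vanishing (fun n => P n (~` A n)).
Proof.
move=> mA /fine_cvgP[_ /cvgrPdist_le cA] e e0; apply: filterS (cA e e0) => n h.
rewrite probability_setC// -(fineK (fin_num_measure (P n) _ (mA n))) -EFinB lee_fin.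
by apply: le_trans h; exact: ler_norm.
Qed.

Lemma vanishingU (A B : forall n, set (T n)) : (forall n, measurable (A n)) ->
  (forall n, measurable (B n)) -> vanishing (fun n => P n (A n)) ->
  vanishing (fun n => P n (B n)) -> vanishing (fun n => P n (A n `|` B n)).
Proof.
move=> mA mB vA vB e e0; have e2 : 0 < e / 2 by rewrite divr_gt0.
apply: filterS2 (vA _ e2) (vB _ e2) => n hA hB.
apply: le_trans (measureU2 _ (mA n) (mB n)) _.
by apply: le_trans (leeD hA hB) _; rewrite -EFinD lee_fin -splitr.
Qed.

Lemma vanishing_bigcup (I : eqType) (s : seq I) (A : I -> forall n, set (T n)) :
  (forall i n, measurable (A i n)) -> {in s, forall i, vanishing (fun n => P n (A i n))} ->
  exists B : forall n, set (T n), [/\ forall n, measurable (B n),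
    vanishing (fun n => P n (B n)) &
    forall n w, ~ B n w -> {in s, forall i, ~ A i n w}].
Proof.
move=> mA; elim: s => [|i s IH] vA.
  exists (fun n => set0); split=> // e e0; near=> n.
  by rewrite measure0 lee_fin ltW.
have [|B [mB vB hB]] := IH; first by move=> j js; apply: vA; rewrite inE js orbT.
exists (fun n => A i n `|` B n); split=> [n||n w /not_orP[nA nB] j].
- exact: measurableU.
- by apply: vanishingU => //; apply: vA; exact: mem_head.
- by rewrite inE => /predU1P[->//|js]; exact: (hB n w nB j js).
Unshelve. all: by end_near.
Qed.

Lemma vanishing_sub (A B : forall n, set (T n)) : 
  (\forall n \near \oo, measurable (A n) /\ A n `<=` B n) ->
  (forall n, measurable (B n)) ->
  vanishing (fun n => P n (B n)) -> vanishing (fun n => P n (A n)).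
Proof.
move=> AB mB vB e e0; apply: filterS2 AB (vB e e0) => n [mA sAB] h.
by apply: le_trans h; apply: le_measure; rewrite ?inE.
Qed.

(** Outside one bad event (norm of [E] too large, or a singular value too small at one of finitely
    many points) the deviation is at most [eps] for every matrix once [n] is large. The deviation
    event thus lies in a vanishing one. Real and imaginary parts take [eps / 2] each. *)
Theorem cvg_to_curve_law (a : int -> C) (k_ : nat -> nat) (k : \bar R)
    (gamma alpha : R) (E : forall n, T n -> 'M[C]_n)
    (mu : {measure set (borelC R) -> \bar R}) :
  (\esum_(j in [set: int]) (normc (j%:~R * a j))%:E < +oo)%E ->
  (k_ n)%:R%:E @[n --> \oo] --> k ->
  (fun n => (k_ n)%:R : R) =o_\oo (fun n => n%:R / ln n%:R) -> 0 < gamma ->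
  (forall n (i j : 'I_n), measurable_fun [set: T n] (fun w => E n w i j : borelC R)) ->
  (exists C0 : R, P n [set w | spectral_norm (E n w) <= C0 * n%:R `^ alpha]
     @[n --> \oo] --> 1%E) ->
  {ae leb2, forall xy : R * R, exists kappa : R, 0 < kappa /\
     P n [set w | sigma_min
            (perturbed alpha gamma (toeplitz a (k_ n) n) (E n w)
             - (xy.1 +i* xy.2)%:M) <= n%:R `^ (- kappa)] @[n --> \oo] --> 0%E} ->
  (forall (phi : C^o -> R) (B : R), continuous phi -> (forall z, `|phi z| <= B) ->
     (\int[mu]_z phi z)%R = (\int[circle_unif]_t phi (laurent_sum a k (expi t)))%R) ->
  cvg_weakly_in_prob P
    (fun n w => esm (perturbed alpha gamma (toeplitz a (k_ n) n) (E n w))) mu.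
Proof.
move=> a_sum k_cvg k_small gamma0 E_meas [C1 E_norm] aeG muE g cg [B gB] eps eps0.
apply/vanishingP => [n|]; first exact: measure_ge0.
have [cR cI] := continuous_comp_ReIm cg.
have mE n i j : cmeas (fun w => E n w i j) := cmeas_borelC (E_meas n i j).
(* The given constant [C1] carries no sign, while the comparison wants a nonnegative one. *)
pose C0 := Num.max C1 0; have C00 : 0 <= C0 by rewrite le_max lexx orbT.
have e2 : 0 < eps / 2 by rewrite divr_gt0.
have Rbd z : `|(@complex.Re R \o g) z| <= B by apply: le_trans (gB z); exact: Re_normc.
have Ibd z : `|(@complex.Im R \o g) z| <= B by apply: le_trans (gB z); exact: Im_normc.
have [I1 [I1G h1]] := esm_integral_close alpha a_sum k_cvg k_small gamma0 C00 cR Rbd e2 aeG.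
have [I2 [I2G h2]] := esm_integral_close alpha a_sum k_cvg k_small gamma0 C00 cI Ibd e2 aeG.
pose I := I1 ++ I2.
pose M n w := perturbed alpha gamma (toeplitz a (k_ n) n) (E n w).
have IG z : z \in I -> exists kappa : R, 0 < kappa /\
    P n [set w | sigma_min (M n w - z%:M) <= n%:R `^ (- kappa)] @[n --> \oo] --> 0%E.
  have e u : complex.Re u +i* complex.Im u = u :> C by case: u.
  by rewrite mem_cat => /orP[/I1G|/I2G]; rewrite /= e.
(* Exponents are given point by point; choice collects them into a function, with the default 0 off
   [I]. *)
have [kappa hk] : exists kappa : C -> R, {in I, forall z, 0 < kappa z /\
    P n [set w | sigma_min (M n w - z%:M) <= n%:R `^ (- kappa z)] @[n --> \oo] --> 0%E}.
  have : forall z, exists kp : R, z \in I -> 0 < kp /\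
      P n [set w | sigma_min (M n w - z%:M) <= n%:R `^ (- kp)] @[n --> \oo] --> 0%E.
    move=> z; have [/IG[kp hkp]|nI] := boolP (z \in I); first by exists kp.
    by exists 0 => zI; case/negP: nI.
  by move=> /choice[kappa hk]; exists kappa => z; exact: hk.
have kp0 z : z \in I -> 0 < kappa z by case/hk.
have {}h1 := h1 kappa (fun z zI => kp0 z (mem_catl I2 zI)).
have {}h2 := h2 kappa (fun z zI => kp0 z (mem_catr I1 zI)).
pose Sig z n := [set w | sigma_min (M n w - z%:M) <= n%:R `^ (- kappa z)].
have mSig z n : measurable (Sig z n).
  by apply: measurable_sigma_min_le; exact: cmeas_perturbed.
have vSig : {in I, forall z, vanishing (fun n => P n (Sig z n))}.
  by move=> z /hk[_ h]; apply/vanishingP => // n; exact: measure_ge0.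
have [Bad [mBad vBad hBad]] := vanishing_bigcup mSig vSig.
pose Nrm n := [set w | spectral_norm (E n w) <= C1 * n%:R `^ alpha].
have mNrm n : measurable (Nrm n) by exact: measurable_spectral_norm_le.
have vNrm := vanishing_compl mNrm E_norm.
have mNrmC n : measurable (~` Nrm n) by exact: measurableC.
apply: (vanishing_sub _ _ (vanishingU mNrmC mBad vNrm vBad)); last first.
  by move=> n; exact: measurableU.
near=> n; have n0 : (0 < n)%N by near: n; exists 1%N.
split.
  apply: (measurable_cintegral_dev _ _ n0 _ cg gB) => i j.
  have := cmeas_perturbed alpha gamma (toeplitz a (k_ n) n) 0 (mE n) i j.
  by under eq_fun do rewrite raddf0 subr0.
move=> w /=; apply: contraPP => /not_orP[/contrapT hN /hBad hS]; apply/negP.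
rewrite -leNgt.
have hE : spectral_norm (E n w) <= C0 * n%:R `^ alpha.
  apply: le_trans hN _; apply: ler_wpM2r; first exact: powR_ge0.
  by rewrite le_max lexx.
have hsig z : z \in I -> n%:R `^ (- kappa z) <= sigma_min (M n w - z%:M).
  by move=> /hS /negP; rewrite -ltNge; exact: ltW.
have d1 : `|(\int[esm (M n w)]_z (@complex.Re R \o g) z)%R
     - (\int[mu]_z (@complex.Re R \o g) z)%R| <= eps / 2.
  rewrite (muE _ _ cR Rbd).
  have hs z : z \in I1 -> n%:R `^ (- kappa z) <= sigma_min (M n w - z%:M).
    by move=> zI; apply: hsig; exact: mem_catl.
  move: hE hs; rewrite /M; move: (E n w) => F.
  by move: F; near: n; exact: h1.
have d2 : `|(\int[esm (M n w)]_z (@complex.Im R \o g) z)%R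
     - (\int[mu]_z (@complex.Im R \o g) z)%R| <= eps / 2.
  rewrite (muE _ _ cI Ibd).
  have hs z : z \in I2 -> n%:R `^ (- kappa z) <= sigma_min (M n w - z%:M).
    by move=> zI; apply: hsig; exact: mem_catr.
  move: hE hs; rewrite /M; move: (E n w) => F.
  by move: F; near: n; exact: h2.
rewrite [leRHS]splitr; apply: le_trans (lerD d1 d2).
exact: (normc_ReIm (cintegral (esm (M n w)) g - cintegral mu g)).
Unshelve. all: by end_near.
Qed.

End Events.
End Convergence.

Theorem theorem3p1 (R : realType) (a : int -> R[i])
  (a_summable : (\esum_(j in [set: int]) (normc (j%:~R * a j))%:E < +oo)%E)
  (k_ : nat -> nat) (k : \bar R)
  (k_cvg : (k_ n)%:R%:E @[n --> \oo] --> k)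
  (k_small : (fun n => (k_ n)%:R : R) =o_\oo (fun n => n%:R / ln n%:R))
  (gamma : R) (gamma_gt0 : 0 < gamma)
  (d : nat -> measure_display) (T : forall n, measurableType (d n))
  (P : forall n, probability (T n) R)
  (E : forall n, T n -> 'M[R[i]]_n)
  (E_meas : forall n (i j : 'I_n),
    measurable_fun [set: T n] (fun w => E n w i j : borelC R))
  (alpha : R) (alpha_ge0 : 0 <= alpha)
  (E_norm : exists C : R,
    P n [set w | spectral_norm (E n w) <= C * n%:R `^ alpha]
      @[n --> \oo] --> 1%E)
  (E_sigma_min :
    {ae (lebesgue_measure \x lebesgue_measure)%E, forall xy : R * R,
      exists kappa : R, 0 < kappa /\
        P n [set w | sigma_min
                       (perturbed alpha gamma (toeplitz a (k_ n) n) (E n w)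
                        - (xy.1 +i* xy.2)%:M) <= n%:R `^ (- kappa)]
          @[n --> \oo] --> 0%E}) :
  exists mu : probability (borelC R) R,
    cvg_weakly_in_prob P
      (fun n w => esm (perturbed alpha gamma (toeplitz a (k_ n) n) (E n w)))
      mu /\
    forall (d' : measure_display) (W : measurableType d')
      (Q : probability W R) (U : {RV Q >-> borelC R}),
      uniform_on_circle U ->
      forall B : set (borelC R), measurable B ->
        mu B = Q [set w | B (laurent_sum a k (U w))].
Proof.
have [K0 [K1 hK]] := summable_bounds a_summable.
have hK0 N : asum N a <= K0 by case: (hK N).
have hK1 N : asum N (fun j => j%:~R * a j) <= K1 by case: (hK N).
have S_lip u v : normc u = 1 -> normc v = 1 ->
    normc (laurent_sum a k u - laurent_sum a k v) <= K1 * normc (u - v).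
  exact: laurent_sum_lipschitz hK1 (laurent_sum_uniform hK0 k_cvg).
have K10 : 0 <= K1 by apply: le_trans (hK1 0%N); exact: asum_ge0.
pose f (t : measurableTypeR R) : borelC R := laurent_sum a k (expi t).
have mf : measurable_fun [set: measurableTypeR R] f.
  apply: (@lipschitz_measurable R f (2 * K1)) => s t.
  apply: le_trans (S_lip _ _ (normc_expi s) (normc_expi t)) _.
  by rewrite -mulrA mulrCA; apply: ler_wpM2l => //; exact: expi_lipschitz.
(* The limit is the image under [f] of the uniform law on angles, so no variable [U] is needed to
   define it. *)
exists (distribution (uniform_prob (@twopi_gt0 R)) (mfun_Sub (mem_set mf))); split.
  apply: (cvg_to_curve_law a_summable k_cvg k_small gamma_gt0 E_meas E_norm
    E_sigma_min) => phi B cphi phiB.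
  have mphi : measurable_fun [set: borelC R] (phi : borelC R -> R).
    by apply: (continuous_borelC_measurable cphi (f := id)); exact: measurable_id.
  rewrite /Rintegral integral_pushforward//.
  - exact/measurable_EFinP.
  - apply: (@bounded_integrable R _ _ (uniform_prob (@twopi_gt0 R)) setT (phi \o f) B) => //.
    + exact: le_lt_trans (probability_le1 _ measurableT) (ltry 1).
    + exact: measurableT_comp.
    + by move=> t; exact: phiB.
move=> d' W Q U [U1 U_unif] B mB.
(* The law of [U] is tested on the part of the circle sent into [B], a Borel set; its preimages
   under [expi] and under [U] are those of [B], since both take values on the circle. *)
have := U_unif _ (circle_lipschitz_measurable S_lip mB).
have -> : @expi R @^-1` [set u : borelC R | normc u = 1 /\ B (laurent_sum a k u)] = f @^-1` B.
  by apply/seteqP; split=> t /= => [[]|] // Bt; split=> //; exact: normc_expi.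
move=> h; apply: etrans (esym h) _; rewrite /distribution /pushforward; congr (Q _).
by apply/seteqP; split=> w /= => [[]|].
Qed.
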